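(* Let $\epsilon>0$ and $\phi\in H^{\infty}(\mathbb R)$. Let $u$ solve the Airy equation $\partial_tu+\partial_xu+\frac{\epsilon}{6}\partial_x^3u=0$ with $u(\cdot,0)=\phi$, and let $v$ solve the linear Whitham equation $\partial_tv+l(\sqrt{\epsilon}D)\partial_xv=0$ with $v(\cdot,0)=\phi$. Then for every integer $j\ge0$ there exists $N_j>0$, depending only on $j$ and $\|\phi\|_{H^{j+7}}$, such that $$\|\partial_x^j(u-v)(t)\|_{L^\infty_x}\le N_j\,\epsilon^2(1+t)\qquad\text{for all } t\ge 0.$$
   Context: $D=-i\partial_x$, and $l(\sqrt{\epsilon}D)$ denotes the Fourier multiplier with symbol $l(\sqrt{\epsilon}\xi)=\left(\frac{\tanh(\sqrt{\epsilon}|\xi|)}{\sqrt{\epsilon}|\xi|}\right)^{1/2}$. $H^{\infty}(\mathbb R)=\bigcap_{s\ge0}H^s(\mathbb R)$. *)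

(* Defs.v *)
From HB Require Import structures.
From mathcomp Require Import all_boot all_order all_algebra.
From mathcomp Require Import all_classical all_reals all_analysis.
Set Implicit Arguments. Unset Strict Implicit. Unset Printing Implicit Defensive.
Import Order.TTheory GRing.Theory Num.Theory.
Import numFieldNormedType.Exports.
Local Open Scope classical_set_scope.
Local Open Scope ring_scope.

Section Defs.
Variable R : realType.

Definition leb := (@lebesgue_measure R).

Definition intR (f : R -> R) : R := Rintegral leb setT f.

Definition L2 (f : R -> R) : Prop :=
  measurable_fun setT f /\ leb.-integrable setT (fun x => ((f x) ^+ 2)%:E).

Definition L2norm (f : R -> R) : R := Num.sqrt (intR (fun x => (f x) ^+ 2)).

Definition d1 (f : R -> R) : R -> R := derive1 f.
Definition dn (n : nat) (f : R -> R) : R -> R := iter n d1 f.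

Definition smooth1 (f : R -> R) : Prop :=
  forall n x, derivable (dn n f) x 1.

Definition Hinf (f : R -> R) : Prop := smooth1 f /\ forall n, L2 (dn n f).

(** H^k norm, ||f||_{H^k}^2 = sum_m C(k,m) ||f^(m)||_{L^2}^2,
    i.e. (up to the Plancherel constant) int (1+xi^2)^k |f^(xi)|^2 dxi *)
Definition Hnorm (k : nat) (f : R -> R) : R :=
  Num.sqrt (\sum_(m < k.+1) 'C(k, m)%:R * (L2norm (dn m f)) ^+ 2).

Definition pdx (u : R -> R -> R) : R -> R -> R :=
  fun x t => derive1 (fun y => u y t) x.
Definition pdt (u : R -> R -> R) : R -> R -> R :=
  fun x t => derive1 (fun s => u x s) t.
Definition mixed (n m : nat) (u : R -> R -> R) := iter n pdx (iter m pdt u).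

Definition smooth2 (u : R -> R -> R) : Prop :=
  forall n m x t,
    derivable (fun y => mixed n m u y t) x 1 /\
    derivable (fun s => mixed n m u x s) t 1 /\
    {for (x, t), continuous (fun p : R * R => mixed n m u p.1 p.2)}.

Definition sol_class (u : R -> R -> R) : Prop :=
  smooth2 u /\
  (forall k t, 0 <= t -> L2 (fun x => iter k pdx u x t)) /\
  (forall k T, exists C : R, forall t, 0 <= t <= T ->
       L2norm (fun x => iter k pdx u x t) <= C).

Definition airy_sol (eps : R) (phi : R -> R) (u : R -> R -> R) : Prop :=
  sol_class u /\ (forall x, u x 0 = phi x) /\
  (forall x t, 0 <= t ->
     pdt u x t + pdx u x t + eps / 6%:R * iter 3 pdx u x t = 0).

Definition tanh (z : R) : R := (expR z - expR (- z)) / (expR z + expR (- z)).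

Definition lsym (z : R) : R :=
  if z == 0 then 1 else Num.sqrt (tanh `|z| / `|z|).

Definition test_fun (psi : R -> R) : Prop :=
  smooth1 psi /\ exists M : R, forall x, M < `|x| -> psi x = 0.

(** Fourier multiplier l(sqrt eps D) applied to a test function psi:
    (1/2pi) int l(sqrt eps xi) psi^(xi) e^{i x xi} dxi
    = (1/2pi) int int l(sqrt eps xi) psi(y) cos((x-y) xi) dy dxi
    (the symbol is real and even) *)
Definition lmult (eps : R) (psi : R -> R) (x : R) : R :=
  (2%:R * pi)^-1 *
  intR (fun xi => lsym (Num.sqrt eps * xi) *
                  intR (fun y => psi y * cos ((x - y) * xi))).

(** linear Whitham equation  v_t + l(sqrt eps D) v_x = 0, v(.,0) = phi,
    the nonlocal term understood in the L^2 (distributional) sense: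
    <v_t(t), psi> + <v_x(t), l(sqrt eps D) psi> = 0 for all test psi
    (l(sqrt eps D) is self-adjoint on L^2) *)
Definition whitham_sol (eps : R) (phi : R -> R) (v : R -> R -> R) : Prop :=
  sol_class v /\ (forall x, v x 0 = phi x) /\
  (forall t psi, 0 <= t -> test_fun psi ->
     intR (fun x => pdt v x t * psi x) +
     intR (fun x => pdx v x t * lmult eps psi x) = 0).

End Defs.

(* Main.v *)
Require Import Defs.
From HB Require Import structures.
From mathcomp Require Import all_boot all_order all_algebra.
From mathcomp Require Import all_classical all_reals all_analysis.
From mathcomp Require Import measurable_realfun.
From mathcomp Require Import ring lra.
Import Order.TTheory GRing.Theory Num.Theory.
Import numFieldNormedType.Exports.
Set Implicit Arguments. Unset Strict Implicit. Unset Printing Implicit Defensive.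
Local Open Scope classical_set_scope.
Local Open Scope ring_scope.

(** The difference [w = u - v] solves the Whitham equation with source
    [-(1 + eps/6 d_x^2 - l(sqrt eps D)) d_x u].  As [|1 - z^2/6 - l(z)| <= z^4],
    the source of the equation for [d_x^k w] has L2 norm at most
    [eps^2 ||d_x^(k+5) u(t)||], hence at most [eps^2 ||phi^(k+5)||] because the
    Airy flow does not increase L2 norms of derivatives.  Since
    [l(sqrt eps D) d_x] is skew, [||d_x^k w(t)|| <= 2 t eps^2 ||phi^(k+5)||], and the
    one-dimensional Sobolev inequality for [k = j, j + 1] gives the theorem.

    The multiplier bounds on test functions come from Plancherel's formula, proved
    by inserting the weight [exp (- d |xi|)], whose cosine transform is the Poisson
    kernel, and letting [d] tend to 0. *)

(** * Integration and differentiation on the line *)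

(** The Whitham equation is available only in weak form, tested against smooth functions of compact
    support. Neither [w(t)] nor [lmult eps psi] has compact support, and nothing is known about
    derivatives of [lmult eps psi]. Every identity is therefore proved for [cutoff n * f] on the
    spectral side and carried to [f] by L2 convergence; commutators of the cutoff with derivatives
    are of order [1/n].

    [sol_class] gives no L2 control of the time derivative, so [||d_x^k w(t)||^2] is never
    differentiated. The localised energy is integrated over [[0, t]] by Fubini, and the supremum [S]
    of [||d_x^k w||] on [[0, t]] satisfies [S^2 <= 2 t eps^2 ||phi^(k+5)|| S]; dividing by [S] gives
    growth linear in [t] and the factor 2. The same estimate without source gives the bound for the
    Airy flow.

    The index [k + 5] is [k + 1] from [d_x^(k+1) u] in the weak equation plus 4 from the symbol
    bound [eps^2 xi^4]. Functions stay real: cosine and sine transforms replace the complex one. *)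

Section Integral.
Variable R : realType.
Implicit Types f g h : R -> R.

Definition L1 f : Prop := (@leb R).-integrable setT (EFin \o f).

Lemma L1_meas f : L1 f -> measurable_fun setT f.
Proof. by move=> /measurable_int /measurable_EFinP. Qed.

Lemma L1_le f g : measurable_fun setT f -> L1 g -> (forall x, `|f x| <= g x) -> L1 f.
Proof.
move=> mf ig fg; apply: (le_integrable measurableT _ _ ig).
  exact/measurable_EFinP.
by move=> x _ /=; rewrite lee_fin (le_trans (fg x))// ler_norm.
Qed.

Lemma L1D f g : L1 f -> L1 g -> L1 (fun x => f x + g x).
Proof. by move=> iF ig; exact: (integrableD measurableT iF ig). Qed.

Lemma L1B f g : L1 f -> L1 g -> L1 (fun x => f x - g x).
Proof. by move=> iF ig; exact: (integrableB measurableT iF ig). Qed.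

Lemma L1Z c f : L1 f -> L1 (fun x => c * f x).
Proof. by move=> iF; exact: (integrableZl measurableT c iF). Qed.

Lemma L1_norm f : L1 f -> L1 (fun x => `|f x|).
Proof. exact: integrable_norm. Qed.

Lemma intRD f g : L1 f -> L1 g -> intR (fun x => f x + g x) = intR f + intR g.
Proof. by move=> iF ig; exact: RintegralD. Qed.

Lemma intRB f g : L1 f -> L1 g -> intR (fun x => f x - g x) = intR f - intR g.
Proof. by move=> iF ig; exact: RintegralB. Qed.

Lemma intRZ c f : L1 f -> intR (fun x => c * f x) = c * intR f.
Proof. by move=> iF; exact: RintegralZl. Qed.

Lemma intRN f : L1 f -> intR (fun x => - f x) = - intR f.
Proof.
move=> iF; rewrite -mulN1r -intRZ//; congr intR; apply/funext => x.
by rewrite mulN1r.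
Qed.

Lemma intR0 : intR (fun=> 0 : R) = 0.
Proof. by rewrite /intR/Rintegral integral0. Qed.

Lemma intR_ge0 f : (forall x, 0 <= f x) -> 0 <= intR f.
Proof. by move=> f0; apply: Rintegral_ge0. Qed.

Lemma le_intR f g : L1 f -> L1 g -> (forall x, f x <= g x) -> intR f <= intR g.
Proof. by move=> iF ig fg; apply: le_Rintegral. Qed.

Lemma norm_intR f : L1 f -> `|intR f| <= intR (fun x => `|f x|).
Proof. by move=> iF; exact: le_normr_Rintegral. Qed.

Lemma norm_intR_le f g : L1 f -> L1 g -> (forall x, `|f x| <= g x) ->
  `|intR f| <= intR g.
Proof.
by move=> iF ig fg; rewrite (le_trans (norm_intR iF))// le_intR//; exact: L1_norm.
Qed.

Lemma intR_EFin f : L1 f -> (intR f)%:E = (\int[@leb R]_x (f x)%:E)%E.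
Proof. by move=> iF; rewrite /intR/Rintegral fineK//; exact: integrable_fin_num. Qed.

Lemma intR_cvg (f_ : nat -> R -> R) f g :
  (forall n, measurable_fun setT (f_ n)) -> L1 g ->
  (forall n x, `|f_ n x| <= g x) ->
  (forall x, f_ ^~ x @ \oo --> f x) ->
  L1 f /\ (fun n => intR (f_ n)) @ \oo --> intR f.
Proof.
move=> mf ig fg cf.
have mff : measurable_fun setT f by apply: (measurable_fun_cvg mf) => x _; exact: cf.
have [|||||iF _ cv] // := @dominated_convergence _ _ _ (@leb R) setT measurableT
  (fun n => EFin \o f_ n) (EFin \o f) (EFin \o g).
- move=> n; apply/measurable_EFinP.
  exact: mf.
- apply/measurable_EFinP.
  exact: mff.
- by apply: aeW => x _; apply: cvg_EFin; [exact: nearW|exact: cf].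
- by apply: aeW => x n _ /=; rewrite lee_fin.
split => //.
have igf n : L1 (f_ n) by exact: L1_le (mf n) ig (fg n).
apply: fine_cvg; rewrite -/(intR f) (intR_EFin iF).
exact: cv.
Qed.

Lemma intR_cvg0 (f_ : nat -> R -> R) g :
  (forall n, measurable_fun setT (f_ n)) -> L1 g ->
  (forall n x, `|f_ n x| <= g x) ->
  (forall x, f_ ^~ x @ \oo --> (0:R)) ->
  (fun n => intR (f_ n)) @ \oo --> (0:R).
Proof.
by move=> mf ig fg cf; have [_] := intR_cvg mf ig fg cf; rewrite intR0.
Qed.

Section Fubini.
Variables (F : R -> R -> R) (a b : R -> R).
Hypothesis mF : measurable_fun setT (fun p : R * R => F p.1 p.2).
Hypotheses (ia : L1 a) (ib : L1 b) (Fab : forall x y, `|F x y| <= a x * b y).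

Lemma meas_sec1 x : measurable_fun setT (F x).
Proof. exact: (measurableT_comp mF (measurable_pair1 x)). Qed.

Lemma meas_sec2 y : measurable_fun setT (F ^~ y).
Proof. exact: (measurableT_comp mF (measurable_pair2 y)). Qed.

Lemma L1_sec1 x : L1 (F x).
Proof. by apply: (L1_le (meas_sec1 x) (L1Z (a x) ib)) => y; exact: Fab. Qed.

Lemma L1_sec2 y : L1 (F ^~ y).
Proof.
apply: (L1_le (meas_sec2 y) (L1Z (b y) ia)) => x.
by rewrite mulrC; exact: Fab.
Qed.

Let P := (@leb R \x @leb R)%E.

(** Tonelli applied to the product majorant. A pointwise majorant [a x * b y] also makes every
    section integrable, not just almost every one, so iterated integrals can be manipulated without
    exceptional sets. *)
Lemma L1_prod : P.-integrable setT (fun p : R * R => (F p.1 p.2)%:E).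
Proof.
apply/integrable12ltyP; first exact/measurable_EFinP.
apply: (@le_lt_trans _ _ (\int[@leb R]_x (`|a x| * intR (fun y => `|b y|))%:E)%E).
  apply: ge0_le_integral => //=.
  - by move=> x _; exact: integral_ge0.
  - have := @measurable_fun_fubini_tonelli_F _ _ _ _ R (@leb R)
      (fun p => `|(F p.1 p.2)%:E|)%E.
    apply; last by move=> ?.
    by apply: measurableT_comp => //; exact/measurable_EFinP.
  - apply/measurable_EFinP; apply: measurable_funM => //.
    exact: L1_meas (L1_norm ia).
  - move=> x _; rewrite -intRZ; last exact: L1_norm.
    rewrite (intR_EFin (L1Z _ (L1_norm ib))).
    apply: ge0_le_integral => //=.
    + by apply/measurable_EFinP/measurableT_comp => //; exact: meas_sec1.
    + apply/measurable_EFinP; exact: (L1_meas (L1Z _ (L1_norm ib))).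
    + by move=> y _; rewrite lee_fin -normrM (le_trans (Fab x y))// ler_norm.
have iab : L1 (fun x => `|a x| * intR (fun y => `|b y|)).
  have := L1Z (intR (fun y => `|b y|)) (L1_norm ia); congr L1.
  by apply/funext => x; rewrite mulrC.
by rewrite -(intR_EFin iab) ltry.
Qed.

Lemma L1_marg1 : L1 (fun x => intR (F x)).
Proof.
have := integrable_fubini_F L1_prod; apply: eq_integrable => // x _ /=.
by rewrite /fubini_F -(intR_EFin (L1_sec1 x)).
Qed.

Lemma L1_marg2 : L1 (fun y => intR (F ^~ y)).
Proof.
have iab : L1 (fun y => b y * intR (fun x => `|a x|)).
  have := L1Z (intR (fun x => `|a x|)) ib; congr L1.
  by apply/funext => x; rewrite mulrC.
apply: L1_le (L1_norm iab) _.
  have := measurable_fubini_G L1_prod.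
  move=> h; apply/measurable_EFinP; move: h; congr measurable_fun.
  by apply/funext => y; rewrite /fubini_G -(intR_EFin (L1_sec2 y)).
move=> y; rewrite normrM [X in _ * X]ger0_norm; last exact: intR_ge0.
rewrite -intRZ; last exact: L1_norm.
apply: norm_intR_le.
- exact: L1_sec2.
- exact: L1Z (L1_norm ia).
- by move=> x; rewrite mulrC -normrM (le_trans (Fab _ _))// ler_norm.
Qed.

Lemma FubiniR : intR (fun x => intR (F x)) = intR (fun y => intR (F ^~ y)).
Proof.
have := Fubini L1_prod => /= h.
rewrite {1 3}/intR /Rintegral; congr fine.
under eq_integral do rewrite (intR_EFin (L1_sec1 _)).
by rewrite h; apply: eq_integral => y _; rewrite -(intR_EFin (L1_sec2 y)).
Qed.

End Fubini.

Lemma cont_meas f : continuous f -> measurable_fun setT f.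
Proof. exact: continuous_measurable_fun. Qed.

Lemma indic_itv_L1 (a b : R) : L1 (\1_`[a, b]).
Proof.
apply/integrableP; split.
  by apply/measurable_EFinP; apply: measurable_indic.
under eq_integral => x _ do rewrite gee0_abs ?lee_fin//.
rewrite integral_indic//= setIT.
by rewrite lebesgue_measure_itv/=; case: ifP => _; rewrite ?ltry// -EFinB ltry.
Qed.

(** The class on which transforms are taken. Smoothness is left out on purpose: truncations
    [cutI n * lmult eps psi], which jump at the ends of the interval, must belong to it for the
    duality argument in [lmult_L2]. *)
Definition bcs f : Prop := measurable_fun setT f /\
  exists M C : R, (forall x, `|f x| <= C) /\ forall x, M < `|x| -> f x = 0.

Lemma bcsP f : bcs f -> exists M C : R, forall x, `|f x| <= C * \1_`[-M, M] x.
Proof.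
move=> [_ [M [C [fC fM]]]]; exists M, C => x.
rewrite indicE; have [xM|xM] := leP `|x| M.
  by rewrite mem_set ?mulr1//= in_itv/= -ler_norml.
by rewrite fM// normr0 mulr_ge0// (le_trans _ (fC 0)).
Qed.

Lemma bcs_L1 f : bcs f -> L1 f.
Proof.
move=> bf; have [M [C fMC]] := bcsP bf.
by apply: L1_le (L1Z C (indic_itv_L1 (-M) M)) _ => //; case: bf.
Qed.

Lemma bcsM f g : bcs f -> measurable_fun setT g -> (forall M, exists C, forall x, `|x| <= M -> `|g x| <= C) ->
  bcs (fun x => f x * g x).
Proof.
move=> [mf [M [C [fC fM]]]] mg gb; split; first exact: measurable_funM.
have [D gD] := gb M.
exists M, (C * `|D|); split=> x; last by move=> /fM ->; rewrite mul0r.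
have C0 : 0 <= C by rewrite (le_trans _ (fC 0)).
have [xM|/fM ->] := leP `|x| M; last by rewrite mul0r normr0 mulr_ge0.
by rewrite normrM ler_pM// (le_trans (gD _ xM))// ler_norm.
Qed.

Lemma cont_bnd f : continuous f -> forall M, exists C, forall x, `|x| <= M -> `|f x| <= C.
Proof.
move=> cf M; have [M0|M0] := leP 0 M; last first.
  by exists 0 => x xM; have := le_lt_trans xM M0; rewrite ltNge normr_ge0.
have cnf : {within `[-M, M], continuous (fun x => `|f x|)}.
  by apply: continuous_subspaceT => x; apply: cvg_norm; exact: cf.
have [|c _ hc] := EVT_max _ cnf; first by rewrite ge0_cp.
by exists (`|f c|) => x; rewrite ler_norml => xM; apply: hc; rewrite in_itv.
Qed.

Lemma bcsMc f g : bcs f -> continuous g -> bcs (fun x => f x * g x).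
Proof. by move=> bf cg; apply: bcsM => //; [exact: cont_meas|exact: cont_bnd]. Qed.

Lemma cont_bcs f M : continuous f -> (forall x, M < `|x| -> f x = 0) -> bcs f.
Proof.
move=> cf fM; split; first exact: cont_meas.
have [C fC] := cont_bnd cf M; exists M, `|C|; split=> // x.
have [/fC h|/fM ->] := leP `|x| M; first by rewrite (le_trans h)// ler_norm.
by rewrite normr0.
Qed.

End Integral.

(** * Smooth functions, the fundamental theorem of calculus and integration by parts *)

Section Calculus.
Variable R : realType.
Implicit Types f g h F : R -> R.

Definition dif f := forall x, derivable f x 1.

Lemma is_derive_d1 f (x l : R) : is_derive x 1 f l -> derive1 f x = l.
Proof. by move=> h; rewrite derive1E derive_val. Qed.

Lemma dif_is f (x : R) : dif f -> is_derive x 1 f (derive1 f x).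
Proof. by move=> df; rewrite derive1E; apply/derivableP. Qed.

Lemma dif_cont f : dif f -> continuous f.
Proof. by move=> df x; apply/differentiable_continuous/derivable1_diffP. Qed.

Lemma dif_dE f f' : (forall x : R, is_derive x 1 f (f' x)) -> dif f /\ derive1 f = f'.
Proof.
move=> h; split=> [x|]; first by case: (h x).
by apply/funext => x; exact: is_derive_d1.
Qed.

Lemma difD f g : dif f -> dif g -> dif (fun x => f x + g x) /\
  derive1 (fun x => f x + g x) = fun x => derive1 f x + derive1 g x.
Proof.
move=> df dg; apply: dif_dE => x.
by have ? := dif_is x df; have ? := dif_is x dg; exact: is_deriveD.
Qed.

Lemma difB f g : dif f -> dif g -> dif (fun x => f x - g x) /\
  derive1 (fun x => f x - g x) = fun x => derive1 f x - derive1 g x.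
Proof.
move=> df dg; apply: dif_dE => x.
by have ? := dif_is x df; have ? := dif_is x dg; exact: is_deriveB.
Qed.

Lemma difZ c f : dif f -> dif (fun x => c * f x) /\
  derive1 (fun x => c * f x) = fun x => c * derive1 f x.
Proof.
move=> df; apply: dif_dE => x.
have ? := dif_is x df.
exact: (is_deriveZ (f := f) c).
Qed.

Lemma difM f g : dif f -> dif g -> dif (fun x => f x * g x) /\
  derive1 (fun x => f x * g x) = fun x => derive1 f x * g x + f x * derive1 g x.
Proof.
move=> df dg; apply: dif_dE => x.
have ? := dif_is x df; have ? := dif_is x dg.
apply: (is_derive_eq (is_deriveM _ _)).
by rewrite /GRing.scale/= addrC mulrC.
Qed.

Lemma dif_affine f (a b : R) : dif f -> dif (fun x => f (a * x + b)) /\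
  derive1 (fun x => f (a * x + b)) = fun x => a * derive1 f (a * x + b).
Proof.
move=> df; apply: dif_dE => x.
have h1 : is_derive x 1 (fun x => a * x + b) a.
  have ? : is_derive x 1 (fun x => a * x) (a * 1) by exact: (is_deriveZ (f := id) a).
  by apply: (is_derive_eq (is_deriveD _ _)); rewrite mulr1 addr0.
have ? := dif_is (a * x + b) df.
by apply: (is_derive_eq (is_derive1_comp _ _)); rewrite mulrC.
Qed.

(** Finite-order smoothness by recursion on the derivative. [smooth1] quantifies over all orders at
    once and offers no induction for products, whereas [Cn] closes under the product rule one order
    at a time. *)
Fixpoint Cn k f : Prop := if k is k'.+1 then dif f /\ Cn k' (derive1 f) else True.

Lemma smooth1P f : smooth1 f <-> forall k, Cn k f.
Proof.
split=> [h k|h n].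
  elim: k f h => //= k IH f h; split; first exact: (h 0%N).
  by apply: IH => n x; have := h n.+1 x; rewrite /dn iterSr.
elim: n f h => [|n IH] f h; first by have [] := h 1%N.
move=> x; rewrite /dn iterSr; apply: IH => k; by have [] := h k.+1.
Qed.

Lemma CnW k f : Cn k.+1 f -> Cn k f.
Proof. by elim: k f => //= k IH f [df [dg c]]; split => //; apply: IH. Qed.

Lemma CnD k f g : Cn k f -> Cn k g -> Cn k (fun x => f x + g x).
Proof.
elim: k f g => //= k IH f g [df cf] [dg cg].
by have [? ->] := difD df dg; split => //; exact: IH.
Qed.

Lemma CnZ k c f : Cn k f -> Cn k (fun x => c * f x).
Proof.
by elim: k f => //= k IH f [df cf]; have [? ->] := difZ c df; split => //; exact: IH.
Qed.

Lemma CnM k f g : Cn k f -> Cn k g -> Cn k (fun x => f x * g x).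
Proof.
elim: k f g => //= k IH f g [df cf] [dg cg].
have [? ->] := difM df dg; split => //.
have cf' : Cn k f by apply: CnW; split.
have cg' : Cn k g by apply: CnW; split.
by apply: CnD; exact: IH.
Qed.

Lemma Cn_affine k (a b : R) f : Cn k f -> Cn k (fun x => f (a * x + b)).
Proof.
elim: k f => //= k IH f [df cf]; have [? ->] := dif_affine a b df.
by split => //; apply: CnZ; exact: IH.
Qed.

Lemma smoothD f g : smooth1 f -> smooth1 g -> smooth1 (fun x => f x + g x).
Proof. by move=> /smooth1P cf /smooth1P cg; apply/smooth1P => k; exact: CnD. Qed.

Lemma smoothZ c f : smooth1 f -> smooth1 (fun x => c * f x).
Proof. by move=> /smooth1P cf; apply/smooth1P => k; exact: CnZ. Qed.

Lemma smoothB f g : smooth1 f -> smooth1 g -> smooth1 (fun x => f x - g x).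
Proof.
move=> sf sg; have := smoothD sf (smoothZ (c := -1) sg); congr smooth1.
by apply/funext => x; rewrite mulN1r.
Qed.

Lemma smoothM f g : smooth1 f -> smooth1 g -> smooth1 (fun x => f x * g x).
Proof. by move=> /smooth1P cf /smooth1P cg; apply/smooth1P => k; exact: CnM. Qed.

Lemma smooth_affine (a b : R) f : smooth1 f -> smooth1 (fun x => f (a * x + b)).
Proof. by move=> /smooth1P cf; apply/smooth1P => k; exact: Cn_affine. Qed.

Lemma dnSr n f : dn n.+1 f = dn n (derive1 f).
Proof. by rewrite /dn iterSr. Qed.

Lemma dnS n f : dn n.+1 f = derive1 (dn n f).
Proof. by []. Qed.

Lemma dnD n m f : dn n (dn m f) = dn (n + m) f.
Proof. by rewrite /dn iterD. Qed.

Lemma smooth_dn n f : smooth1 f -> smooth1 (dn n f).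
Proof. by move=> sf k x; rewrite dnD; exact: sf. Qed.

Lemma smooth_d1 f : smooth1 f -> smooth1 (derive1 f).
Proof. exact: (@smooth_dn 1). Qed.

Lemma smooth_dif f : smooth1 f -> dif f.
Proof. by move=> sf; exact: (sf 0%N). Qed.

Lemma smooth_cont f : smooth1 f -> continuous f.
Proof. by move=> /smooth_dif; exact: dif_cont. Qed.

Lemma dn_add n f g : smooth1 f -> smooth1 g ->
  dn n (fun x => f x + g x) = fun x => dn n f x + dn n g x.
Proof.
elim: n f g => // n IH f g sf sg; rewrite !dnSr.
have [_ ->] := difD (smooth_dif sf) (smooth_dif sg).
by apply: IH; exact: smooth_d1.
Qed.

Lemma dn_scale n c f : smooth1 f -> dn n (fun x => c * f x) = fun x => c * dn n f x.
Proof.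
elim: n f => // n IH f sf; rewrite !dnSr.
have [_ ->] := difZ c (smooth_dif sf).
by apply: IH; exact: smooth_d1.
Qed.

Lemma dn_sub n f g : smooth1 f -> smooth1 g ->
  dn n (fun x => f x - g x) = fun x => dn n f x - dn n g x.
Proof.
elim: n f g => // n IH f g sf sg; rewrite !dnSr.
have [_ ->] := difB (smooth_dif sf) (smooth_dif sg).
by apply: IH; exact: smooth_d1.
Qed.

Lemma FTC_itv F (a b : R) : a <= b -> dif F -> continuous (derive1 F) ->
  intR (fun x => \1_`[a, b] x * derive1 F x) = F b - F a.
Proof.
move=> ab difF cf; have cF := dif_cont difF; set f := derive1 F in cf *.
transitivity (Rintegral (@leb R) `[a, b] f).
  rewrite Rintegral_mkcond /intR; congr Rintegral; apply/funext => x.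
  by rewrite patchE indicE; case: ifP => _; rewrite ?mul1r ?mul0r.
move: ab; rewrite le_eqVlt => /predU1P[->|ab].
  by rewrite set_itv1 Rintegral_set1 subrr.
have cfw : {within `[a, b], continuous f} by exact: continuous_subspaceT.
have dFab : derivable_oo_LRcontinuous F a b.
  split; [by move=> x _; exact: difF|exact/cvg_at_right_filter/cF|].
  exact/cvg_at_left_filter/cF.
have E := @continuous_FTC2 R f F a b ab cfw dFab (fun x _ => erefl).
by rewrite /Rintegral [X in fine X]E.
Qed.

Lemma supp_d1 f (M : R) : (forall x, M < `|x| -> f x = 0) ->
  forall x, M < `|x| -> derive1 f x = 0.
Proof.
move=> fM x Mx; rewrite derive1E.
rewrite -(@derive_cst R _ _ (0:R) x 1); apply: near_eq_derive.
have H := @cvgr_gt R _ _ _ (fun y : R => `|y|) `|x| (@norm_continuous _ R x) _ Mx.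
by apply: filterS (H _) => y /fM ->.
Qed.

Lemma intR_d1 f (M : R) : dif f -> continuous (derive1 f) ->
  (forall x, M < `|x| -> f x = 0) -> intR (derive1 f) = 0.
Proof.
move=> df cf fM; pose A := `|M| + 1.
have MA : M < A by rewrite (le_lt_trans (ler_norm M))// ltrDl.
have A0 : 0 <= A by rewrite /A addr_ge0.
transitivity (intR (fun x => \1_`[-A, A] x * derive1 f x)).
  congr intR; apply/funext => x; rewrite indicE.
  have [xA|xA] := leP `|x| A.
    by rewrite mem_set ?mul1r//= in_itv/= -ler_norml.
  by rewrite (supp_d1 fM) ?mulr0// (lt_trans MA).
rewrite FTC_itv//; last by lra.
by rewrite !fM ?subrr// ?normrN ger0_norm.
Qed.

(** Compact support of [g] alone kills the boundary terms, so [f] may be a cosine, a sine or a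
    derivative of a solution. *)
Lemma ibp f g (M : R) : dif f -> continuous (derive1 f) ->
  dif g -> continuous (derive1 g) -> (forall x, M < `|x| -> g x = 0) ->
  intR (fun x => derive1 f x * g x) = - intR (fun x => f x * derive1 g x).
Proof.
move=> df cf' dg cg' gM; have [dfg dE] := difM df dg.
have cf := dif_cont df; have cg := dif_cont dg.
have := @intR_d1 (fun x => f x * g x) M dfg; rewrite dE => h.
have b1 : bcs (fun x => derive1 f x * g x).
  apply: (@cont_bcs _ _ M) => [x|x /gM ->]; last by rewrite mulr0.
  by apply: cvgM; [exact: cf'|exact: cg].
have b2 : bcs (fun x => f x * derive1 g x).
  apply: (@cont_bcs _ _ M) => [x|x /(supp_d1 gM) ->]; last by rewrite mulr0.
  by apply: cvgM; [exact: cf|exact: cg'].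
apply/eqP; rewrite -subr_eq0 opprK -intRD; [|exact: bcs_L1..].
apply/eqP/h.
- move=> x; apply: cvgD.
  + by apply: cvgM; [exact: cf'|exact: cg].
  + by apply: cvgM; [exact: cf|exact: cg'].
- by move=> x /gM ->; rewrite mulr0.
Qed.

End Calculus.

(** * A smooth bump function *)

Section Bump.
Variable R : realType.
Implicit Types f g h : R -> R.

(** The classical flat function [exp (-1/x)] together with its multiples by powers of [1/x]. The
    family is closed under differentiation up to linear combinations, which turns smoothness into an
    induction without polynomials in [1/x]. *)
Definition flat n (x : R) : R := if 0 < x then x ^- n * expR (- x^-1) else 0.

(** Write [expR y] as the [n+1]-st power of [expR (y / (n+1))]: [n] of the factors are at least
    [y / (n+1)] and the remaining one is at least 1. *)
Lemma exprn_expRN_le n (y : R) : 0 < y -> y ^+ n * expR (- y) <= n.+1%:R ^+ n.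
Proof.
move=> y0; rewrite expRN ler_pdivrMr ?expR_gt0//.
have -> : expR y = expR (y / n.+1%:R) ^+ n.+1.
  by rewrite -expRM_natl -mulr_natl mulrCA divff ?mulr1// pnatr_eq0.
have n0 : 0 < n.+1%:R :> R by rewrite ltr0n.
have yn : y / n.+1%:R <= expR (y / n.+1%:R).
  by rewrite (le_trans _ (expR_ge1Dx _))// lerDr.
rewrite (_ : y ^+ n = n.+1%:R ^+ n * (y / n.+1%:R) ^+ n); last first.
  by rewrite -exprMn mulrCA divff ?mulr1// gt_eqF.
rewrite ler_pM2l ?exprn_gt0// exprS.
rewrite (@le_trans _ _ (expR (y / n.+1%:R) ^+ n))//.
  by rewrite lerXn2r// nnegrE ?expR_ge0// divr_ge0// ltW.
rewrite ler_peMl ?exprn_ge0 ?expR_ge0//.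
rewrite (le_trans _ (expR_ge1Dx _))// lerDl divr_ge0// ltW//.
Qed.

Lemma flat_is_derive n (x : R) :
  is_derive x 1 (flat n) (flat n.+2 x - n%:R * flat n.+1 x).
Proof.
have [x0|x0|<-] := ltgtP 0 x.
- have xn : x != 0 by rewrite gt_eqF.
  have d1 : is_derive x 1 (fun y : R => y^-1) (- x ^- 2).
    have := is_deriveV (f := id) xn (is_derive_id x 1).
    by move=> d; apply: (is_derive_eq d); rewrite /GRing.scale/= mulr1.
  have d2 : is_derive x 1 (fun y : R => y ^- n) (- (n%:R * x ^- n.+1)).
    have -> : (fun y : R => y ^- n) = (fun y : R => y^-1) ^+ n.
      by apply/funext => y; rewrite fctE exprVn.
    apply: (is_derive_eq (is_deriveX _ _)).
    rewrite /GRing.scale/= -!exprVn; case: n => [|n]; first by rewrite !mul0r oppr0.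
    by rewrite /= (exprSr _ n.+1) (exprSr _ n); ring.
  have d3 : is_derive x 1 (fun y : R => expR (- y^-1)) (expR (- x^-1) * x ^- 2).
    apply: (is_derive_eq (is_derive1_comp _ _)).
    by rewrite /GRing.scale/= opprK mulrC.
  have d4 : is_derive x 1 (fun y : R => y ^- n * expR (- y^-1))
      (flat n.+2 x - n%:R * flat n.+1 x).
    apply: (is_derive_eq (is_deriveM d2 d3)).
    rewrite /flat x0 /GRing.scale/= -!exprVn !exprS; ring.
  apply: near_eq_is_derive d4.
  near=> y; rewrite /flat ifT//.
  by near: y; exact: lt_nbhsr.
- have d4 : is_derive x 1 (fun y : R => 0 : R) (flat n.+2 x - n%:R * flat n.+1 x).
    by rewrite /flat ltNge (ltW x0)/= mulr0 subrr; exact: is_derive_cst.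
  apply: near_eq_is_derive d4.
  near=> y; rewrite /flat ifF//; apply/negbTE; rewrite -leNgt ltW//.
  by near: y; exact: lt_nbhsl.
have -> : flat n.+2 0 - n%:R * flat n.+1 0 = 0 by rewrite /flat ltxx mulr0 subrr.
have lim0 : h^-1 * (flat n h - flat n 0) @[h --> (0:R)^'] --> (0:R).
  (* [K] bounds [y^(n+2) exp (-y)]. With [y = 1/h] this gives [flat n h / h = h * (h^-(n+2) exp
     (-1/h)) <= K h], so the difference quotient at 0 tends to 0. *)
  pose K : R := n.+3%:R ^+ n.+2.
  have K0 : 0 <= K by rewrite exprn_ge0.
  have nK : K * `|h| @[h --> (0:R)^'] --> (0:R).
    rewrite -[X in _ --> X](mulr0 K); apply: cvgM; first exact: cvg_cst.
    apply: cvg_within_filter.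
    by have := @norm_continuous _ R (0:R); rewrite /continuous_at normr0.
  apply: (@squeeze_cvgr _ _ _ _ (fun h : R => - (K * `|h|)) (fun h : R => K * `|h|)).
  - near=> h; rewrite -ler_norml /flat ltxx subr0.
    have [h0|h0] := ltP 0 h; last by rewrite mulr0 normr0 mulr_ge0.
    rewrite ger0_norm; last by rewrite !mulr_ge0 ?invr_ge0 ?exprn_ge0 ?expR_ge0 ?ltW.
    rewrite gtr0_norm//.
    have hv : 0 < h^-1 by rewrite invr_gt0.
    have := exprn_expRN_le n.+2 hv; rewrite -/K => hK.
    rewrite -ler_pdivrMr//; apply: le_trans hK.
    by rewrite -exprVn !exprS le_eqVlt; apply/orP; left; apply/eqP; ring.
  - have := cvgN nK; rewrite oppr0; exact.
  - exact: nK.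
have E : (fun h : R => h^-1 *: ((flat n \o shift 0) (h *: 1) - flat n 0)) =
         (fun h : R => h^-1 * (flat n h - flat n 0)).
  by apply/funext => h; rewrite /= addr0 /GRing.scale/= mulr1.
apply: DeriveDef.
  by rewrite /derivable E; apply/cvg_ex; exists 0; exact: lim0.
by rewrite /derive E; apply: cvg_lim.
Unshelve. all: by end_near.
Qed.

Lemma flat_Cn k n : Cn k (flat n).
Proof.
elim: k n => //= k IH n; have [df ->] := dif_dE (flat_is_derive n).
split=> //; apply: CnD; first exact: IH.
have := CnZ (-1) (CnZ n%:R (IH n.+1)); congr Cn.
by apply/funext => x; rewrite mulN1r.
Qed.

(** On [(-1, 1)] this is [exp (2 - 2 / (1 - x^2))]; the factor [expR 2] normalises the value at 0 to
    1. The arguments are spelled as affine maps to match [smooth_affine]. *)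
Definition bumpf (x : R) : R :=
  expR 2 * (flat 0 (1 * x + 1) * flat 0 (-1 * x + 1)).

Lemma bump_smooth : smooth1 bumpf.
Proof.
have sf : smooth1 (flat 0) by apply/smooth1P => k; exact: flat_Cn.
by apply: smoothZ; apply: smoothM; exact: smooth_affine.
Qed.

Lemma bump_supp x : 1 < `|x| -> bumpf x = 0.
Proof.
rewrite /bumpf /flat; have [x0|x0] := leP 0 x => x1.
  have -> : (0 < -1 * x + 1) = false by apply/negbTE; rewrite -leNgt; move: x1; rewrite ger0_norm//; lra.
  by rewrite !mulr0.
have -> : (0 < 1 * x + 1) = false by apply/negbTE; rewrite -leNgt; move: x1; rewrite ltr0_norm//; lra.
by rewrite mul0r mulr0.
Qed.

Lemma bump0 : bumpf 0 = 1.
Proof.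
rewrite /bumpf /flat !mulr0 !add0r ltr01 expr0 invr1 !mul1r -!expRD.
by rewrite (_ : _ + _ = 0) ?expR0//; lra.
Qed.

Lemma bump_ge0 x : 0 <= bumpf x.
Proof.
have f0 y : 0 <= flat 0 y.
  by rewrite /flat; case: ifP => // _; rewrite expr0 invr1 mul1r expR_ge0.
by rewrite /bumpf !mulr_ge0// expR_ge0.
Qed.

(** With [a = 1 + x] and [b = 1 - x] the exponent is [2 - 1/a - 1/b], which is nonpositive because
    [a + b = 2] forces [a b <= 1]. *)
Lemma bump_le1 x : bumpf x <= 1.
Proof.
rewrite /bumpf /flat; case: ifPn => [h1|_]; last by rewrite mul0r mulr0.
case: ifPn => [h2|_]; last by rewrite !mulr0.
rewrite expr0 invr1 !mul1r -!expRD -[leRHS]expR0 ler_expR.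
set a := x + 1 in h1 *; set b := _ + 1 in h2 *.
have ab : a + b = 2 by rewrite /a /b; lra.
have a0 : a != 0 by rewrite gt_eqF // /a; lra.
have b0 : b != 0 by rewrite gt_eqF.
have h1' : 0 < a by rewrite /a; lra.
have : 2 * a * b <= a + b.
  rewrite ab (_ : 2 * a * b = 2 - 2 * x ^+ 2); last by rewrite /a /b; ring.
  by have := sqr_ge0 x; lra.
rewrite -ler_pdivlMr ?divr_gt0// -ler_pdivlMr//.
have -> : (a + b) / b / a = a^-1 + b^-1 by field; rewrite a0 b0.
by lra.
Qed.

End Bump.

(** * Square-integrable functions, test functions and the Sobolev inequality *)

Section L2space.
Variable R : realType.
Implicit Types f g h : R -> R.

(** The product [a * b] is the infimum over [k] of the right-hand side, formally at [k = b / a].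
    Since [a] or [b] may vanish, [k = (b + d) / (a + d)] is used and [d] is taken small. It converts
    additive Young bounds into Cauchy-Schwarz, in physical space and again on the spectral side. *)
Lemma amgm_opt (a b x : R) : 0 <= a -> 0 <= b ->
  (forall k, 0 < k -> x <= (k * a ^+ 2 + k^-1 * b ^+ 2) / 2) -> x <= a * b.
Proof.
move=> a0 b0 h; apply/ler_addgt0Pr => e e0.
pose s := a + b + 1; have s0 : 0 < s by rewrite /s; lra.
pose d := Num.min 1 (e / s).
have d0 : 0 < d by rewrite lt_min ltr01 divr_gt0.
have d1 : d <= 1 by rewrite ge_min lexx.
have de : d * s <= e by rewrite -ler_pdivlMr// ge_min lexx orbT.
have ad : 0 < a + d by lra.
have bd : 0 < b + d by lra.
have k0 : 0 < (b + d) / (a + d) by rewrite divr_gt0.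
have /le_trans -> // := h _ k0.
have h1 : (b + d) / (a + d) * a ^+ 2 <= (a + d) * (b + d).
  rewrite mulrAC ler_pdivrMr//.
  have : a ^+ 2 <= (a + d) ^+ 2 by rewrite lerXn2r// ?nnegrE; lra.
  by nra.
have h2 : ((b + d) / (a + d))^-1 * b ^+ 2 <= (a + d) * (b + d).
  rewrite invf_div mulrAC ler_pdivrMr//.
  have : b ^+ 2 <= (b + d) ^+ 2 by rewrite lerXn2r// ?nnegrE; lra.
  by nra.
have : (a + d) * (b + d) <= a * b + e by move: de; rewrite /s; nra.
by lra.
Qed.

Definition sq f : R := intR (fun x => f x ^+ 2).

Lemma L2_sqr_L1 f : L2 f -> L1 (fun x => f x ^+ 2). Proof. by case. Qed.

Lemma L2_meas f : L2 f -> measurable_fun setT f. Proof. by case. Qed.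

Lemma L2_le f g : measurable_fun setT f -> L2 g -> (forall x, `|f x| <= `|g x|) -> L2 f.
Proof.
move=> mf ig fg; split => //; apply: L1_le (L2_sqr_L1 ig) _.
  exact: measurable_funX.
by move=> x; rewrite ger0_norm ?sqr_ge0// -ler_sqrt ?sqr_ge0// !sqrtr_sqr.
Qed.

Lemma L2M f g : L2 f -> L2 g -> L1 (fun x => f x * g x).
Proof.
move=> lf lg; apply: L1_le (L1D (L2_sqr_L1 lf) (L2_sqr_L1 lg)) _.
  by apply: measurable_funM; exact: L2_meas.
move=> x; rewrite ler_norml; have := sqr_ge0 (f x + g x); have := sqr_ge0 (f x - g x).
by rewrite sqrrB sqrrD; have := sqr_ge0 (f x); have := sqr_ge0 (g x); lra.
Qed.

Lemma L2Z c f : L2 f -> L2 (fun x => c * f x).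
Proof.
move=> lf; split; first by apply: measurable_funM => //; exact: L2_meas.
by have := L1Z (c ^+ 2) (L2_sqr_L1 lf); congr L1; apply/funext => x; rewrite exprMn.
Qed.

Lemma L2D f g : L2 f -> L2 g -> L2 (fun x => f x + g x).
Proof.
move=> lf lg; split; first by apply: measurable_funD; exact: L2_meas.
have := L1D (L1D (L2_sqr_L1 lf) (L2_sqr_L1 lg)) (L1Z 2 (L2M lf lg)); congr L1.
by apply/funext => x; ring.
Qed.

Lemma L2B f g : L2 f -> L2 g -> L2 (fun x => f x - g x).
Proof.
move=> lf lg; have := L2D lf (L2Z (-1) lg); congr L2.
by apply/funext => x; rewrite mulN1r.
Qed.

Lemma sq_ge0 f : 0 <= sq f.
Proof. by apply: intR_ge0 => x; exact: sqr_ge0. Qed.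

Lemma L2norm_ge0 f : 0 <= L2norm f. Proof. exact: sqrtr_ge0. Qed.

Lemma L2norm_sq f : L2norm f ^+ 2 = sq f.
Proof. by rewrite sqr_sqrtr// sq_ge0. Qed.

Lemma cauchy_schwarz_abs f g : L2 f -> L2 g ->
  intR (fun x => `|f x * g x|) <= L2norm f * L2norm g.
Proof.
move=> lf lg; apply: amgm_opt; [exact: L2norm_ge0|exact: L2norm_ge0|move=> k k0].
rewrite !L2norm_sq /sq -(intRZ k (L2_sqr_L1 lf)) -(intRZ k^-1 (L2_sqr_L1 lg)).
have i1 := L1Z k (L2_sqr_L1 lf); have i2 := L1Z k^-1 (L2_sqr_L1 lg).
rewrite -intRD// mulrC -intRZ; last exact: L1D.
apply: le_intR.
- exact: L1_norm (L2M lf lg).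
- exact: L1Z (L1D i1 i2).
move=> x; set a := f x; set b := g x.
have kv : 0 < k^-1 by rewrite invr_gt0.
have e1 : k^-1 * (k * a + b) ^+ 2 = k * a ^+ 2 + 2 * (a * b) + k^-1 * b ^+ 2.
  by field; rewrite gt_eqF.
have e2 : k^-1 * (k * a - b) ^+ 2 = k * a ^+ 2 - 2 * (a * b) + k^-1 * b ^+ 2.
  by field; rewrite gt_eqF.
have := mulr_ge0 (ltW kv) (sqr_ge0 (k * a + b)).
have := mulr_ge0 (ltW kv) (sqr_ge0 (k * a - b)).
by rewrite e1 e2 ler_norml; lra.
Qed.

Lemma cauchy_schwarz f g : L2 f -> L2 g ->
  `|intR (fun x => f x * g x)| <= L2norm f * L2norm g.
Proof.
move=> lf lg; rewrite (le_trans (norm_intR (L2M lf lg)))//.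
exact: cauchy_schwarz_abs.
Qed.

Lemma L2normD f g : L2 f -> L2 g ->
  L2norm (fun x => f x + g x) <= L2norm f + L2norm g.
Proof.
move=> lf lg; rewrite -(@ler_pXn2r _ 2)// ?nnegrE ?addr_ge0 ?L2norm_ge0//.
rewrite sqrrD !L2norm_sq /sq.
rewrite (_ : (fun x => (f x + g x) ^+ 2) =
  (fun x => (f x ^+ 2 + g x ^+ 2) + 2 * (f x * g x))); last first.
  by apply/funext => x; ring.
have i3 := L2M lf lg; have i1 := L2_sqr_L1 lf; have i2 := L2_sqr_L1 lg.
rewrite intRD; [|exact: L1D|exact: L1Z].
rewrite intRD// intRZ// addrAC.
have := ler_norm (intR (fun x => f x * g x)); have := cauchy_schwarz lf lg.
by lra.
Qed.

Lemma L2normZ c f : L2 f -> L2norm (fun x => c * f x) = `|c| * L2norm f.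
Proof.
move=> lf; rewrite /L2norm -(sqrtr_sqr c) -sqrtrM ?sqr_ge0//; congr Num.sqrt.
by rewrite -intRZ; [congr intR; apply/funext => x; rewrite exprMn|exact: L2_sqr_L1].
Qed.

Lemma L2normB f g : L2 f -> L2 g ->
  L2norm (fun x => f x - g x) <= L2norm f + L2norm g.
Proof.
move=> lf lg; have := L2normD lf (L2Z (-1) lg); rewrite (L2normZ (-1) lg) normrN1 mul1r.
by congr (_ <= _); congr L2norm; apply/funext => x; rewrite mulN1r.
Qed.

Lemma L2norm_le f g : L2 f -> L2 g -> (forall x, `|f x| <= `|g x|) -> L2norm f <= L2norm g.
Proof.
move=> lf lg fg; rewrite ler_sqrt ?sq_ge0//.
apply: le_intR; [exact: L2_sqr_L1..|move=> x].
by rewrite -ler_sqrt ?sqr_ge0// !sqrtr_sqr.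
Qed.

Lemma L2norm_leZ c f g : L2 f -> L2 g -> 0 <= c -> (forall x, `|f x| <= c * `|g x|) ->
  L2norm f <= c * L2norm g.
Proof.
move=> lf lg c0 fg; have := L2normZ c lg; rewrite ger0_norm// => <-.
by apply: L2norm_le => // [|x]; [exact: L2Z|rewrite normrM (ger0_norm c0)].
Qed.

Lemma bcs_L2 f : bcs f -> L2 f.
Proof.
move=> bf; split; first by case: bf.
apply: bcs_L1; case: bf => mf [M [C [fC fM]]]; split; first exact: measurable_funX.
exists M, (C ^+ 2); split=> x; last by move=> /fM ->; rewrite expr0n.
by rewrite normrX lerXn2r ?nnegrE// (le_trans _ (fC 0)).
Qed.

Lemma test_smooth f : test_fun f -> smooth1 f. Proof. by case. Qed.

Lemma test_cont f : test_fun f -> continuous f.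
Proof. by case=> /smooth_cont. Qed.

Lemma test_bcs f : test_fun f -> bcs f.
Proof. by case=> sf [M fM]; apply: cont_bcs fM; exact: smooth_cont. Qed.

Lemma test_d1 f : test_fun f -> test_fun (derive1 f).
Proof. by case=> sf [M fM]; split; [exact: smooth_d1|exists M; exact: supp_d1]. Qed.

Lemma test_dn n f : test_fun f -> test_fun (dn n f).
Proof. by move=> tf; elim: n => // n IH; rewrite dnS; exact: test_d1. Qed.

Lemma testMr f g : test_fun f -> smooth1 g -> test_fun (fun x => f x * g x).
Proof.
case=> sf [M fM] sg; split; first exact: smoothM.
by exists M => x /fM ->; rewrite mul0r.
Qed.

Lemma testD f g : test_fun f -> test_fun g -> test_fun (fun x => f x + g x).
Proof.
case=> sf [M fM] [sg [N gN]]; split; first exact: smoothD.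
by exists (Num.max M N) => x; rewrite gt_max => /andP[/fM -> /gN ->]; rewrite addr0.
Qed.

Lemma testZ c f : test_fun f -> test_fun (fun x => c * f x).
Proof.
case=> sf [M fM]; split; first exact: smoothZ.
by exists M => x /fM ->; rewrite mulr0.
Qed.

Lemma test_Hinf f : test_fun f -> Hinf f.
Proof. by move=> tf; split; [exact: test_smooth|move=> n; apply/bcs_L2/test_bcs/test_dn]. Qed.

Lemma Hinf_L2 f : Hinf f -> L2 f. Proof. by case=> _ /(_ 0%N). Qed.

Lemma Hinf_smooth f : Hinf f -> smooth1 f. Proof. by case. Qed.

Lemma Hinf_dn n f : Hinf f -> Hinf (dn n f).
Proof. by case=> sf lf; split => [|m]; [exact: smooth_dn|rewrite dnD; exact: lf]. Qed.

Lemma Hinf_d1 f : Hinf f -> Hinf (derive1 f).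
Proof. exact: (@Hinf_dn 1). Qed.

Lemma HinfB f g : Hinf f -> Hinf g -> Hinf (fun x => f x - g x).
Proof.
case=> sf lf [sg lg]; split; first exact: smoothB.
by move=> n; rewrite dn_sub//; exact: L2B.
Qed.

Lemma intR_indic_itv (a b : R) : a <= b -> intR (\1_`[a, b]) = b - a.
Proof.
move=> ab; rewrite /intR /Rintegral integral_indic//= setIT.
rewrite lebesgue_measure_itv/=; case: ifPn => //.
by rewrite lte_fin -leNgt => ba; rewrite (_ : a = b) ?subrr//; apply/le_anti; rewrite ab.
Qed.

(** From [(f^2)' = 2 f f'] and [2 |f f'| <= f^2 + f'^2] one gets [f(x)^2 <= sq f + sq f' + f(y)^2]
    for every [y >= x]. Averaging over [y] in [[x, x + 1]] replaces [f(y)^2] by at most [sq f]. *)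
Lemma sup_bound f x : Hinf f -> `|f x| <= 2 * (L2norm f + L2norm (derive1 f)).
Proof.
move=> hf; have lf := Hinf_L2 hf; have lf' := Hinf_L2 (Hinf_d1 hf).
have df := smooth_dif (Hinf_smooth hf).
have cf' := smooth_cont (smooth_d1 (Hinf_smooth hf)).
have cf := dif_cont df.
suff h : f x ^+ 2 <= 2 * sq f + sq (derive1 f).
  rewrite -(@ler_pXn2r _ 2)// ?nnegrE ?mulr_ge0 ?addr_ge0 ?L2norm_ge0//.
  rewrite real_normK ?num_real// (le_trans h)// -!L2norm_sq.
  by have := L2norm_ge0 f; have := L2norm_ge0 (derive1 f); nra.
have [dg dgE] := difM df df.
have i1 := L2_sqr_L1 lf; have i2 := L2_sqr_L1 lf'; have i3 := L1D i1 i2.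
have step y : x <= y -> f x ^+ 2 <= sq f + sq (derive1 f) + f y ^+ 2.
  move=> xy; have := FTC_itv xy dg; rewrite dgE => /(_ _) E.
  have {}E : intR (fun z => \1_`[x, y] z * (derive1 f z * f z + f z * derive1 f z)) =
      f y * f y - f x * f x.
    apply: E => z; apply: cvgD.
      by apply: cvgM; [exact: cf'|exact: cf].
    by apply: cvgM; [exact: cf|exact: cf'].
  have b z : `|\1_`[x, y] z * (derive1 f z * f z + f z * derive1 f z)| <=
      f z ^+ 2 + derive1 f z ^+ 2.
    rewrite normrM indicE.
    have h : `|derive1 f z * f z + f z * derive1 f z| <= f z ^+ 2 + derive1 f z ^+ 2.
      rewrite ler_norml; have := sqr_ge0 (f z + derive1 f z).
      by have := sqr_ge0 (f z - derive1 f z); rewrite sqrrB sqrrD; lra.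
    by case: (_ \in _); rewrite ?normr1 ?mul1r// normr0 mul0r addr_ge0// sqr_ge0.
  have iE : L1 (fun z => \1_`[x, y] z * (derive1 f z * f z + f z * derive1 f z)).
    apply: L1_le i3 b; apply: measurable_funM; first exact: measurable_indic.
    by apply: measurable_funD; apply: measurable_funM; exact: L2_meas.
  have := norm_intR_le iE i3 b; rewrite E intRD// -/(sq f) -/(sq (derive1 f)).
  by rewrite ler_norml !expr2; lra.
have xx1 : x <= x + 1 by lra.
have i0 := indic_itv_L1 x (x + 1).
have -> : f x ^+ 2 = intR (fun y => f x ^+ 2 * \1_`[x, x + 1] y).
  by rewrite intRZ// intR_indic_itv// addrC addKr mulr1.
have ia : L1 (fun y => (sq f + sq (derive1 f)) * \1_`[x, (x + 1)%R] y + f y ^+ 2).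
  by apply: L1D => //; exact: L1Z.
have le1 : intR (fun y => f x ^+ 2 * \1_`[x, x + 1] y) <=
    intR (fun y => (sq f + sq (derive1 f)) * \1_`[x, (x + 1)%R] y + f y ^+ 2).
  apply: le_intR => // [|y]; first exact: L1Z.
  rewrite indicE; have [|_] := boolP (_ \in _); last first.
    by rewrite !mulr0 add0r sqr_ge0.
  by rewrite inE/= in_itv/= => /andP[xy _]; rewrite !mulr1 step.
apply: (le_trans le1); rewrite intRD//; last exact: L1Z.
by rewrite intRZ// intR_indic_itv// (addrC x) addrK mulr1 -/(sq f); lra.
Qed.

End L2space.

(** * Smooth cutoffs and density of compactly supported functions *)

Section Cutoff.
Variable R : realType.
Implicit Types f g h : R -> R.

(** The summand 0 keeps the affine shape expected by [dif_affine] and [smooth_affine]. *)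
Definition dilate g n (x : R) : R := g (n.+1%:R^-1 * x + 0).

Lemma dilate_smooth g n : smooth1 g -> smooth1 (dilate g n).
Proof. exact: smooth_affine. Qed.

Lemma dilate_test g n : test_fun g -> test_fun (dilate g n).
Proof.
case=> sg [M gM]; split; first exact: dilate_smooth.
exists (n.+1%:R * M) => x hx; apply: gM.
rewrite addr0 normrM ger0_norm ?invr_ge0//.
by rewrite mulrC ltr_pdivlMr ?ltr0n// mulrC.
Qed.

Lemma dilate_d1 g n : smooth1 g ->
  derive1 (dilate g n) = fun x => n.+1%:R^-1 * dilate (derive1 g) n x.
Proof. by move=> sg; have [_ ->] := dif_affine (n.+1%:R^-1) 0 (smooth_dif sg). Qed.

Lemma test_bounded g : test_fun g -> exists2 C : R, 0 <= C & forall x, `|g x| <= C.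
Proof.
move=> /test_bcs [_ [M [C [gC _]]]]; exists C => //.
by rewrite (le_trans _ (gC 0)).
Qed.

Lemma L2_testM g f : test_fun g -> L2 f -> L2 (fun x => g x * f x).
Proof.
move=> tg lf; have [C C0 gC] := test_bounded tg.
apply: L2_le (L2Z C lf) _.
  apply: measurable_funM; last exact: L2_meas.
  by apply: cont_meas; exact: test_cont.
by move=> x; rewrite !normrM (ger0_norm C0) ler_wpM2r.
Qed.

(** In the Leibniz expansion every term of the commutator has at least one derivative on the dilated
    factor, and each such derivative brings out [1 / (n+1)]. The induction varies [g], because one
    differentiation turns [g] into [g']. The constant depends on neither [f] nor [n]. *)
Lemma cut_dn m g : test_fun g -> exists2 C : R, 0 <= C &
  forall f n, Hinf f ->
  L2norm (fun x => dn m (fun y => dilate g n y * f y) x - dilate g n x * dn m f x) <=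
  C * n.+1%:R^-1 * \sum_(k < m) L2norm (dn k f).
Proof.
elim: m g => [|m IH] g tg.
  exists 0 => // f n hf; rewrite big_ord0 mulr0.
  rewrite /L2norm (_ : (fun _ => _) = (fun=> 0)) ?intR0 ?sqrtr0//.
  by apply/funext => x; rewrite /dn/= subrr expr0n.
have [C1 C10 h1] := IH g tg.
have tg' := test_d1 tg.
have [C2 C20 h2] := IH _ tg'.
have [C3 C30 h3] := test_bounded tg'.
exists (C1 + C2 + C3); first by rewrite !addr_ge0.
move=> f n hf; set e := n.+1%:R^-1.
have e0 : 0 <= e by rewrite invr_ge0.
have e1 : e <= 1 by rewrite invf_le1 ?ltr0n// ler1n.
have sf := Hinf_smooth hf; have sg := test_smooth tg.
have ts := dilate_test n tg; have ts' := dilate_test n tg'.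
have hf' := Hinf_d1 hf.
(* After one differentiation, [A] is the commutator for [g'] and [f], [B] is its main term, and [D]
   is the commutator for [g] and [f']. [A] and [B] come with the factor [e] from the chain rule. *)
pose A x := dn m (fun y => dilate (derive1 g) n y * f y) x - dilate (derive1 g) n x * dn m f x.
pose B x := dilate (derive1 g) n x * dn m f x.
pose D x := dn m (fun y => dilate g n y * derive1 f y) x - dilate g n x * dn m (derive1 f) x.
have lA : L2 A.
  apply: L2B; first by apply/Hinf_L2/Hinf_dn/test_Hinf; exact: testMr.
  by apply: L2_testM => //; exact/Hinf_L2/Hinf_dn.
have lB : L2 B by apply: L2_testM => //; exact/Hinf_L2/Hinf_dn.
have lD : L2 D.
  apply: L2B.
    by apply/Hinf_L2/Hinf_dn/test_Hinf; apply: testMr => //; exact: smooth_d1.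
  by apply: L2_testM => //; exact/Hinf_L2/Hinf_dn.
rewrite (_ : (fun _ => _) = (fun x => (e * A x + e * B x) + D x)); last first.
  apply/funext => x; rewrite !dnSr.
  have [_ ->] := difM (smooth_dif (dilate_smooth (n := n) sg)) (smooth_dif sf).
  rewrite dilate_d1//.
  rewrite (_ : (fun y => e * dilate (derive1 g) n y * f y + dilate g n y * derive1 f y) =
   (fun y => e * (dilate (derive1 g) n y * f y) + dilate g n y * derive1 f y)); last first.
    by apply/funext => y; rewrite mulrA.
  rewrite dn_add; first last.
  - by apply: smoothM; [exact: dilate_smooth|exact: smooth_d1].
  - by apply: smoothZ; apply: smoothM => //; apply: dilate_smooth; exact: smooth_d1.
  rewrite dn_scale; last by apply: smoothM => //; apply: dilate_smooth; exact: smooth_d1.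
  by rewrite /A /B /D; ring.
have leAB := L2normD (L2Z e lA) (L2Z e lB).
have leD := L2normD (L2D (L2Z e lA) (L2Z e lB)) lD.
apply: (le_trans leD); rewrite (L2normZ e lA) (L2normZ e lB) (ger0_norm e0) in leAB.
have hA := h2 f n hf; rewrite -/e in hA.
have hD := h1 _ n hf'; rewrite -/e in hD.
have hB : L2norm B <= C3 * L2norm (dn m f).
  apply: L2norm_leZ => // [|x]; first exact/Hinf_L2/Hinf_dn.
  rewrite /B normrM ler_wpM2r//; exact: h3.
set S1 := \sum_(k < m) _ in hA; set S2 := \sum_(k < m) _ in hD.
have S10 : 0 <= S1 by apply: sumr_ge0 => k _; exact: L2norm_ge0.
have S20 : 0 <= S2 by apply: sumr_ge0 => k _; exact: L2norm_ge0.
have ES : \sum_(k < m.+1) L2norm (dn k f) = S1 + L2norm (dn m f) by rewrite big_ord_recr.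
have ES2 : \sum_(k < m.+1) L2norm (dn k f) = L2norm f + S2.
  rewrite big_ord_recl; congr (_ + _); apply: eq_bigr => k _.
  by rewrite lift0 dnSr.
have N0 := L2norm_ge0 f; have Nm := L2norm_ge0 (dn m f).
set S := \sum_(k < m.+1) _ in ES ES2 *.
(* Here the small factor occurs twice, once from the chain rule and once in [hA]; one of the two is
   bounded by 1. *)
have t1 : e * L2norm A <= C2 * e * S.
  apply: (@le_trans _ _ (e * (C2 * S))); last by rewrite mulrCA mulrA.
  rewrite ler_wpM2l// (le_trans hA)//.
  apply: (@le_trans _ _ (C2 * 1 * S1)); last by rewrite mulr1 ler_wpM2l// ES lerDl.
  by rewrite ler_wpM2r// ler_wpM2l.
have t2 : e * L2norm B <= C3 * e * S.
  rewrite mulrAC mulrC ler_wpM2r// (le_trans hB)// ler_wpM2l// ES lerDr//.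
have t3 : L2norm D <= C1 * e * S.
  by rewrite (le_trans hD)// ler_wpM2l ?mulr_ge0// ES2 lerDr.
rewrite (_ : _ * S = C1 * e * S + C2 * e * S + C3 * e * S); last by ring.
by move: leAB t1 t2 t3; rewrite -/A -/B -/D; lra.
Qed.

Definition cutoff n : R -> R := dilate (@bumpf R) n.

Lemma bump_test : test_fun (@bumpf R).
Proof. by split; [exact: bump_smooth|exists 1; exact: bump_supp]. Qed.

Lemma cutoff_test n : test_fun (cutoff n).
Proof. exact: dilate_test bump_test. Qed.

Lemma cutoff01 n x : 0 <= cutoff n x <= 1.
Proof. by rewrite /cutoff /dilate bump_ge0 bump_le1. Qed.

Lemma cutoff_cvg x : cutoff n x @[n --> \oo] --> (1:R).
Proof.
rewrite -(bump0 R) /cutoff /dilate.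
have h : (n.+1%:R^-1 * x + 0 : R) @[n --> \oo] --> (0 * x + 0 : R).
  apply: cvgD; last exact: cvg_cst.
  by apply: cvgM; [exact: cvg_harmonic|exact: cvg_cst].
rewrite mul0r addr0 in h.
by apply: (cvg_comp _ _ h); exact: (smooth_cont (@bump_smooth R)).
Qed.

Lemma cut_tail f : L2 f ->
  (fun n => L2norm (fun x => (1 - cutoff n x) * f x)) @ \oo --> (0:R).
Proof.
move=> lf; rewrite -(@sqrtr0 R).
apply: continuous_cvg; first exact: sqrt_continuous.
apply: (intR_cvg0 _ (L2_sqr_L1 lf)).
- move=> n; apply: measurable_funX; apply: measurable_funM; last exact: L2_meas.
  apply: measurable_funB => //; apply: cont_meas; apply: test_cont.
  exact: cutoff_test.
- move=> n x; rewrite ger0_norm ?sqr_ge0// exprMn ler_piMl ?sqr_ge0//.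
  by have /andP[c0 c1] := cutoff01 n x; rewrite expr2; nra.
- move=> x; have h : (1 - cutoff n x) * f x @[n --> \oo] --> (0:R).
    rewrite (_ : 0 = (1 - 1) * f x); last by rewrite subrr mul0r.
    apply: cvgM; last exact: cvg_cst.
    by apply: cvgB; [exact: cvg_cst|exact: cutoff_cvg].
  by have := cvgM h h; rewrite mulr0; exact.
Qed.

Lemma L2_cut n f : L2 f -> L2 (fun x => (1 - cutoff n x) * f x).
Proof.
move=> lf; have := L2B lf (L2_testM (cutoff_test n) lf); congr L2.
by apply/funext => x; rewrite mulrBl mul1r.
Qed.

(** The error splits into the commutator, of order [1/n] by [cut_dn], and the tail of [dn m f],
    which vanishes by dominated convergence. *)
Lemma cut_dense m f : Hinf f ->
  (fun n => L2norm (fun x => dn m (fun y => cutoff n y * f y) x - dn m f x)) @ \oo --> (0:R).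
Proof.
move=> hf; have [C C0 hC] := cut_dn m bump_test.
have lm := Hinf_L2 (Hinf_dn m hf).
have tm n : test_fun (fun y => cutoff n y * f y) by apply: testMr (cutoff_test n) _; case: hf.
apply: (@squeeze_cvgr _ _ _ _ (fun=> 0)
  (fun n => C * n.+1%:R^-1 * (\sum_(k < m) L2norm (dn k f)) +
            L2norm (fun x => (1 - cutoff n x) * dn m f x))).
- apply: nearW => n; rewrite L2norm_ge0/= -lerBlDr.
  rewrite (le_trans _ (hC f n hf))//.
  have l1 : L2 (fun x => dn m (fun y => cutoff n y * f y) x - cutoff n x * dn m f x).
    apply: L2B; first exact/bcs_L2/test_bcs/test_dn.
    by apply: L2_testM => //; exact: cutoff_test.
  have := L2normB l1 (L2_cut n lm); rewrite -/(cutoff n) lerBlDr.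
  rewrite (_ : (fun x => _ - (1 - cutoff n x) * _) =
    (fun x => dn m (fun y => cutoff n y * f y) x - dn m f x))//.
  by apply/funext => x; ring.
- exact: cvg_cst.
- set S := \sum_(k < m) _.
  have -> : 0 = C * 0 * S + 0 by rewrite mulr0 mul0r addr0.
  apply: cvgD; last exact: cut_tail.
  apply: cvgM; last exact: cvg_cst.
  by apply: cvgM; [exact: cvg_cst|exact: cvg_harmonic].
Qed.

End Cutoff.

(** * Fourier transforms and Plancherel's formula *)

Section FTCline.
Variable R : realType.
Implicit Types f g h F : R -> R.

(** The sharp counterpart of [cutoff]: increasing in [n], as monotone convergence demands, and equal
    to its own square, which [lmult_L2] exploits. *)
Definition cutI n (x : R) : R := \1_`[(- n%:R)%R, n%:R] x.

Lemma cutI01 n x : 0 <= cutI n x <= 1.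
Proof. by rewrite /cutI indicE; case: (_ \in _); rewrite /= ?lexx ?ler01. Qed.

Lemma cutI_meas n : measurable_fun setT (cutI n).
Proof. exact: measurable_indic. Qed.

Lemma cutI1 n x : `|x| <= n%:R -> cutI n x = 1.
Proof. by move=> xn; rewrite /cutI indicE mem_set//= in_itv/= -ler_norml. Qed.

Lemma cutI0 n x : n%:R < `|x| -> cutI n x = 0.
Proof.
move=> xn; rewrite /cutI indicE memNset//= in_itv/= => h.
by move: xn; rewrite ltNge ler_norml h.
Qed.

Lemma cutI_bcs n : bcs (cutI n).
Proof.
split; first exact: cutI_meas.
exists n%:R, 1; split=> x; last exact: cutI0.
by have /andP[h0 h1] := cutI01 n x; rewrite ger0_norm.
Qed.

Lemma cutI_nd x : nondecreasing_seq (fun n => cutI n x).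
Proof.
move=> n m nm; have [xn|xn] := leP `|x| n%:R.
  by rewrite !cutI1// (le_trans xn)// ler_nat.
by rewrite cutI0//; have /andP[] := cutI01 m x.
Qed.

Lemma cutI_cvg x : cutI n x @[n --> \oo] --> (1:R).
Proof.
apply: cvg_near_cst.
have [n xn] : exists n : nat, `|x| <= n%:R.
  by exists (Num.truncn `|x|).+1; apply/ltW; exact: truncnS_gt.
by exists n => // m /= nm; rewrite cutI1// (le_trans xn)// ler_nat.
Qed.

(** Monotone convergence, arranged so that uniform bounds on truncated integrals yield integrability
    as a conclusion. *)
Lemma L1_mono f (C : R) : measurable_fun setT f -> (forall x, 0 <= f x) ->
  (forall n, L1 (fun x => cutI n x * f x)) ->
  (forall n, intR (fun x => cutI n x * f x) <= C) -> L1 f /\ intR f <= C.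
Proof.
move=> mf f0 ig iC.
have cv : ((\int[@leb R]_x (cutI n x * f x)%:E)%E @[n --> \oo] -->
    (\int[@leb R]_x (f x)%:E)%E).
  have -> : (\int[@leb R]_x (f x)%:E)%E =
      (\int[@leb R]_x limn (fun n => (cutI n x * f x)%:E))%E.
    apply: eq_integral => x _; apply/esym/cvg_lim => //.
    apply: cvg_EFin; first exact: nearW.
    rewrite -[X in _ --> X]mul1r; apply: cvgM; [exact: cutI_cvg|exact: cvg_cst].
  apply: cvg_monotone_convergence => //.
  - by move=> n; apply/measurable_EFinP; exact: (L1_meas (ig n)).
  - by move=> n x _; rewrite lee_fin mulr_ge0//; have /andP[] := cutI01 n x.
  - by move=> x _ n m nm; rewrite lee_fin ler_wpM2r//; exact: cutI_nd.
have le1 : (\int[@leb R]_x (f x)%:E <= C%:E)%E.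
  rewrite -(cvg_lim _ cv)//; apply: lime_le.
    by apply/cvg_ex; eexists; exact: cv.
  by apply: nearW => n; rewrite -(intR_EFin (ig n)) lee_fin.
have igf : L1 f.
  apply/integrableP; split; first exact/measurable_EFinP.
  under eq_integral => x _ do rewrite gee0_abs ?lee_fin//.
  by rewrite (le_lt_trans le1) ?ltry.
by split=> //; rewrite -lee_fin (intR_EFin igf).
Qed.

(** A nonnegative derivative makes the truncated integrals increase to [l - l'], so integrability
    comes for free and dominated convergence then identifies the value. *)
Lemma FTC_line F (l l' : R) : dif F -> continuous (derive1 F) ->
  (forall x, 0 <= derive1 F x) ->
  F n%:R @[n --> \oo] --> l -> F (- n%:R) @[n --> \oo] --> l' ->
  L1 (derive1 F) /\ intR (derive1 F) = l - l'.
Proof.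
move=> dF cF F0 Fl Fl'.
have n0 n : - n%:R <= n%:R :> R by rewrite ge0_cp.
have ig n : L1 (fun x => cutI n x * derive1 F x).
  by apply: bcs_L1; apply: bcsMc => //; exact: cutI_bcs.
have E n : intR (fun x => cutI n x * derive1 F x) = F n%:R - F (- n%:R).
  exact: FTC_itv (n0 n) dF cF.
have cv : F n%:R - F (- n%:R) @[n --> \oo] --> l - l' by exact: cvgB.
have ndE n m : (n <= m)%N -> F n%:R - F (- n%:R) <= F m%:R - F (- m%:R).
  move=> nm; rewrite -!E; apply: le_intR => // x.
  by rewrite ler_wpM2r//; exact: cutI_nd.
have [|iF _] := @L1_mono _ (l - l') (cont_meas cF) F0 ig.
  move=> n; rewrite E -(cvg_lim _ cv)//; apply: limr_ge.
    by apply/cvg_ex; eexists; exact: cv.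
  by exists n => // m /= nm; exact: ndE.
split=> //.
have [||||_ cv2] := @intR_cvg R (fun n x => cutI n x * derive1 F x) (derive1 F) (derive1 F).
- by move=> n; exact: L1_meas (ig n).
- exact: iF.
- move=> n x; have /andP[c0 c1] := cutI01 n x.
  by rewrite normrM !ger0_norm// ler_piMl.
- move=> x; rewrite -[X in _ --> X]mul1r; apply: cvgM; [exact: cutI_cvg|exact: cvg_cst].
apply: (@cvg_unique _ (@Rhausdorff R) _ _ _ _ cv2).
have -> : (fun n => intR (fun x => cutI n x * derive1 F x)) =
  (fun n => F n%:R - F (- n%:R)) by apply/funext.
exact: cv.
Qed.

(** The Poisson kernel of the upper half-plane at height [d], without the factor [1/pi]. Its total
    mass is therefore [pi], and the cosine transform of [expw d] is twice this kernel. *)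
Definition poissonK (d a : R) : R := d / (d ^+ 2 + a ^+ 2).

Lemma poissonK_den_gt0 (d a : R) : 0 < d -> 0 < d ^+ 2 + a ^+ 2.
Proof. by move=> d0; rewrite ltr_pwDl ?exprn_gt0 ?sqr_ge0. Qed.

Lemma poissonK_ge0 d a : 0 < d -> 0 <= poissonK d a.
Proof. by move=> d0; rewrite /poissonK divr_ge0 ?ltW// poissonK_den_gt0. Qed.

Lemma poissonK_cont d : 0 < d -> continuous (poissonK d).
Proof.
move=> d0 a; apply: cvgM; first exact: cvg_cst.
apply: cvgV; first by rewrite gt_eqF// poissonK_den_gt0.
by apply: cvgD; [exact: cvg_cst|exact: exprn_continuous].
Qed.

Lemma cvg_natr_affine (c e : R) : 0 < c -> (c * n%:R + e) @[n --> \oo] --> +oo.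
Proof.
move=> c0; apply/cvgryPge => A.
have [n hn] : exists n : nat, (A - e) / c <= n%:R.
  by exists (Num.truncn ((A - e) / c)).+1; apply/ltW; exact: truncnS_gt.
exists n => // m /= nm; rewrite -lerBlDr mulrC -ler_pdivrMr//.
by rewrite (le_trans hn)// ler_nat.
Qed.

Lemma poissonK_int d x : 0 < d -> L1 (fun y => poissonK d (x - y)) /\ intR (fun y => poissonK d (x - y)) = pi.
Proof.
move=> d0; have dn0 : d != 0 by rewrite gt_eqF.
pose F (y : R) := atan (d^-1 * y + - (x / d)).
have dat : dif (@atan R) by move=> y; exact: derivable_atan.
have [dF dFE] := dif_affine d^-1 (- (x / d)) dat.
have E : derive1 F = fun y => poissonK d (x - y).
  rewrite /F dFE; apply/funext => y; rewrite derive1_atan /poissonK.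
  have := poissonK_den_gt0 (x - y) d0; move=> h.
  field; rewrite dn0 /= (_ : _ + _ = d ^+ 2 + (x - y) ^+ 2); last by ring.
  by rewrite gt_eqF.
have at1 : F n%:R @[n --> \oo] --> pi / 2.
  by apply: (cvg_comp _ _ (cvg_natr_affine _ _) (@cvgy_atan R)); rewrite invr_gt0.
have at2 : F (- n%:R) @[n --> \oo] --> - (pi / 2).
  have -> : (fun n : nat => F (- n%:R)) = (fun n : nat => - atan (d^-1 * n%:R + x / d)).
    apply/funext => n; rewrite /F -atanN; congr atan; ring.
  apply: cvgN.
  by apply: (cvg_comp _ _ (cvg_natr_affine _ _) (@cvgy_atan R)); rewrite invr_gt0.
have cE : continuous (derive1 F).
  rewrite E => y; apply: (@continuous_comp _ _ _ (fun z : R => x - z) (poissonK d)).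
    by apply: cvgB; [exact: cvg_cst|exact: cvg_id].
  exact: poissonK_cont.
have := FTC_line dF cE _ at1 at2; rewrite E => -[|? ->].
  by move=> y; exact: poissonK_ge0.
by split=> //; rewrite opprK -splitr.
Qed.

Lemma L1_lorentz : L1 (fun x : R => (1 + x ^+ 2)^-1).
Proof.
have [h _] := poissonK_int 0 (@ltr01 R); move: h; congr L1; apply/funext => x.
by rewrite /poissonK sub0r sqrrN expr1n mul1r.
Qed.

Definition expw (d x : R) : R := expR (- (d * `|x|)).

Lemma expw_cont d : continuous (expw d).
Proof.
move=> x; apply: continuous_comp; last exact: continuous_expR.
by apply: cvgN; apply: cvgM; [exact: cvg_cst|exact: norm_continuous].
Qed.

Lemma expw_gt0 d x : 0 < expw d x. Proof. exact: expR_gt0. Qed.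

Lemma expw_le1 d x : 0 < d -> expw d x <= 1.
Proof. by move=> d0; rewrite /expw expR_le1 oppr_le0 mulr_ge0// ltW. Qed.

(* The sign-changing integrand is shifted by the integrand at [a = 0] so
   that the improper FTC for nonnegative functions applies. *)
Lemma expw_cos_aux d a : 0 < d ->
  L1 (fun x => expw d x * (1 + cos (a * x))) /\
  intR (fun x => expw d x * (1 + cos (a * x))) = 2 * (d^-1 + poissonK d a).
Proof.
move=> d0; pose f x := expw d x * (1 + cos (a * x)).
have dn0 : d != 0 by rewrite gt_eqF.
have D0 : d ^+ 2 + a ^+ 2 != 0 by rewrite gt_eqF// poissonK_den_gt0.
have ca : continuous (fun x : R => cos (a * x)).
  by move=> x; apply: continuous_comp; [apply: cvgM; [exact: cvg_cst|exact: cvg_id]|exact: continuous_cos].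
have cf : continuous f.
  move=> x; apply: cvgM; first exact: expw_cont.
  by apply: cvgD; [exact: cvg_cst|exact: ca].
have f0 x : 0 <= f x.
  by apply: mulr_ge0; [exact/ltW/expw_gt0|have := cos_geN1 (a * x); lra].
have ef : f =1 f \o -%R.
  by move=> x; rewrite /f /expw/= normrN mulrN cosN.
(* An antiderivative of the integrand on the half-line [x > 0] that tends to 0 at infinity; the
   half-line integral is [- F 0], and evenness doubles it. *)
pose F x := expR (- (d * x)) *
  (- d^-1 + (d ^+ 2 + a ^+ 2)^-1 * (a * sin (a * x) - d * cos (a * x))).
have dF (x : R) : is_derive x 1 F (expR (- (d * x)) * (1 + cos (a * x))).
  have dax : is_derive x 1 (fun x : R => a * x) a.
    by have := is_deriveZ a (is_derive_id x (1:R)); rewrite /GRing.scale/= mulr1.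
  have dnd : is_derive x 1 (fun x : R => - (d * x)) (- d).
    have := is_deriveZ d (is_derive_id x (1:R)).
    by rewrite /GRing.scale/= mulr1 => h; exact: is_deriveN.
  have d1 : is_derive x 1 (fun x : R => expR (- (d * x))) (expR (- (d * x)) * - d).
    exact: is_derive1_comp.
  have d2 : is_derive x 1 (fun x : R => sin (a * x)) (cos (a * x) * a) by exact: is_derive1_comp.
  have d3 : is_derive x 1 (fun x : R => cos (a * x)) (- sin (a * x) * a) by exact: is_derive1_comp.
  have d4 := is_deriveZ a d2; have d5 := is_deriveZ d d3.
  have d6 := is_deriveB d4 d5.
  have d7 := is_deriveZ (d ^+ 2 + a ^+ 2)^-1 d6.
  have d8 := is_deriveD (is_derive_cst (- d^-1) x 1) d7.
  have d9 := is_deriveM d1 d8.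
  have -> : F = (fun x : R => expR (- (d * x))) * ((cst (- d^-1)) + (d ^+ 2 + a ^+ 2)^-1 \*: (a \*: (fun x : R => sin (a * x)) - d \*: (fun x : R => cos (a * x)))).
    by apply/funext => y; rewrite /F !fctE.
  apply: (is_derive_eq d9).
  change (expR (- (d * x)) * (0 + (d ^+ 2 + a ^+ 2)^-1 *
      (a * (cos (a * x) * a) - d * (- sin (a * x) * a))) +
    (- d^-1 + (d ^+ 2 + a ^+ 2)^-1 * (a * sin (a * x) - d * cos (a * x))) *
      (expR (- (d * x)) * - d) = expR (- (d * x)) * (1 + cos (a * x))).
  by field; rewrite D0 dn0.
have [difF dFE] := dif_dE dF.
have cF := dif_cont difF.
have Fy : F x @[x --> +oo] --> (0:R).
  pose K := d^-1 + (d ^+ 2 + a ^+ 2)^-1 * (`|a| + d).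
  have K0 : 0 <= K.
    have := poissonK_den_gt0 a d0 => D; rewrite addr_ge0 ?invr_ge0 ?(ltW d0)//.
    by apply: mulr_ge0; [rewrite invr_ge0 ltW|rewrite addr_ge0// ltW].
  have FK x : `|F x| <= expR (- (d * x)) * K.
    rewrite /F normrM ger0_norm ?expR_ge0// ler_wpM2l ?expR_ge0//.
    rewrite (le_trans (ler_normD _ _))// normrN (ger0_norm (_ : 0 <= d^-1)) ?invr_ge0 ?(ltW d0)//.
    rewrite lerD2l normrM normfV (ger0_norm (ltW (poissonK_den_gt0 a d0))).
    rewrite ler_wpM2l ?invr_ge0 ?(ltW (poissonK_den_gt0 a d0))//.
    rewrite (le_trans (ler_normB _ _))// !normrM (ger0_norm (ltW d0)).
    by rewrite lerD// ler_piMr ?(ltW d0)// ler_norml ?sin_geN1 ?sin_le1 ?cos_geN1 ?cos_le1.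
  have eK : expR (- (d * x)) * K @[x --> +oo] --> (0:R).
    rewrite -(mul0r K); apply: cvgM; last exact: cvg_cst.
    apply: (@cvg_comp _ _ _ (fun x => d * x) (fun y => expR (- y))); last exact: cvgr_expR.
    apply/cvgryPge => A; exists (A / d); split; first exact: num_real.
    by move=> x Ax; rewrite mulrC -ler_pdivrMr// ltW.
  apply: (@squeeze_cvgr _ _ _ _ (fun x => - (expR (- (d * x)) * K)) (fun x => expR (- (d * x)) * K)).
  - by apply: nearW => x; rewrite -ler_norml.
  - by have := cvgN eK; rewrite oppr0; exact.
  - exact: eK.
have h1 : (\int[@leb R]_(x in `[0%R, +oo[) (f x)%:E = 0%:E - (F 0%R)%:E)%E.
  apply: ge0_continuous_FTC2y => //.
  - exact: continuous_subspaceT.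
  - exact/cvg_at_right_filter/cF.
  - move=> x; rewrite in_itv/= andbT => x0; rewrite dFE /f /expw.
    by rewrite (gtr0_norm x0).
have F0 : F 0 = - (d^-1 + poissonK d a).
  rewrite /F /poissonK !mulr0 oppr0 expR0 sin0 cos0; field.
  by rewrite D0 dn0.
have h2 : (\int[@leb R]_x (f x)%:E = (2 * (d^-1 + poissonK d a))%:E)%E.
  rewrite ge0_symfun_integralT// -set_itvcy h1 F0 sub0e EFinN oppeK.
  by rewrite EFinM.
have if1 : L1 f.
  apply/integrableP; split.
    by apply/measurable_EFinP; exact: cont_meas cf.
  under eq_integral => x _ do rewrite gee0_abs ?lee_fin//.
  by rewrite h2 ltry.
by split=> //; rewrite /intR /Rintegral h2.
Qed.

Lemma expw_L1 d : 0 < d -> L1 (expw d).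
Proof.
move=> d0; have [h _] := expw_cos_aux 0 d0.
have := L1Z 2^-1 h; congr L1; apply/funext => x.
by rewrite mul0r cos0 (_ : 1 + 1 = 2)// mulrC -mulrA divff ?mulr1.
Qed.

Lemma expw_cos d a : 0 < d -> L1 (fun x => expw d x * cos (a * x)) /\
  intR (fun x => expw d x * cos (a * x)) = 2 * poissonK d a.
Proof.
move=> d0; have [h1 E1] := expw_cos_aux a d0; have [h0 E0] := expw_cos_aux 0 d0.
have h := L1Z 2^-1 h0; have hB := L1B h1 h.
have E : (fun x => expw d x * cos (a * x)) =
   (fun x => expw d x * (1 + cos (a * x)) - 2^-1 * (expw d x * (1 + cos (0 * x)))).
  by apply/funext => x; rewrite mul0r cos0; field.
rewrite E; split=> //.
rewrite intRB// intRZ// E1 E0 /poissonK; field.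
by rewrite !gt_eqF ?poissonK_den_gt0.
Qed.

Lemma poissonK_le (d a : R) : 0 < d -> poissonK d a <= d^-1.
Proof.
move=> d0; rewrite /poissonK ler_pdivrMr ?poissonK_den_gt0// ler_pdivlMl//.
by rewrite -expr2 lerDl sqr_ge0.
Qed.

Lemma poissonK_sym (d x y : R) : poissonK d (x - y) = poissonK d (y - x).
Proof. by rewrite /poissonK -(opprB y x) sqrrN. Qed.

(** For [a^2 >= s^2] one has [s^2 / (s^4 + a^2) <= s^2 / a^2 <= 2 s^2 / (s^2 + a^2)]. Away from its
    centre the kernel of height [s^2] is thus dominated by [2 s] times a kernel of mass [pi], which
    makes the tail of order [s]. *)
Lemma poissonK_split (s a : R) : 0 < s -> s <= `|a| -> poissonK (s ^+ 2) a <= 2 * s * poissonK s a.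
Proof.
move=> s0 sa; rewrite /poissonK.
have D1 := poissonK_den_gt0 a (exprn_gt0 2 s0); have D2 := poissonK_den_gt0 a s0.
have a2 : s ^+ 2 <= a ^+ 2.
  by rewrite -(real_normK (num_real a)) lerXn2r// nnegrE// ltW.
rewrite ler_pdivrMr// mulrA mulrAC ler_pdivlMr//.
rewrite (_ : 2 * s * s = 2 * s ^+ 2); last by ring.
have s20 : 0 <= s ^+ 2 by rewrite sqr_ge0.
have := sqr_ge0 (s ^+ 2); move: (s ^+ 2) (a ^+ 2) (s ^+ 2 ^+ 2) s20 a2 => S A S4 *.
by nra.
Qed.

End FTCline.

(** * Cosine and sine transforms of compactly supported functions *)

Section Fourier.
Variable R : realType.
Implicit Types f g h psi : R -> R.

Definition cosT f (xi : R) : R := intR (fun y => f y * cos (y * xi)).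
Definition sinT f (xi : R) : R := intR (fun y => f y * sin (y * xi)).
(* The real part of the Fourier transform of [f] times the conjugate of that of [g]. *)
Definition spec f g (xi : R) : R := cosT f xi * cosT g xi + sinT f xi * sinT g xi.
Definition L1norm f : R := intR (fun x => `|f x|).

Lemma L1norm_ge0 f : 0 <= L1norm f.
Proof. by apply: intR_ge0 => x; exact: normr_ge0. Qed.

Lemma cos_bnd (x : R) : `|cos x| <= 1.
Proof. by rewrite ler_norml cos_geN1 cos_le1. Qed.

Lemma sin_bnd (x : R) : `|sin x| <= 1.
Proof. by rewrite ler_norml sin_geN1 sin_le1. Qed.

Lemma cosx_cont (xi : R) : continuous (fun y : R => cos (y * xi)).
Proof.
move=> y; apply: (@continuous_comp _ _ _ (fun z : R => z * xi) (@cos R)).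
  by apply: cvgM; [exact: cvg_id|exact: cvg_cst].
exact: continuous_cos.
Qed.

Lemma sinx_cont (xi : R) : continuous (fun y : R => sin (y * xi)).
Proof.
move=> y; apply: (@continuous_comp _ _ _ (fun z : R => z * xi) (@sin R)).
  by apply: cvgM; [exact: cvg_id|exact: cvg_cst].
exact: continuous_sin.
Qed.

Lemma cosT_L1 f xi : bcs f -> L1 (fun y => f y * cos (y * xi)).
Proof. by move=> bf; apply/bcs_L1/bcsMc => //; exact: cosx_cont. Qed.

Lemma sinT_L1 f xi : bcs f -> L1 (fun y => f y * sin (y * xi)).
Proof. by move=> bf; apply/bcs_L1/bcsMc => //; exact: sinx_cont. Qed.

Lemma cosT_bnd f xi : bcs f -> `|cosT f xi| <= L1norm f.
Proof.
move=> bf; apply: norm_intR_le; [exact: cosT_L1|exact/L1_norm/bcs_L1|move=> x].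
by rewrite normrM ler_piMr// cos_bnd.
Qed.

Lemma sinT_bnd f xi : bcs f -> `|sinT f xi| <= L1norm f.
Proof.
move=> bf; apply: norm_intR_le; [exact: sinT_L1|exact/L1_norm/bcs_L1|move=> x].
by rewrite normrM ler_piMr// sin_bnd.
Qed.

Lemma meas2 f g : measurable_fun setT f -> measurable_fun setT g ->
  measurable_fun setT (fun p : R * R => f p.1 * g p.2).
Proof.
move=> mf mg; apply: measurable_funM.
  exact: (measurableT_comp mf measurable_fst).
exact: (measurableT_comp mg measurable_snd).
Qed.

Lemma meas2c g : continuous g -> measurable_fun setT (fun p : R * R => g (p.1 * p.2)).
Proof.
move=> cg; apply: (measurableT_comp (cont_meas cg)).
by apply: (@measurable_funM _ _ _ setT fst snd); [exact: measurable_fst|exact: measurable_snd].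
Qed.

(** Measurability in [xi] is read off a Fubini marginal, which needs integrability in both
    variables. The weight [expw 1 xi] supplies it and is divided out afterwards. *)
Lemma ftrig_meas f g : continuous g -> (forall x, `|g x| <= 1) -> bcs f ->
  measurable_fun setT (fun xi => intR (fun y => f y * g (y * xi))).
Proof.
move=> cg g1 bf; pose F y xi := f y * g (y * xi) * expw 1 xi.
have iF := bcs_L1 bf; have iw := expw_L1 (@ltr01 R).
have mF : measurable_fun setT (fun p : R * R => F p.1 p.2).
  apply: measurable_funM; last exact: (measurableT_comp (cont_meas (@expw_cont R 1)) measurable_snd).
  apply: measurable_funM; last exact: meas2c.
  by apply: (measurableT_comp _ measurable_fst); case: bf.
have bF y xi : `|F y xi| <= `|f y| * expw 1 xi.
  rewrite /F !normrM (ger0_norm (ltW (expw_gt0 1 xi))).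
  by rewrite ler_wpM2r ?(ltW (expw_gt0 1 xi))// ler_piMr.
have := L1_marg2 mF (L1_norm iF) iw bF => /L1_meas mG.
have ew : continuous (fun xi : R => expR `|xi|).
  by move=> xi; apply: continuous_comp; [exact: norm_continuous|exact: continuous_expR].
have := measurable_funM mG (cont_meas ew); congr measurable_fun.
apply/funext => xi; rewrite /F /=.
have -> : (fun y => f y * g (y * xi) * expw 1 xi) = (fun y => expw 1 xi * (f y * g (y * xi))).
  by apply/funext => y; rewrite mulrC.
rewrite intRZ; last first.
  apply/bcs_L1/bcsMc => // y; apply: (@continuous_comp _ _ _ (fun z : R => z * xi) g).
    by apply: cvgM; [exact: cvg_id|exact: cvg_cst].
  exact: cg.
by rewrite /expw mul1r mulrAC -expRD addNr expR0 mul1r.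
Qed.

Lemma cosT_meas f : bcs f -> measurable_fun setT (cosT f).
Proof. by move=> bf; apply: ftrig_meas => //; [exact: continuous_cos|exact: cos_bnd]. Qed.

Lemma sinT_meas f : bcs f -> measurable_fun setT (sinT f).
Proof. by move=> bf; apply: ftrig_meas => //; [exact: continuous_sin|exact: sin_bnd]. Qed.

Lemma pr_meas f g : bcs f -> bcs g -> measurable_fun setT (spec f g).
Proof.
move=> bf bg.
have m1 := measurable_funM (cosT_meas bf) (cosT_meas bg).
have m2 := measurable_funM (sinT_meas bf) (sinT_meas bg).
exact: measurable_funD m1 m2.
Qed.

(** The right-hand side is the real part of [exp (i x xi)] times the Fourier transform of [g], the
    form in which the integrand of [lmult] is handled from here on. *)
Lemma fcos_shift g x xi : bcs g ->
  intR (fun y => g y * cos ((x - y) * xi)) = cos (x * xi) * cosT g xi + sin (x * xi) * sinT g xi.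
Proof.
move=> bg; rewrite /cosT /sinT -!intRZ; [|exact: sinT_L1|exact: cosT_L1].
rewrite -intRD; [|exact/L1Z/cosT_L1|exact/L1Z/sinT_L1].
by congr intR; apply/funext => y; rewrite mulrBl cosB; ring.
Qed.

Lemma fcD f g xi : bcs f -> bcs g -> cosT (fun x => f x + g x) xi = cosT f xi + cosT g xi.
Proof.
move=> bf bg; rewrite /cosT -intRD; [|exact: cosT_L1..].
by congr intR; apply/funext => y; rewrite mulrDl.
Qed.

Lemma fsD f g xi : bcs f -> bcs g -> sinT (fun x => f x + g x) xi = sinT f xi + sinT g xi.
Proof.
move=> bf bg; rewrite /sinT -intRD; [|exact: sinT_L1..].
by congr intR; apply/funext => y; rewrite mulrDl.
Qed.

Lemma fcZ c f xi : bcs f -> cosT (fun x => c * f x) xi = c * cosT f xi.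
Proof.
move=> bf; rewrite /cosT -intRZ; [|exact: cosT_L1].
by congr intR; apply/funext => y; rewrite mulrA.
Qed.

Lemma fsZ c f xi : bcs f -> sinT (fun x => c * f x) xi = c * sinT f xi.
Proof.
move=> bf; rewrite /sinT -intRZ; [|exact: sinT_L1].
by congr intR; apply/funext => y; rewrite mulrA.
Qed.

Lemma dif_cosx (xi : R) : dif (fun y : R => cos (y * xi)) /\
  derive1 (fun y : R => cos (y * xi)) = fun y => - xi * sin (y * xi).
Proof.
apply: dif_dE => y.
have d1 : is_derive y 1 (fun y : R => y * xi) xi.
  have := is_deriveZ xi (is_derive_id y (1:R)).
  rewrite /GRing.scale/= mulr1; congr is_derive.
  by apply/funext => z; rewrite /GRing.scale/= mulrC.
have d2 := @is_derive1_comp R (@cos R) (fun z : R => z * xi) y _ _ (is_derive_cos _) d1.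
by apply: (is_derive_eq d2); rewrite mulrC mulrN mulNr.
Qed.

Lemma dif_sinx (xi : R) : dif (fun y : R => sin (y * xi)) /\
  derive1 (fun y : R => sin (y * xi)) = fun y => xi * cos (y * xi).
Proof.
apply: dif_dE => y.
have d1 : is_derive y 1 (fun y : R => y * xi) xi.
  have := is_deriveZ xi (is_derive_id y (1:R)).
  rewrite /GRing.scale/= mulr1; congr is_derive.
  by apply/funext => z; rewrite /GRing.scale/= mulrC.
by apply: (is_derive_eq (is_derive1_comp _ _)); rewrite mulrC.
Qed.

Lemma cosT_d1 psi xi : test_fun psi -> cosT (derive1 psi) xi = xi * sinT psi xi.
Proof.
move=> tp; have [dc cE] := dif_cosx xi.
have bp := test_bcs tp; have [sp [M pM]] := tp.
have cc : continuous (derive1 (fun y : R => cos (y * xi))).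
  by rewrite cE => y; apply: cvgM; [exact: cvg_cst|exact: sinx_cont].
have := ibp dc cc (smooth_dif sp) (smooth_cont (smooth_d1 sp)) pM.
rewrite cE /cosT /sinT => h.
have -> : (fun y => derive1 psi y * cos (y * xi)) = (fun y => cos (y * xi) * derive1 psi y).
  by apply/funext => y; rewrite mulrC.
apply: oppr_inj; rewrite -h -intRZ; last exact: sinT_L1.
rewrite -intRN; last by apply/L1Z/sinT_L1.
by congr intR; apply/funext => y; ring.
Qed.

Lemma sinT_d1 psi xi : test_fun psi -> sinT (derive1 psi) xi = - (xi * cosT psi xi).
Proof.
move=> tp; have [dc cE] := dif_sinx xi.
have bp := test_bcs tp; have [sp [M pM]] := tp.
have cc : continuous (derive1 (fun y : R => sin (y * xi))).
  by rewrite cE => y; apply: cvgM; [exact: cvg_cst|exact: cosx_cont].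
have := ibp dc cc (smooth_dif sp) (smooth_cont (smooth_d1 sp)) pM.
rewrite cE /cosT /sinT => h.
have -> : (fun y => derive1 psi y * sin (y * xi)) = (fun y => sin (y * xi) * derive1 psi y).
  by apply/funext => y; rewrite mulrC.
apply: oppr_inj; rewrite -h opprK -intRZ; last exact: cosT_L1.
by congr intR; apply/funext => y; ring.
Qed.

Definition lor (xi : R) : R := (1 + xi ^+ 2)^-1.

Lemma lor_den (xi : R) : 0 < 1 + xi ^+ 2.
Proof. by rewrite ltr_pwDl// sqr_ge0. Qed.

Lemma lor_gt0 xi : 0 < lor xi. Proof. by rewrite invr_gt0 lor_den. Qed.

Lemma lor_le1 xi : lor xi <= 1.
Proof. by rewrite invf_le1 ?lor_den// lerDl sqr_ge0. Qed.

Lemma lor_xi xi : `|xi| * lor xi <= 1.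
Proof.
rewrite ler_pdivrMr ?lor_den// mul1r -(real_normK (num_real xi)).
by have := sqr_ge0 (`|xi| - 1); rewrite sqrrB; have := normr_ge0 xi; lra.
Qed.

Lemma test_lap psi : test_fun psi -> test_fun (fun x => psi x + - 1 * dn 2 psi x).
Proof. by move=> tp; apply: testD => //; apply: testZ; exact: test_dn. Qed.

Lemma cosT_lap psi xi : test_fun psi ->
  cosT (fun x => psi x + - 1 * dn 2 psi x) xi = (1 + xi ^+ 2) * cosT psi xi.
Proof.
move=> tp; have t1 := test_d1 tp; have t2 := test_d1 t1.
rewrite fcD ?fcZ; [|exact: test_bcs..|exact: test_bcs (testZ _ _)].
by rewrite cosT_d1// sinT_d1//; ring.
Qed.

Lemma sinT_lap psi xi : test_fun psi ->
  sinT (fun x => psi x + - 1 * dn 2 psi x) xi = (1 + xi ^+ 2) * sinT psi xi.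
Proof.
move=> tp; have t1 := test_d1 tp; have t2 := test_d1 t1.
rewrite fsD ?fsZ; [|exact: test_bcs..|exact: test_bcs (testZ _ _)].
by rewrite sinT_d1// cosT_d1//; ring.
Qed.

(** The operator [1 - d_x^2] multiplies both transforms by [1 + xi^2] and is applied twice. One
    resulting power of [lor] ensures integrability; the other absorbs a factor [|xi|] when the
    exponential weight is removed. *)
Lemma f_decay psi : test_fun psi -> exists2 C : R, 0 <= C &
  forall xi, `|cosT psi xi| <= C * lor xi ^+ 2 /\ `|sinT psi xi| <= C * lor xi ^+ 2.
Proof.
move=> tp; have t1 := test_lap tp; have t2 := test_lap t1.
set p2 := fun x => _ in t2; exists (L1norm p2); first exact: L1norm_ge0.
move=> xi.
have E1 : cosT psi xi = cosT p2 xi * lor xi ^+ 2.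
  by rewrite /p2 cosT_lap// cosT_lap// /lor; field; rewrite gt_eqF ?lor_den.
have E2 : sinT psi xi = sinT p2 xi * lor xi ^+ 2.
  by rewrite /p2 sinT_lap// sinT_lap// /lor; field; rewrite gt_eqF ?lor_den.
have l0 : 0 <= lor xi ^+ 2 by rewrite sqr_ge0.
have b2 := test_bcs t2.
split; [rewrite E1|rewrite E2]; rewrite normrM (ger0_norm l0) ler_wpM2r//.
  exact: cosT_bnd.
exact: sinT_bnd.
Qed.

Lemma spec_decay f psi : bcs f -> test_fun psi -> exists2 C : R, 0 <= C &
  forall xi, `|spec f psi xi| <= C * lor xi ^+ 2.
Proof.
move=> bf tp; have [C C0 hC] := f_decay tp.
exists (2 * L1norm f * C); first by rewrite !mulr_ge0// L1norm_ge0.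
move=> xi; have [h1 h2] := hC xi; rewrite /spec (le_trans (ler_normD _ _))// !normrM.
have l0 : 0 <= C * lor xi ^+ 2 by rewrite mulr_ge0// sqr_ge0.
have := ler_pM (normr_ge0 _) (normr_ge0 _) (cosT_bnd xi bf) h1.
have := ler_pM (normr_ge0 _) (normr_ge0 _) (sinT_bnd xi bf) h2.
by lra.
Qed.

Lemma lor2_L1 C : L1 (fun xi => C * lor xi ^+ 2).
Proof.
apply: L1Z; apply: L1_le (L1_lorentz R) _.
  apply: measurable_funX; exact: L1_meas (L1_lorentz R).
move=> x; rewrite ger0_norm ?sqr_ge0// expr2.
by have := lor_le1 x; have := lor_gt0 x; rewrite -/(lor x); nra.
Qed.

Lemma spec_L1 f psi : bcs f -> test_fun psi -> L1 (spec f psi).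
Proof.
move=> bf tp; have [C C0 hC] := spec_decay bf tp.
by apply: L1_le (lor2_L1 C) hC; apply: pr_meas => //; exact: test_bcs.
Qed.

End Fourier.

(** * Plancherel's formula by Poisson summability *)

Section Plancherel.
Variable R : realType.
Implicit Types f g h m b psi : R -> R.
Implicit Types d x a : R.

Lemma twist_bnd g x xi : bcs g ->
  `|cos (x * xi) * cosT g xi + sin (x * xi) * sinT g xi| <= 2 * L1norm g.
Proof.
move=> bg; rewrite (le_trans (ler_normD _ _))// !normrM.
have := ler_pM (normr_ge0 _) (normr_ge0 _) (cos_bnd (x * xi)) (cosT_bnd xi bg).
have := ler_pM (normr_ge0 _) (normr_ge0 _) (sin_bnd (x * xi)) (sinT_bnd xi bg).
by lra.
Qed.

Lemma twist_meas f g m : measurable_fun setT f -> bcs g -> measurable_fun setT m ->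
  measurable_fun setT (fun p : R * R =>
    f p.1 * (m p.2 * (cos (p.1 * p.2) * cosT g p.2 + sin (p.1 * p.2) * sinT g p.2))).
Proof.
move=> mf bg mm; apply: measurable_funM; first exact: (measurableT_comp mf measurable_fst).
apply: measurable_funM; first exact: (measurableT_comp mm measurable_snd).
apply: measurable_funD; apply: measurable_funM.
- exact: meas2c (@continuous_cos R).
- exact: (measurableT_comp (cosT_meas bg) measurable_snd).
- exact: meas2c (@continuous_sin R).
- exact: (measurableT_comp (sinT_meas bg) measurable_snd).
Qed.

Lemma pr_twist f g xi : bcs f -> bcs g ->
  intR (fun x => f x * (cos (x * xi) * cosT g xi + sin (x * xi) * sinT g xi)) = spec f g xi.
Proof.
move=> bf bg; rewrite /spec mulrC (mulrC (sinT f xi)) [X in _ * X + _]/cosT [X in _ + _ * X]/sinT.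
rewrite -!intRZ; [|exact: sinT_L1|exact: cosT_L1].
rewrite -intRD; [|exact/L1Z/cosT_L1|exact/L1Z/sinT_L1].
by congr intR; apply/funext => y; ring.
Qed.

(** Fubini for a general multiplier [m], used both with the weight [expw d] and with the Whitham
    symbol. The majorant [b] must be uniform in [x] to give the product bound. *)
Lemma mult_pairing f g m b : bcs f -> bcs g -> measurable_fun setT m -> L1 b ->
  (forall x xi, `|m xi * (cos (x * xi) * cosT g xi + sin (x * xi) * sinT g xi)| <= b xi) ->
  intR (fun xi => m xi * spec f g xi) =
  intR (fun x => f x * intR (fun xi => m xi * (cos (x * xi) * cosT g xi + sin (x * xi) * sinT g xi))).
Proof.
move=> bf bg mm ib mb.
have mF := twist_meas (L1_meas (bcs_L1 bf)) bg mm.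
have iF := L1_norm (bcs_L1 bf).
pose F x xi := f x * (m xi * (cos (x * xi) * cosT g xi + sin (x * xi) * sinT g xi)).
have bF x xi : `|F x xi| <= `|f x| * b xi by rewrite /F normrM ler_wpM2l.
have := FubiniR (F := F) mF iF ib bF => E.
transitivity (intR (fun xi => intR (F ^~ xi))).
  congr intR; apply/funext => xi.
  have i1 : L1 (fun x => f x * (cos (x * xi) * cosT g xi + sin (x * xi) * sinT g xi)).
    apply: bcs_L1; apply: (bcsMc bf) => x.
    apply: cvgD; apply: cvgM; [exact: cosx_cont|exact: cvg_cst|exact: sinx_cont|exact: cvg_cst].
  rewrite -(pr_twist xi bf bg) -(intRZ (m xi) i1).
  by congr intR; apply/funext => x; rewrite /F mulrCA.
rewrite -E; congr intR; apply/funext => x.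
have mc : measurable_fun setT (fun xi => cos (x * xi)).
  by have := cont_meas (@cosx_cont R x); under eq_fun do rewrite mulrC.
have ms : measurable_fun setT (fun xi => sin (x * xi)).
  by have := cont_meas (@sinx_cont R x); under eq_fun do rewrite mulrC.
have m1 := measurable_funD (measurable_funM mc (cosT_meas bg)) (measurable_funM ms (sinT_meas bg)).
have ix : L1 (fun xi => m xi * (cos (x * xi) * cosT g xi + sin (x * xi) * sinT g xi)).
  exact: L1_le (measurable_funM mm m1) ib (mb x).
by rewrite -(intRZ (f x) ix).
Qed.

Lemma poisson_twist g x d : 0 < d -> bcs g ->
  intR (fun xi => expw d xi * (cos (x * xi) * cosT g xi + sin (x * xi) * sinT g xi)) =
  intR (fun y => g y * (2 * poissonK d (x - y))).
Proof.
move=> d0 bg; have iw := expw_L1 d0; have ig := L1_norm (bcs_L1 bg).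
pose F y xi := g y * (expw d xi * cos ((x - y) * xi)).
have mF : measurable_fun setT (fun p : R * R => F p.1 p.2).
  apply: measurable_funM.
    by apply: (measurableT_comp _ measurable_fst); case: bg.
  apply: measurable_funM.
    exact: (measurableT_comp (cont_meas (@expw_cont R d)) measurable_snd).
  apply: (measurableT_comp (cont_meas (@continuous_cos R))).
  apply: measurable_funM; last exact: measurable_snd.
  by apply: measurable_funB => //; exact: measurable_fst.
have bF y xi : `|F y xi| <= `|g y| * expw d xi.
  rewrite /F !normrM (ger0_norm (ltW (expw_gt0 d xi))) ler_wpM2l//.
  by rewrite ler_piMr ?(ltW (expw_gt0 d xi))// cos_bnd.
have := FubiniR mF ig iw bF => E.
transitivity (intR (fun xi => intR (F ^~ xi))).
  congr intR; apply/funext => xi.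
  have i1 : L1 (fun y => g y * cos ((x - y) * xi)).
    apply: bcs_L1; apply: (bcsMc bg) => y.
    apply: (@continuous_comp _ _ _ (fun z : R => (x - z) * xi) (@cos R)).
      by apply: cvgM; [apply: cvgB; [exact: cvg_cst|exact: cvg_id]|exact: cvg_cst].
    exact: continuous_cos.
  rewrite -(fcos_shift x xi bg) -(intRZ (expw d xi) i1).
  by congr intR; apply/funext => y; rewrite /F mulrCA.
rewrite -E; congr intR; apply/funext => y.
by have [i1 <-] := expw_cos (x - y) d0; rewrite /F intRZ.
Qed.

Lemma poisson_pairing f g d : 0 < d -> bcs f -> bcs g ->
  intR (fun xi => expw d xi * spec f g xi) =
  intR (fun x => f x * intR (fun y => g y * (2 * poissonK d (x - y)))).
Proof.
move=> d0 bf bg; have mw : measurable_fun setT (@expw R d) by apply: cont_meas; exact: expw_cont.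
have mb x xi : `|expw d xi * (cos (x * xi) * cosT g xi + sin (x * xi) * sinT g xi)| <=
    2 * L1norm g * expw d xi.
  rewrite normrM (ger0_norm (ltW (expw_gt0 d xi))) mulrC.
  by rewrite ler_wpM2r ?(ltW (expw_gt0 d xi))// twist_bnd.
rewrite (mult_pairing bf bg mw (L1Z (2 * L1norm g) (expw_L1 d0)) mb).
by congr intR; apply/funext => x; rewrite poisson_twist.
Qed.

Lemma expw_spec_L1 f g d : 0 < d -> bcs f -> bcs g -> L1 (fun xi => expw d xi * spec f g xi).
Proof.
move=> d0 bf bg.
apply: L1_le (L1Z (2 * (L1norm f * L1norm g)) (expw_L1 d0)) _.
  by apply: measurable_funM; [apply: cont_meas; exact: expw_cont|exact: pr_meas].
move=> xi; rewrite normrM (ger0_norm (ltW (expw_gt0 d xi))) mulrC.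
rewrite ler_wpM2r ?(ltW (expw_gt0 d xi))// (le_trans (ler_normD _ _))// !normrM.
have := ler_pM (normr_ge0 _) (normr_ge0 _) (cosT_bnd xi bf) (cosT_bnd xi bg).
have := ler_pM (normr_ge0 _) (normr_ge0 _) (sinT_bnd xi bf) (sinT_bnd xi bg).
by lra.
Qed.

Lemma poisson_L1 f g d : 0 < d -> bcs f -> bcs g ->
  L1 (fun x => f x * intR (fun y => g y * (2 * poissonK d (x - y)))).
Proof.
move=> d0 bf bg; pose G x y := f x * (g y * (2 * poissonK d (x - y))).
have mf : measurable_fun setT f by case: bf.
have mg : measurable_fun setT g by case: bg.
have mP : measurable_fun setT (fun p : R * R => poissonK d (p.1 - p.2)).
  apply: (measurableT_comp (cont_meas (poissonK_cont d0))).
  by apply: measurable_funB; [exact: measurable_fst|exact: measurable_snd].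
have mG : measurable_fun setT (fun p : R * R => G p.1 p.2).
  apply: measurable_funM; first exact: (measurableT_comp mf measurable_fst).
  apply: measurable_funM; first exact: (measurableT_comp mg measurable_snd).
  exact: measurable_funM.
have iF := L1_norm (bcs_L1 bf); have ig2 := L1Z (2 * d^-1) (L1_norm (bcs_L1 bg)).
have bG x y : `|G x y| <= `|f x| * (2 * d^-1 * `|g y|).
  rewrite /G; move: (poissonK d (x - y)) (poissonK_ge0 (x - y) d0) (poissonK_le (x - y) d0) => P P0 P1.
  rewrite !normrM (ger0_norm P0) (ger0_norm (ler0n R 2)).
  apply: ler_wpM2l => //; rewrite mulrC; apply: ler_wpM2r => //; exact: ler_wpM2l.
have := L1_marg1 mG iF ig2 bG; congr L1; apply/funext => x.
rewrite /G intRZ//; apply: bcs_L1; apply: (bcsMc bg) => y.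
apply: cvgM; first exact: cvg_cst.
apply: (@continuous_comp _ _ _ (fun z : R => x - z) (poissonK d)).
  by apply: cvgB; [exact: cvg_cst|exact: cvg_id].
exact: poissonK_cont.
Qed.

(** [J] will be the indicator of an interval containing the support of [f], at the point where [u]
    is evaluated. Carrying it along keeps the second term under a product majorant, so that Fubini
    applies. *)
Lemma weighted_young (u v J P : R) : 0 <= P -> 0 <= J -> (u != 0 -> J = 1) ->
  u * (v * (2 * P)) <= u ^+ 2 * P + J * v ^+ 2 * P.
Proof.
move=> P0 J0 uJ; have [->|/uJ ->] := eqVneq u 0.
  rewrite mul0r expr0n/= mul0r add0r.
  by apply: mulr_ge0 => //; apply: mulr_ge0 => //; exact: sqr_ge0.
have := mulr_ge0 P0 (sqr_ge0 (u - v)).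
by rewrite sqrrB !expr2; lra.
Qed.

(** Schur's test for the Poisson kernel: [2 f(x) f(y) P <= f(x)^2 P + J(x) f(y)^2 P], and each term
    integrates to at most [pi * sq f] since the kernel has mass [pi] in either variable. The bound
    is uniform in [d]. The weight stays because [f] is merely [bcs] and its transform has no known
    decay. *)
Lemma bessel f d : 0 < d -> bcs f -> intR (fun xi => expw d xi * spec f f xi) <= 2 * pi * sq f.
Proof.
move=> d0 bf; rewrite poisson_pairing//.
have [M [C fMC]] := bcsP bf; pose J : R -> R := \1_`[-M, M].
have iJ : L1 J by exact: indic_itv_L1.
have J0 x : 0 <= J x by rewrite /J indicE; case: (_ \in _).
have J1 x : J x <= 1 by rewrite /J indicE; case: (_ \in _).
have if2 : L1 (fun x => f x ^+ 2) by exact/L2_sqr_L1/bcs_L2.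
pose F x y := J x * f y ^+ 2 * poissonK d (x - y).
have mP : measurable_fun setT (fun p : R * R => poissonK d (p.1 - p.2)).
  apply: (measurableT_comp (cont_meas (poissonK_cont d0))).
  by apply: measurable_funB; [exact: measurable_fst|exact: measurable_snd].
have mF : measurable_fun setT (fun p : R * R => F p.1 p.2).
  by apply: measurable_funM => //; exact: (meas2 (L1_meas iJ) (L1_meas if2)).
have iJd : L1 (fun x => J x * d^-1).
  by have := L1Z d^-1 iJ; congr L1; apply/funext => x; rewrite mulrC.
have bF x y : `|F x y| <= J x * d^-1 * f y ^+ 2.
  rewrite /F; move: (poissonK d (x - y)) (poissonK_ge0 (x - y) d0) (poissonK_le (x - y) d0) => P P0 P1.
  have f20 := sqr_ge0 (f y); have JP := mulr_ge0 (mulr_ge0 (J0 x) f20) P0.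
  rewrite (ger0_norm JP) mulrAC.
  by apply: ler_wpM2r; [exact: sqr_ge0|exact: ler_wpM2l].
have E := FubiniR mF iJd if2 bF.
have iP x : L1 (fun y => poissonK d (x - y)) by have [] := poissonK_int x d0.
have PE x : intR (fun y => poissonK d (x - y)) = pi by have [] := poissonK_int x d0.
have iS x : L1 (fun y => f x ^+ 2 * poissonK d (x - y)) by exact: L1Z.
have iFx x : L1 (F x) by exact: L1_sec1 mF if2 bF x.
have ifP x : L1 (fun y => f y * (2 * poissonK d (x - y))).
  apply: bcs_L1; apply: (bcsMc bf) => y; apply: cvgM; first exact: cvg_cst.
  apply: (@continuous_comp _ _ _ (fun z : R => x - z) (poissonK d)).
    by apply: cvgB; [exact: cvg_cst|exact: cvg_id].
  exact: poissonK_cont.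
have step x : f x * intR (fun y => f y * (2 * poissonK d (x - y))) <=
    f x ^+ 2 * pi + intR (F x).
  have e2 := intRZ (f x ^+ 2) (iP x); rewrite (PE x) in e2.
  rewrite -(intRZ (f x) (ifP x)) -e2 -(intRD (iS x) (iFx x)).
  apply: le_intR => [||y]; [exact: L1Z|exact: L1D|].
  apply: weighted_young; [exact: poissonK_ge0|exact: J0|move=> fx0].
  have := fMC x; rewrite /J indicE; case: (_ \in _); first by [].
  by rewrite mulr0 normr_le0 (negbTE fx0).
have i1 : L1 (fun x => f x ^+ 2 * pi).
  by have := L1Z pi if2; congr L1; apply/funext => x; rewrite mulrC.
have i2 : L1 (fun x => intR (F x)) by exact: L1_marg1 mF iJd if2 bF.
have iQ := poisson_L1 d0 bf bf.
have le1 := le_intR iQ (L1D i1 i2) step.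
apply: (le_trans le1); rewrite (intRD i1 i2) E.
have -> : intR (fun x => f x ^+ 2 * pi) = pi * sq f.
  by rewrite /sq -(intRZ pi if2); congr intR; apply/funext => x; rewrite mulrC.
have le2 : intR (fun y => intR (F ^~ y)) <= intR (fun y => pi * f y ^+ 2).
  apply: le_intR => [||y]; first exact: L1_marg2 mF iJd if2 bF.
    exact: L1Z.
  have iPy : L1 (fun x => f y ^+ 2 * poissonK d (x - y)).
    have := L1Z (f y ^+ 2) (iP y); congr L1.
    by apply/funext => x; rewrite poissonK_sym.
  apply: (@le_trans _ _ (intR (fun x => f y ^+ 2 * poissonK d (x - y)))).
    apply: le_intR => [||x]; [exact: L1_sec2 mF iJd bF y|exact: iPy|].
    rewrite /F; move: (poissonK d (x - y)) (poissonK_ge0 (x - y) d0) => P P0.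
    by apply: ler_wpM2r; [exact: P0|exact: ler_piMl (sqr_ge0 _) (J1 x)].
  have -> : (fun x => f y ^+ 2 * poissonK d (x - y)) = (fun x => f y ^+ 2 * poissonK d (y - x)).
    by apply/funext => x; rewrite poissonK_sym.
  rewrite (intRZ (f y ^+ 2) (iP y)) (PE y) mulrC; exact: lexx.
have -> : 2 * pi * sq f = pi * sq f + pi * sq f by ring.
rewrite lerD2l; apply: (le_trans le2); rewrite (intRZ pi if2); exact: lexx.
Qed.

Lemma expw_lip d xi : 0 < d -> 0 <= 1 - expw d xi <= d * `|xi|.
Proof.
move=> d0; have h := expw_le1 xi d0; apply/andP; split; first by lra.
by have := expR_ge1Dx (- (d * `|xi|)); rewrite -/(expw d xi); lra.
Qed.

(** The weight differs from 1 by at most [d |xi|], and the decay coming from the smooth factor [psi]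
    makes [|xi|] times the spectrum integrable. It serves for [spec f psi] and for its absolute
    value. *)
Lemma expw_removal f psi m : bcs f -> test_fun psi -> measurable_fun setT m ->
  (forall xi, `|m xi| <= `|spec f psi xi|) ->
  exists2 C, 0 <= C & forall d, 0 < d ->
    L1 (fun xi => expw d xi * m xi) /\ `|intR m - intR (fun xi => expw d xi * m xi)| <= d * C.
Proof.
move=> bf tp mm hm; have [C C0 hC] := spec_decay bf tp.
have im : L1 m by apply: L1_le (L1_norm (spec_L1 bf tp)) hm.
exists (intR (fun xi => C * lor xi)).
  by apply: intR_ge0 => xi; rewrite mulr_ge0// ltW// lor_gt0.
move=> d d0; have iwm : L1 (fun xi => expw d xi * m xi).
  apply: L1_le (L1_norm im) _ => [|xi].
    by apply: measurable_funM => //; apply: cont_meas; exact: expw_cont.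
  rewrite normrM (ger0_norm (ltW (expw_gt0 d xi))) ler_piMl//; exact: expw_le1.
split=> //; rewrite -intRB// -intRZ; last exact/L1Z/L1_lorentz.
apply: norm_intR_le => [||xi]; first exact: L1B.
  by apply: L1Z; apply: L1Z; exact: L1_lorentz.
have /andP[w0 w1] := expw_lip xi d0.
rewrite -{1}(mul1r (m xi)) -mulrBl normrM (ger0_norm w0).
have h : `|m xi| <= C * lor xi ^+ 2 := le_trans (hm xi) (hC xi).
apply: (le_trans (ler_pM w0 (normr_ge0 _) w1 h)).
rewrite -mulrA ler_wpM2l ?(ltW d0)// mulrCA ler_wpM2l// expr2 mulrA.
by rewrite ler_piMl ?(ltW (lor_gt0 xi))// lor_xi.
Qed.

Lemma young_prod (k u v : R) : 0 < k -> `|u * v| <= k / 2 * (u * u) + k^-1 / 2 * (v * v).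
Proof.
move=> k0; have kv : 0 < k^-1 by rewrite invr_gt0.
have p1 := mulr_ge0 (ltW kv) (sqr_ge0 (k * u + v)).
have p2 := mulr_ge0 (ltW kv) (sqr_ge0 (k * u - v)).
have e2 : k^-1 * (k * u + v) ^+ 2 = k * (u * u) + 2 * (u * v) + k^-1 * (v * v).
  by field; rewrite gt_eqF.
have e3 : k^-1 * (k * u - v) ^+ 2 = k * (u * u) - 2 * (u * v) + k^-1 * (v * v).
  by field; rewrite gt_eqF.
by rewrite e2 in p1; rewrite e3 in p2; rewrite ler_norml; lra.
Qed.

Lemma young_dot (k a b c e : R) : 0 < k ->
  `|a * c + b * e| <= k / 2 * (a * a + b * b) + k^-1 / 2 * (c * c + e * e).
Proof.
move=> k0; rewrite (le_trans (ler_normD _ _))//.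
by have := young_prod a c k0; have := young_prod b e k0; lra.
Qed.

(** [spec f f] is not known to be integrable, so Cauchy-Schwarz cannot be applied to it directly.
    Instead Young's inequality with a parameter [k] is used under the weight, [bessel] bounds both
    squares, the weight is removed, and [amgm_opt] optimises [k]. *)
Lemma spec_cauchy f psi : bcs f -> test_fun psi ->
  intR (fun xi => `|spec f psi xi|) <= 2 * pi * (L2norm f * L2norm psi).
Proof.
move=> bf tp; have bp := test_bcs tp.
have tpi0 : 0 < 2 * pi :> R by rewrite mulr_gt0// pi_gt0.
rewrite -ler_pdivrMl//; apply: amgm_opt; [exact: L2norm_ge0|exact: L2norm_ge0|move=> k k0].
rewrite !L2norm_sq ler_pdivrMl//.
pose m xi := `|spec f psi xi|.
have mm : measurable_fun setT m.
  exact: L1_meas (L1_norm (spec_L1 bf tp)).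
have [|C C0 hC] := @expw_removal f psi m bf tp mm.
  by move=> xi; rewrite /m normr_id.
apply/ler_addgt0Pr => e e0.
pose d := e / (C + 1); have d0 : 0 < d by rewrite divr_gt0// ltr_wpDl.
have [iwm hd] := hC d d0.
have dC : d * C <= e.
  by rewrite /d mulrAC ler_pdivrMr ?ltr_wpDl// ler_wpM2l ?(ltW e0)// lerDl.
suff h : intR (fun xi => expw d xi * m xi) <= 2 * pi * ((k * sq f + k^-1 * sq psi) / 2).
  by move: hd; rewrite ler_norml => /andP[_]; rewrite -/m; lra.
have kv : 0 < k^-1 by rewrite invr_gt0.
have i1 := expw_spec_L1 d0 bf bf; have i2 := expw_spec_L1 d0 bp bp.
have := bessel d0 bf; have := bessel d0 bp => b2 b1.
apply: (@le_trans _ _ (intR (fun xi => k / 2 * (expw d xi * spec f f xi) + k^-1 / 2 * (expw d xi * spec psi psi xi)))).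
  apply: le_intR => // [|xi]; first by apply: L1D; exact: L1Z.
  rewrite (_ : _ + _ = expw d xi * (k / 2 * spec f f xi + k^-1 / 2 * spec psi psi xi)); last by ring.
  rewrite ler_wpM2l ?(ltW (expw_gt0 d xi))// /m /spec.
  move: (cosT f xi) (sinT f xi) (cosT psi xi) (sinT psi xi) => a b c e1.
  exact: young_dot.
rewrite intRD; [|exact: L1Z..]; rewrite !intRZ//.
have h1 := ler_wpM2l (divr_ge0 (ltW k0) (ler0n R 2)) b1.
have h2 := ler_wpM2l (divr_ge0 (ltW kv) (ler0n R 2)) b2.
by apply: (le_trans (lerD h1 h2)); rewrite le_eqVlt; apply/orP; left; apply/eqP; ring.
Qed.

Lemma test_lip psi : test_fun psi -> exists2 L, 0 <= L &
  forall x y, `|psi y - psi x| <= L * `|y - x|.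
Proof.
move=> tp; have [L L0 hL] := test_bounded (test_d1 tp); exists L => //.
have dp := smooth_dif (test_smooth tp).
suff h x y : x < y -> `|psi y - psi x| <= L * `|y - x|.
  move=> x y; have [xy|xy|->] := ltgtP x y; first exact: h.
    by rewrite distrC (distrC y) h.
  by rewrite !subrr normr0 mulr0.
move=> xy; have [c _ ->] := MVT xy (fun z _ => dif_is z dp)
    (continuous_subspaceT (dif_cont dp)).
by rewrite normrM ler_wpM2r.
Qed.

(** For [|x - y| <= s] the Lipschitz bound gives [L s]; beyond, [|psi y - psi x| <= 2 C] and
    [poissonK_split] gains [2 s]. Multiplying by the masses [pi] and the prefactor 2 gives
    [2 L pi s + 8 C pi s]. *)
Lemma poisson_approx psi : test_fun psi -> exists2 K, 0 <= K &
  forall s x, 0 < s ->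
   `|intR (fun y => psi y * (2 * poissonK (s ^+ 2) (x - y))) - 2 * pi * psi x| <= s * K.
Proof.
move=> tp; have [L L0 hL] := test_lip tp; have [C C0 hC] := test_bounded tp.
exists (2 * (L + 4 * C) * pi).
  by apply: mulr_ge0; [lra|exact: pi_ge0].
move=> s x s0; have s20 : 0 < s ^+ 2 by rewrite exprn_gt0.
have [i1 E1] := poissonK_int x s20; have [i2 E2] := poissonK_int x s0.
have i3 : L1 (fun y => psi y * (2 * poissonK (s ^+ 2) (x - y))).
  apply/bcs_L1/bcsMc; first exact: test_bcs.
  move=> y; apply: cvgM; first exact: cvg_cst.
  apply: (@continuous_comp _ _ _ (fun z : R => x - z) (poissonK (s ^+ 2))).
    by apply: cvgB; [exact: cvg_cst|exact: cvg_id].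
  exact: poissonK_cont.
rewrite (_ : 2 * pi * psi x = intR (fun y => 2 * psi x * poissonK (s ^+ 2) (x - y))); last first.
  by rewrite (intRZ _ i1) E1; ring.
have i4 := L1Z (2 * psi x) i1.
rewrite -intRB//.
rewrite (_ : s * _ = intR (fun y => 2 * L * s * poissonK (s ^+ 2) (x - y) + 8 * C * s * poissonK s (x - y))); last first.
  by rewrite intRD; [rewrite (intRZ _ i1) (intRZ _ i2) E1 E2; ring|exact: L1Z..].
apply: norm_intR_le => [||y]; first exact: L1B.
  by apply: L1D; exact: L1Z.
rewrite (_ : _ - _ = 2 * (psi y - psi x) * poissonK (s ^+ 2) (x - y)); last by ring.
have h2 := @poissonK_split R s (x - y) s0.
move: (poissonK (s ^+ 2) (x - y)) (poissonK s (x - y)) (poissonK_ge0 (x - y) s20) (poissonK_ge0 (x - y) s0) h2.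
move=> p q P1 P2 h2; rewrite normrM (ger0_norm P1) normrM (ger0_norm (ler0n R 2)).
have [xy|xy] := leP `|x - y| s.
  have h : `|psi y - psi x| <= L * s.
    by rewrite (le_trans (hL _ _))// distrC ler_wpM2l.
  have c0 : 0 <= 8 * C * s * q by rewrite !mulr_ge0// ltW.
  by have := ler_wpM2r P1 h; lra.
have h : `|psi y - psi x| <= 2 * C.
  by rewrite (le_trans (ler_normB _ _))//; have := hC x; have := hC y; lra.
have {}h2 := h2 (ltW xy).
have c0 : 0 <= 2 * L * s * p by rewrite !mulr_ge0// ltW.
have h3 := ler_wpM2r P1 h; have h4 := ler_wpM2l (mulr_ge0 (ler0n R 2) C0) h2.
by lra.
Qed.

(** The polarised formula with only one smooth factor: smoothness of [psi] both removes the weight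
    and makes the Poisson averages converge at a rate uniform in [x]. *)
Lemma plancherel f psi : bcs f -> test_fun psi ->
  intR (spec f psi) = 2 * pi * intR (fun x => f x * psi x).
Proof.
move=> bf tp; have bp := test_bcs tp.
have [|C C0 hC] := @expw_removal f psi (spec f psi) bf tp (pr_meas bf bp).
  by [].
have [K K0 hK] := poisson_approx tp.
have n0 := L1norm_ge0 f.
have ifp : L1 (fun x => f x * psi x) by apply/bcs_L1/bcsMc => //; exact: test_cont.
(* The weight parameter is [d = s^2], the height used in [poisson_approx]; [s <= 1] turns the
   removal error [s^2 C] into [s C]. *)
have key s : 0 < s -> s <= 1 ->
    `|intR (spec f psi) - 2 * pi * intR (fun x => f x * psi x)| <= s * (C + K * L1norm f).
  move=> s0 s1; have s20 : 0 < s ^+ 2 by rewrite exprn_gt0.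
  have [iw h1] := hC _ s20.
  have s2s : s ^+ 2 <= s by rewrite expr2 ler_piMl// ltW.
  have {}h1 : `|intR (spec f psi) - intR (fun xi => expw (s ^+ 2) xi * spec f psi xi)| <= s * C.
    by rewrite (le_trans h1)// ler_wpM2r.
  have h2 : `|intR (fun xi => expw (s ^+ 2) xi * spec f psi xi) - 2 * pi * intR (fun x => f x * psi x)| <= s * K * L1norm f.
    have iQ := poisson_L1 s20 bf bp; have i2 := L1Z (2 * pi) ifp.
    rewrite poisson_pairing// -intRZ// -intRB// -intRZ; last exact/L1_norm/bcs_L1.
    apply: norm_intR_le => [||x]; first exact: L1B.
      by apply: L1Z; exact/L1_norm/bcs_L1.
    rewrite mulrCA -mulrBr normrM mulrC ler_wpM2r//; exact: hK.
  have := ler_distD (intR (fun xi => expw (s ^+ 2) xi * spec f psi xi)) (intR (spec f psi)) (2 * pi * intR (fun x => f x * psi x)).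
  by move: h1 h2; lra.
apply/eqP; rewrite -subr_eq0 -normr_le0; apply/ler_addgt0Pr => e e0; rewrite add0r.
pose A := C + K * L1norm f + 1.
have A0 : 0 < A by rewrite ltr_wpDl// addr_ge0// mulr_ge0.
pose s := Num.min 1 (e / A).
have s0 : 0 < s by rewrite lt_min ltr01 divr_gt0.
have s1 : s <= 1 by rewrite ge_min lexx.
have sA : s * A <= e by rewrite -ler_pdivlMr// ge_min lexx orbT.
rewrite (le_trans (key s s0 s1))// (le_trans _ sA)// ler_wpM2l ?(ltW s0)//.
by rewrite /A lerDl.
Qed.

End Plancherel.

(** * The Whitham multiplier *)

Section Symbol.
Variable R : realType.

Lemma nonneg_of_derive (F F' : R -> R) (b : R) : (forall x : R, is_derive x 1 F (F' x)) ->
  F 0 = 0 -> (forall x, 0 <= x <= b -> 0 <= F' x) -> forall x, 0 <= x <= b -> 0 <= F x.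
Proof.
move=> dF F0 F'0 x /andP[]; rewrite le_eqVlt => /predU1P[<-|x0] xb; first by rewrite F0.
have [difF _] := dif_dE dF.
have [c] := MVT x0 (fun z _ => dF z) (continuous_subspaceT (dif_cont difF)).
rewrite in_itv/= F0 subr0 subr0 => /andP[c0 cx] ->.
by rewrite mulr_ge0 ?(ltW x0)// F'0// (ltW c0) (le_trans (ltW cx)).
Qed.

Lemma cosh_gt0 (z : R) : 0 < expR z + expR (- z).
Proof. by rewrite addr_gt0// expR_gt0. Qed.

Lemma tanh_is_derive (z : R) : is_derive z 1 (@tanh R) (1 - tanh z ^+ 2).
Proof.
have c0 := cosh_gt0 z; have cn0 : expR z + expR (- z) != 0 by rewrite gt_eqF.
have dN : is_derive z 1 (fun y : R => expR (- y)) (- expR (- z)).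
  have d := @is_derive1_comp R (@expR R) (fun y : R => - y) z _ _ (is_derive_expR _) (is_deriveNid z 1).
  by apply: (is_derive_eq d); rewrite mulrN1.
have d1 := is_deriveB (is_derive_expR z) dN.
have d2 := is_deriveD (is_derive_expR z) dN.
have d3 := is_deriveM d1 (is_deriveV (f := fun y : R => expR y + expR (- y)) cn0 d2).
apply: (is_derive_eq d3).
change ((expR z - expR (- z)) * (- (expR z + expR (- z)) ^- 2 * (expR z + - expR (- z))) +
  (expR z + expR (- z))^-1 * (expR z - - expR (- z)) = 1 - tanh z ^+ 2).
by rewrite /tanh; field.
Qed.

Lemma tanh0 : tanh 0 = 0 :> R.
Proof. by rewrite /tanh oppr0 subrr mul0r. Qed.

Lemma tanh_ge0 (z : R) : 0 <= z -> 0 <= tanh z.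
Proof.
move=> z0; rewrite /tanh divr_ge0 ?(ltW (cosh_gt0 z))// subr_ge0 ler_expR; lra.
Qed.

(** First of three bootstrapped bounds: since [tanh' = 1 - tanh^2], an upper bound on [tanh]
    integrates to a lower bound in [tanh_lower], and that one to the upper bound in [tanh_upper]. *)
Lemma tanh_le (z : R) : 0 <= z -> tanh z <= z.
Proof.
move=> z0; rewrite -subr_ge0.
apply: (@nonneg_of_derive (fun z => z - tanh z) (fun z => tanh z ^+ 2) z).
- move=> x; have := is_deriveB (is_derive_id x 1) (tanh_is_derive x).
  by move=> d; apply: (is_derive_eq d); ring.
- by rewrite tanh0 subrr.
- by move=> x _; exact: sqr_ge0.
- by rewrite z0 lexx.
Qed.

Lemma is_derive_mon n (x : R) : is_derive x 1 (fun y : R => y ^+ n) (n%:R * x ^+ n.-1).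
Proof.
have d := is_deriveX n (is_derive_id x (1:R)).
have -> : (fun y : R => y ^+ n) = (@id R) ^+ n by apply/funext => y; rewrite fctE.
by apply: (is_derive_eq d); rewrite /GRing.scale/= mulr1.
Qed.

Lemma tanh_lower (z : R) : 0 <= z -> z - z ^+ 3 / 3 <= tanh z.
Proof.
move=> z0; rewrite -subr_ge0.
apply: (@nonneg_of_derive (fun z => tanh z - (z - z ^+ 3 / 3)) (fun z => z ^+ 2 - tanh z ^+ 2) z).
- move=> x; have d3 := is_deriveZ (3^-1 : R) (is_derive_mon 3 x).
  have d := is_deriveB (tanh_is_derive x) (is_deriveB (is_derive_id x 1) d3).
  have E : (fun z : R => tanh z - (z - z ^+ 3 / 3)) = (@tanh R) - (id - (3^-1 : R) \*: (fun y : R => y ^+ 3)).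
    by apply/funext => y; rewrite !fctE /GRing.scale/= (mulrC _ 3^-1).
  rewrite E; apply: (is_derive_eq d).
  change (1 - tanh x ^+ 2 - (1 - 3^-1 * (3%:R * x ^+ 2)) = x ^+ 2 - tanh x ^+ 2).
  by field.
- by rewrite tanh0 expr0n/= mul0r !subrr.
- move=> x /andP[x0 _]; rewrite subr_ge0 lerXn2r ?nnegrE ?tanh_ge0//; exact: tanh_le.
- by rewrite z0 lexx.
Qed.

Lemma tanh_upper (z : R) : 0 <= z <= 1 -> tanh z <= z - z ^+ 3 / 3 + 2 / 15 * z ^+ 5.
Proof.
move=> z01; rewrite -subr_ge0.
apply: (@nonneg_of_derive (fun z => z - z ^+ 3 / 3 + 2 / 15 * z ^+ 5 - tanh z)
  (fun z => 2 / 3 * z ^+ 4 - z ^+ 2 + tanh z ^+ 2) 1).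
- move=> x; have d3 := is_deriveZ (3^-1 : R) (is_derive_mon 3 x).
  have d5 := is_deriveZ (2 / 15 : R) (is_derive_mon 5 x).
  have d := is_deriveB (is_deriveD (is_deriveB (is_derive_id x 1) d3) d5) (tanh_is_derive x).
  have E : (fun z : R => z - z ^+ 3 / 3 + 2 / 15 * z ^+ 5 - tanh z) =
      (id - (3^-1 : R) \*: (fun y : R => y ^+ 3)) + (2 / 15 : R) \*: (fun y : R => y ^+ 5) - (@tanh R).
    by apply/funext => y; rewrite !fctE /GRing.scale/= (mulrC _ 3^-1).
  rewrite E; apply: (is_derive_eq d).
  change (1 - 3^-1 * (3%:R * x ^+ 2) + 2 / 15 * (5%:R * x ^+ 4) - (1 - tanh x ^+ 2) =
    2 / 3 * x ^+ 4 - x ^+ 2 + tanh x ^+ 2).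
  by field.
- by rewrite tanh0; ring.
- move=> x /andP[x0 x1].
  (* Squaring the lower bound on [tanh] needs its left side to be nonnegative; this is where
     [x <= 1] enters. *)
  have h : 0 <= x - x ^+ 3 / 3.
    have : x ^+ 3 <= x by rewrite exprS ler_piMr// expr_le1.
    by lra.
  have : (x - x ^+ 3 / 3) ^+ 2 <= tanh x ^+ 2.
    by rewrite lerXn2r ?nnegrE ?tanh_ge0//; exact: tanh_lower.
  rewrite (_ : (x - x ^+ 3 / 3) ^+ 2 = x ^+ 2 - 2 / 3 * x ^+ 4 + x ^+ 6 / 9); last by field.
  have : 0 <= x ^+ 6 by rewrite exprn_ge0.
  by lra.
- by [].
Qed.

Lemma lsym_ge0 (z : R) : 0 <= lsym z.
Proof. by rewrite /lsym; case: ifP => // _; exact: sqrtr_ge0. Qed.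

Lemma lsym_le1 (z : R) : lsym z <= 1.
Proof.
rewrite /lsym; case: ifPn => // z0; rewrite -[leRHS]sqrtr1 ler_sqrt//.
by rewrite ler_pdivrMr ?normr_gt0// mul1r tanh_le.
Qed.

(** For [|z| > 1] it is enough that [lsym] lies in [[0, 1]]. For [|z| <= 1] put [q = z^2],
    [T = tanh |z| / |z|], [S = sqrt T]: multiplying by the conjugate [1 - q/6 + S >= 5/6] turns the
    difference into [(1 - q/6)^2 - T], where the Taylor bounds on [tanh] leave only a multiple of
    [q^2] with coefficient below [5/6]. *)
Lemma lsym_approx (z : R) : `|1 - z ^+ 2 / 6 - lsym z| <= z ^+ 4.
Proof.
have [->|z0] := eqVneq z 0.
  by rewrite /lsym eqxx !expr0n/= mul0r subr0 subrr normr0.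
have l0 := lsym_ge0 z; have l1 := lsym_le1 z.
rewrite /lsym (negbTE z0) in l0 l1 *.
have -> : z ^+ 2 = `|z| ^+ 2 by rewrite real_normK ?num_real.
have -> : z ^+ 4 = `|z| ^+ 4 by rewrite -[RHS]normrX ger0_norm// exprn_even_ge0.
have : 0 < `|z| by rewrite normr_gt0.
move: (`|z|) l0 l1 => y l0 l1 y0.
have [y1|y1] := leP y 1; last first.
  have y21 : 1 <= y ^+ 2 by rewrite expr_ge1// ltW.
  have y24 : y ^+ 2 <= y ^+ 4.
    have -> : y ^+ 4 = y ^+ 2 * y ^+ 2 by ring.
    by apply: ler_peMl => //; exact: sqr_ge0.
  by rewrite ler_norml; lra.
set T := tanh y / y in l0 l1 *.
have T0 : 0 <= T by rewrite divr_ge0 ?tanh_ge0// ltW.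
have T1 : 1 - y ^+ 2 / 3 <= T.
  rewrite /T ler_pdivlMr//.
  by have := tanh_lower (ltW y0); rewrite (_ : y - _ = (1 - y ^+ 2 / 3) * y)//; ring.
have T2 : T <= 1 - y ^+ 2 / 3 + 2 / 15 * y ^+ 4.
  rewrite /T ler_pdivrMr//.
  have : 0 <= y <= 1 by rewrite (ltW y0) y1.
  move=> /tanh_upper; rewrite (_ : y - _ + _ = (1 - y ^+ 2 / 3 + 2 / 15 * y ^+ 4) * y)//; ring.
have S2 : Num.sqrt T ^+ 2 = T by rewrite sqr_sqrtr.
move: (Num.sqrt T) l0 l1 S2 => S l0 l1 S2.
have y2 : y ^+ 2 <= 1 by rewrite expr_le1// ltW.
have y20 : 0 <= y ^+ 2 by rewrite sqr_ge0.
have y4 : y ^+ 4 = y ^+ 2 * y ^+ 2 by ring.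
rewrite y4 in T2 *; move: (y ^+ 2) y2 y20 T1 T2 => q q1 q0 T1 T2.
have key : (1 - q / 6 - S) * (1 - q / 6 + S) = 1 - q / 3 + q * q / 36 - T.
  by rewrite -S2; field.
clearbody T; clear y y0 y1 y4 z z0 T0 S2.
have q2 : 0 <= q * q by rewrite mulr_ge0.
rewrite ler_norml; apply/andP; split.
  rewrite lerNl; have [D0|D0] := leP 0 (1 - q / 6 - S); first by lra.
  have : (5 / 6) * - (1 - q / 6 - S) <= - (1 - q / 6 - S) * (1 - q / 6 + S).
    by rewrite mulrC ler_wpM2l//; lra.
  by rewrite mulNr key; lra.
have [D0|D0] := leP 0 (1 - q / 6 - S); last by lra.
have : (5 / 6) * (1 - q / 6 - S) <= (1 - q / 6 - S) * (1 - q / 6 + S).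
  by rewrite mulrC ler_wpM2l//; lra.
by rewrite key; lra.
Qed.

Lemma lsym_meas : measurable_fun setT (@lsym R).
Proof.
(* At 0 the square root vanishes, because 0 has inverse 0, and the indicator supplies the value 1.
   The inverse is written as a power to use measurability of powers. *)
have -> : (@lsym R) = (fun z => \1_[set (0:R)] z + Num.sqrt (tanh `|z| * (`|z| `^ -1))).
  apply/funext => z; rewrite /lsym powR_inv1// indicE; case: ifPn => [/eqP ->|z0].
    by rewrite mem_set// normr0 invr0 mulr0 sqrtr0 addr0.
  by rewrite memNset ?add0r//= => /eqP; rewrite (negbTE z0).
have mn : measurable_fun setT (fun z : R => `|z|) by apply: cont_meas; exact: norm_continuous.
have ct : continuous (@tanh R).
  by apply: dif_cont => x; have [] := tanh_is_derive x.
apply: measurable_funD; first exact: measurable_indic.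
apply: (measurableT_comp (cont_meas (@sqrt_continuous R))).
apply: measurable_funM; first exact: (measurableT_comp (cont_meas ct) mn).
exact: (measurableT_comp (measurable_powR (-1)) mn).
Qed.

End Symbol.

(** * The Whitham multiplier on test functions: contraction, skewness and defect from Airy *)

Section Multiplier.
Variable R : realType.
Implicit Types f g h psi theta : R -> R.

Definition leps (eps xi : R) : R := lsym (Num.sqrt eps * xi).

Lemma leps01 eps xi : 0 <= leps eps xi <= 1.
Proof. by rewrite lsym_ge0 lsym_le1. Qed.

Lemma leps_meas eps : measurable_fun setT (leps eps).
Proof.
apply: (measurableT_comp (@lsym_meas R)); apply: cont_meas => x.
by apply: cvgM; [exact: cvg_cst|exact: cvg_id].
Qed.

Lemma lmultE eps psi x : test_fun psi -> lmult eps psi x = (2 * pi)^-1 *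
  intR (fun xi => leps eps xi * (cos (x * xi) * cosT psi xi + sin (x * xi) * sinT psi xi)).
Proof.
move=> tp; rewrite /lmult; congr (_ * intR _); apply/funext => xi.
by rewrite -(fcos_shift x xi (test_bcs tp)).
Qed.

Lemma leps_twist eps psi : test_fun psi -> exists2 C, 0 <= C & forall x xi,
  `|leps eps xi * (cos (x * xi) * cosT psi xi + sin (x * xi) * sinT psi xi)| <= C * lor xi ^+ 2.
Proof.
move=> tp; have [C C0 hC] := f_decay tp; exists (2 * C); first by rewrite mulr_ge0.
move=> x xi; have [h1 h2] := hC xi; have /andP[l0 l1] := leps01 eps xi.
have L0 : 0 <= C * lor xi ^+ 2 by rewrite mulr_ge0// sqr_ge0.
rewrite normrM (ger0_norm l0); apply: (le_trans (ler_piMl (normr_ge0 _) l1)).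
apply: (le_trans (ler_normD _ _)); rewrite !normrM.
have := ler_pM (normr_ge0 _) (normr_ge0 _) (cos_bnd (x * xi)) h1.
have := ler_pM (normr_ge0 _) (normr_ge0 _) (sin_bnd (x * xi)) h2.
by rewrite !mul1r -mulrA mulr_natl mulr2n => *; exact: lerD.
Qed.

Lemma leps_twist_L1 eps x psi : test_fun psi ->
  L1 (fun xi => leps eps xi * (cos (x * xi) * cosT psi xi + sin (x * xi) * sinT psi xi)).
Proof.
move=> tp; have [C C0 hC] := leps_twist eps tp; have bg := test_bcs tp.
apply: L1_le _ (lor2_L1 C) (hC x).
have mc : measurable_fun setT (fun xi => cos (x * xi)).
  by have := cont_meas (@cosx_cont R x); under eq_fun do rewrite mulrC.
have ms : measurable_fun setT (fun xi => sin (x * xi)).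
  by have := cont_meas (@sinx_cont R x); under eq_fun do rewrite mulrC.
have m1 := measurable_funD (measurable_funM mc (cosT_meas bg)) (measurable_funM ms (sinT_meas bg)).
exact: measurable_funM (leps_meas eps) m1.
Qed.

Lemma lmult_pairing eps f psi : bcs f -> test_fun psi ->
  intR (fun x => f x * lmult eps psi x) = (2 * pi)^-1 * intR (fun xi => leps eps xi * spec f psi xi).
Proof.
move=> bf tp; have [C C0 hC] := leps_twist eps tp; have bp := test_bcs tp.
have mw := leps_meas eps.
rewrite (mult_pairing bf bp mw (lor2_L1 C) hC).
pose I x := intR (fun xi => leps eps xi * (cos (x * xi) * cosT psi xi + sin (x * xi) * sinT psi xi)).
have iI : L1 (fun x => f x * I x).
  have mF := twist_meas (L1_meas (bcs_L1 bf)) bp mw.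
  pose F x xi := f x * (leps eps xi * (cos (x * xi) * cosT psi xi + sin (x * xi) * sinT psi xi)).
  have bF x xi : `|F x xi| <= `|f x| * (C * lor xi ^+ 2).
    by rewrite /F normrM; apply: ler_wpM2l.
  have := L1_marg1 (F := F) mF (L1_norm (bcs_L1 bf)) (lor2_L1 C) bF.
  congr L1; apply/funext => x; rewrite /F (intRZ (f x))//.
  exact: leps_twist_L1.
rewrite -(intRZ (2 * pi)^-1 iI); congr intR; apply/funext => x.
by rewrite (lmultE eps x tp) mulrCA.
Qed.

Lemma lmult_bnd eps psi : test_fun psi -> exists2 C, 0 <= C & forall x, `|lmult eps psi x| <= C.
Proof.
move=> tp; have [C C0 hC] := leps_twist eps tp.
have p0 : 0 <= (2 * pi)^-1 :> R by rewrite invr_ge0 mulr_ge0// pi_ge0.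
have i0 : 0 <= intR (fun xi => C * lor xi ^+ 2).
  by apply: intR_ge0 => xi; rewrite mulr_ge0// sqr_ge0.
exists ((2 * pi)^-1 * intR (fun xi => C * lor xi ^+ 2)); first exact: mulr_ge0.
move=> x; rewrite (lmultE eps x tp) normrM (ger0_norm p0); apply: ler_wpM2l => //.
by apply: norm_intR_le => // [|]; [exact: leps_twist_L1|exact: lor2_L1].
Qed.

(** The weighting device of [ftrig_meas], this time in the variable [x]. *)
Lemma lmult_meas eps psi : test_fun psi -> measurable_fun setT (lmult eps psi).
Proof.
move=> tp; have [C C0 hC] := leps_twist eps tp; have bp := test_bcs tp.
have mw := leps_meas eps; have w1 := expw_L1 (@ltr01 R).
pose F x xi := expw 1 x * (leps eps xi * (cos (x * xi) * cosT psi xi + sin (x * xi) * sinT psi xi)).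
have mF : measurable_fun setT (fun p : R * R => F p.1 p.2).
  exact: twist_meas (L1_meas w1) bp mw.
have bF x xi : `|F x xi| <= expw 1 x * (C * lor xi ^+ 2).
  by rewrite /F normrM (ger0_norm (ltW (expw_gt0 1 x))) ler_wpM2l// ltW// expw_gt0.
have /L1_meas mG := L1_marg1 mF w1 (lor2_L1 C) bF.
have ew : continuous (fun x : R => expR `|x|).
  by move=> x; apply: continuous_comp; [exact: norm_continuous|exact: continuous_expR].
have mGe := measurable_funM mG (cont_meas ew).
have := measurable_funM (measurable_cst ((2 * pi)^-1 : R)) mGe.
congr measurable_fun; apply/funext => x /=; rewrite (lmultE eps x tp) /F.
rewrite (intRZ (expw 1 x) (leps_twist_L1 eps x tp)) mulrAC /expw mul1r -expRD addNr expR0.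
by rewrite mul1r.
Qed.

(** Duality. [lmult eps psi] lacks compact support, so it is paired with its own truncation [c n]:
    [||c n||^2 = <c n, lmult eps psi> <= ||c n|| ||psi||] by [spec_cauchy] and [0 <= leps <= 1].
    Hence [||c n|| <= ||psi||], and [n] tends to infinity monotonically. *)
Lemma lmult_L2 eps psi : test_fun psi -> L2 (lmult eps psi) /\ L2norm (lmult eps psi) <= L2norm psi.
Proof.
move=> tp; have ml := lmult_meas eps tp; have [C C0 hC] := lmult_bnd eps tp.
pose c n x := cutI n x * lmult eps psi x.
have bc n : bcs (c n).
  by apply: (bcsM (cutI_bcs R n) ml) => M; exists C => x _; exact: hC.
have cE n : (fun x => c n x * lmult eps psi x) = (fun x => cutI n x * lmult eps psi x ^+ 2).
  by apply/funext => x; rewrite /c expr2 mulrA.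
have cE2 n : (fun x => c n x ^+ 2) = (fun x => cutI n x * lmult eps psi x ^+ 2).
  apply/funext => x; rewrite /c exprMn; congr (_ * _).
  by rewrite /cutI indicE; case: (_ \in _); rewrite /= ?expr1n ?expr0n.
have pi0 : 0 < 2 * pi :> R by rewrite mulr_gt0// pi_gt0.
have ic n : L1 (fun x => cutI n x * lmult eps psi x ^+ 2).
  by rewrite -cE2; exact: L2_sqr_L1 (bcs_L2 (bc n)).
have bnd n : intR (fun x => cutI n x * lmult eps psi x ^+ 2) <= L2norm psi ^+ 2.
  have h : intR (fun x => c n x * lmult eps psi x) <= L2norm (c n) * L2norm psi.
    rewrite (lmult_pairing eps (bc n) tp) ler_pdivrMl//.
    have ip := spec_L1 (bc n) tp.
    apply: (le_trans _ (spec_cauchy (bc n) tp)); apply: (le_trans (ler_norm _)).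
    apply: norm_intR_le => [||xi].
    - apply: L1_le (L1_norm ip) _ => [|xi].
        by apply: measurable_funM; [exact: leps_meas|exact: L1_meas ip].
      have /andP[l0 l1] := leps01 eps xi; rewrite normrM (ger0_norm l0).
      exact: ler_piMl.
    - exact: L1_norm.
    - have /andP[l0 l1] := leps01 eps xi; rewrite normrM (ger0_norm l0).
      exact: ler_piMl.
  rewrite cE -cE2 -/(sq (c n)) -L2norm_sq in h *.
  have n0 := L2norm_ge0 (c n); have m0 := L2norm_ge0 psi.
  move: (L2norm (c n)) (L2norm psi) n0 m0 h => a b a0 b0 h.
  by rewrite lerXn2r// ?nnegrE//; have [|] := leP a b => // ab; nra.
have [||||i1 i2] := @L1_mono R (fun x => lmult eps psi x ^+ 2) (L2norm psi ^+ 2).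
- exact: measurable_funX.
- by move=> x; exact: sqr_ge0.
- exact: ic.
- exact: bnd.
split; first by split.
by rewrite -(@ler_pXn2r _ 2)// ?nnegrE ?L2norm_ge0// L2norm_sq.
Qed.

(** The passage from test functions to [Hinf] in every pairing below; the second factor only has to
    be in L2, which is all that is known of [lmult eps psi]. *)
Lemma dens_pair m f g : Hinf f -> L2 g ->
  intR (fun x => dn m (fun y => cutoff n y * f y) x * g x) @[n --> \oo] -->
  intR (fun x => dn m f x * g x).
Proof.
move=> hf lg; apply/cvgrPdist_le => e e0.
have /cvgrPdist_le h := cut_dense m hf.
have [N _ hN] := h _ (divr_gt0 e0 (ltr_wpDl (L2norm_ge0 g) ltr01)).
exists N => // n nN; rewrite distrC.
have sf := Hinf_smooth hf; have tc : test_fun (fun y => cutoff n y * f y).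
  by apply: testMr sf; exact: cutoff_test.
have l1 : L2 (dn m (fun y => cutoff n y * f y)) by exact/bcs_L2/test_bcs/test_dn.
have l2 := Hinf_L2 (Hinf_dn m hf).
rewrite -(intRB (L2M l1 lg) (L2M l2 lg)).
rewrite (_ : (fun x => _ - _) = (fun x => (dn m (fun y => cutoff n y * f y) x - dn m f x) * g x)); last first.
  by apply/funext => x; rewrite mulrBl.
apply: (le_trans (cauchy_schwarz (L2B l1 l2) lg)).
have := hN n nN; rewrite sub0r normrN (ger0_norm (L2norm_ge0 _)) => hn.
apply: (le_trans (ler_wpM2r (L2norm_ge0 g) hn)).
by rewrite mulrAC ler_pdivrMr ?ltr_wpDl ?L2norm_ge0// ler_wpM2l ?(ltW e0)// lerDl.
Qed.

(** Differentiation rotates the pair [(cosT psi, sinT psi)] by a right angle and scales it by [xi],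
    so [spec (derive1 psi) psi] vanishes identically. *)
Lemma lmult_skew eps psi : test_fun psi ->
  intR (fun x => derive1 psi x * lmult eps psi x) = 0.
Proof.
move=> tp; have td := test_d1 tp; rewrite (lmult_pairing eps (test_bcs td) tp).
rewrite (_ : (fun xi => _) = (fun=> 0)); first by rewrite intR0 mulr0.
by apply/funext => xi; rewrite /spec (cosT_d1 xi tp) (sinT_d1 xi tp); ring.
Qed.

Lemma lmult_test_d1 eps theta psi : test_fun theta -> test_fun psi ->
  intR (fun x => theta x * lmult eps (derive1 psi) x) =
  - intR (fun x => derive1 theta x * lmult eps psi x).
Proof.
move=> tt tp; have tp' := test_d1 tp; have tt' := test_d1 tt.
rewrite [LHS](lmult_pairing eps (test_bcs tt) tp').
rewrite [X in - X](lmult_pairing eps (test_bcs tt') tp) -mulrN.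
congr (_ * _); rewrite -intRN; last first.
  have ip := spec_L1 (test_bcs tt') tp.
  apply: L1_le (L1_norm ip) _ => [|xi].
    by apply: measurable_funM; [exact: leps_meas|exact: L1_meas ip].
  have /andP[l0 l1] := leps01 eps xi; rewrite normrM (ger0_norm l0).
  exact: ler_piMl.
congr intR; apply/funext => xi.
by rewrite /spec (cosT_d1 xi tp) (sinT_d1 xi tp) (cosT_d1 xi tt) (sinT_d1 xi tt); ring.
Qed.

(** Replaces integration by parts against [lmult eps psi], for which no derivative is available: the
    identity holds for test functions on the spectral side and extends by density. *)
Lemma lmult_d1 eps f psi : Hinf f -> test_fun psi ->
  intR (fun x => f x * lmult eps (derive1 psi) x) =
  - intR (fun x => derive1 f x * lmult eps psi x).
Proof.
move=> hf tp; have [l1 _] := lmult_L2 eps tp; have [l2 _] := lmult_L2 eps (test_d1 tp).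
have h1 := dens_pair (m := 0) hf l2; have h2 := cvgN (dens_pair (m := 1) hf l1).
have E : (fun n => intR (fun x => dn 0 (fun y => cutoff n y * f y) x * lmult eps (derive1 psi) x)) =
    - (fun n => intR (fun x => dn 1 (fun y => cutoff n y * f y) x * lmult eps psi x)).
  apply/funext => n; rewrite fctE.
  have tc : test_fun (fun y => cutoff n y * f y).
    by apply: testMr; [exact: cutoff_test|exact: Hinf_smooth].
  rewrite dnS /dn/= [LHS](lmult_test_d1 eps tc tp); reflexivity.
rewrite E in h1.
exact: (@cvg_unique _ (@Rhausdorff R) _ _ _ _ h1 (h2 _)).
Qed.

Lemma lmult_dn eps k f psi : Hinf f -> test_fun psi ->
  intR (fun x => f x * lmult eps (dn k psi) x) =
  (-1) ^+ k * intR (fun x => dn k f x * lmult eps psi x).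
Proof.
elim: k f psi => [|k IH] f psi hf tp; first by rewrite mul1r.
transitivity (- intR (fun x => derive1 f x * lmult eps (dn k psi) x)).
  exact: lmult_d1 hf (test_dn k tp).
rewrite [X in - X](IH _ _ (Hinf_d1 hf) tp).
by rewrite -dnSr exprS mulN1r mulNr.
Qed.

(* The symbol of this operator is bounded by [eps^2 xi^4]. *)
Definition defect eps psi (x : R) : R := psi x + eps / 6 * dn 2 psi x - lmult eps psi x.

Lemma spec_dn2 f psi xi : test_fun psi -> spec f (dn 2 psi) xi = - (xi ^+ 2 * spec f psi xi).
Proof.
move=> tp; have tp' := test_d1 tp.
by rewrite /spec /= (cosT_d1 xi tp') (sinT_d1 xi tp') (sinT_d1 xi tp) (cosT_d1 xi tp); ring.
Qed.

Lemma specC f g xi : spec f g xi = spec g f xi.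
Proof. by rewrite /spec; ring. Qed.

Lemma defect_L2 eps psi : test_fun psi -> L2 (defect eps psi).
Proof.
move=> tp; have [l1 _] := lmult_L2 eps tp; apply: L2B => //; apply: L2D.
  exact/bcs_L2/test_bcs.
exact/L2Z/bcs_L2/test_bcs/test_dn.
Qed.

(** By Plancherel the pairing is the integral of [spec theta psi] against
    [1 - eps xi^2 / 6 - leps eps xi], bounded by [eps^2 xi^4]. All four powers of [xi] go to
    [theta], so that [psi] enters through its L2 norm alone, as the energy estimate requires. *)
Lemma defect_test eps theta psi : 0 <= eps -> test_fun theta -> test_fun psi ->
  `|intR (fun x => theta x * defect eps psi x)| <= eps ^+ 2 * L2norm (dn 4 theta) * L2norm psi.
Proof.
move=> e0 tt tp; have bt := test_bcs tt; have bp := test_bcs tp.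
have tp2 := test_dn 2 tp; have tt4 := test_dn 4 tt.
have [l1 _] := lmult_L2 eps tp; have lt := bcs_L2 bt.
have i1 := L2M lt (bcs_L2 bp); have i2 := L2M lt (bcs_L2 (test_bcs tp2)); have i3 := L2M lt l1.
have pi0 : 0 < 2 * pi :> R by rewrite mulr_gt0// pi_gt0.
have p1 := spec_L1 bt tp; have p2 := spec_L1 bt tp2.
have p3 : L1 (fun xi => leps eps xi * spec theta psi xi).
  apply: L1_le (L1_norm p1) _ => [|xi].
    by apply: measurable_funM; [exact: leps_meas|exact: L1_meas p1].
  have /andP[q0 q1] := leps01 eps xi; rewrite normrM (ger0_norm q0).
  exact: ler_piMl.
have E : intR (fun x => theta x * defect eps psi x) = (2 * pi)^-1 *
   intR (fun xi => spec theta psi xi + eps / 6 * spec theta (dn 2 psi) xi - leps eps xi * spec theta psi xi).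
  rewrite (intRB (L1D p1 (L1Z (eps / 6) p2)) p3) (intRD p1 (L1Z (eps / 6) p2)) (intRZ _ p2).
  rewrite (plancherel bt tp) (plancherel bt tp2).
  have := lmult_pairing eps bt tp.
  rewrite (_ : (fun x => theta x * defect eps psi x) = (fun x => (theta x * psi x + eps / 6 * (theta x * dn 2 psi x)) - theta x * lmult eps psi x)); last first.
    by apply/funext => x; rewrite /defect; ring.
  rewrite (intRB (L1D i1 (L1Z (eps / 6) i2)) i3) (intRD i1 (L1Z (eps / 6) i2)) (intRZ _ i2) => ->.
  have tn0 : 2 * pi != 0 :> R by rewrite gt_eqF.
  have alg (A B C e p : R) : p != 0 -> A + e * B - p^-1 * C = p^-1 * (p * A + e * (p * B) - C).
    by move=> p0; field.
  exact: alg.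
rewrite E normrM ger0_norm; last by rewrite invr_ge0 ltW.
rewrite ler_pdivrMl//.
have p4 := spec_L1 (test_bcs tt4) tp; have p5 := L1Z (eps ^+ 2) (L1_norm p4).
have pc := spec_cauchy (test_bcs tt4) tp.
apply: (@le_trans _ _ (eps ^+ 2 * (2 * pi * (L2norm (dn 4 theta) * L2norm psi)))); last first.
  by rewrite le_eqVlt; apply/orP; left; apply/eqP; ring.
apply: (le_trans _ (ler_wpM2l (sqr_ge0 eps) pc)); rewrite -(intRZ _ (L1_norm p4)).
apply: norm_intR_le => // [|xi]; first by apply: L1B => //; apply: L1D => //; exact: L1Z.
rewrite (spec_dn2 theta xi tp).
have -> : spec (dn 4 theta) psi xi = xi ^+ 4 * spec theta psi xi.
  have -> : dn 4 theta = dn 2 (dn 2 theta) by rewrite dnD.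
  rewrite specC (spec_dn2 psi xi (test_dn 2 tt)) specC.
  rewrite [spec (dn 2 theta) psi xi]specC (spec_dn2 psi xi tt) specC; ring.
rewrite (_ : _ + _ - _ = (1 - (Num.sqrt eps * xi) ^+ 2 / 6 - leps eps xi) * spec theta psi xi); last first.
  by rewrite exprMn sqr_sqrtr//; field.
rewrite normrM (normrM (xi ^+ 4)) mulrA; apply: ler_wpM2r => //.
rewrite (le_trans (lsym_approx _))// exprMn.
rewrite (_ : Num.sqrt eps ^+ 4 = (Num.sqrt eps ^+ 2) ^+ 2); last by rewrite -exprM.
by rewrite sqr_sqrtr// ler_wpM2l ?sqr_ge0// ler_norm.
Qed.

Lemma defect_bound eps f psi : 0 <= eps -> Hinf f -> test_fun psi ->
  `|intR (fun x => f x * defect eps psi x)| <= eps ^+ 2 * L2norm (dn 4 f) * L2norm psi.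
Proof.
move=> e0 hf tp; have lG := defect_L2 eps tp.
have h1 := cvg_norm (dens_pair (m := 0) hf lG).
have h2 : eps ^+ 2 * (L2norm (dn 4 f) + L2norm (fun x => dn 4 (fun y => cutoff n y * f y) x - dn 4 f x)) * L2norm psi
    @[n --> \oo] --> eps ^+ 2 * (L2norm (dn 4 f) + 0) * L2norm psi.
  apply: cvgM; last exact: cvg_cst.
  apply: cvgM; first exact: cvg_cst.
  by apply: cvgD; [exact: cvg_cst|exact: cut_dense].
rewrite addr0 in h2.
apply: (ler_cvg_to (h1 _) h2); apply: nearW => n.
have tc : test_fun (fun y => cutoff n y * f y).
  by apply: testMr; [exact: cutoff_test|exact: Hinf_smooth].
apply: (le_trans (defect_test e0 tc tp)).
apply: ler_wpM2r; first exact: L2norm_ge0.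
apply: ler_wpM2l; first exact: sqr_ge0.
have l4 := Hinf_L2 (Hinf_dn 4 hf).
have l5 : L2 (dn 4 (fun y => cutoff n y * f y)) by exact/bcs_L2/test_bcs/test_dn.
have := L2normD l4 (L2B l5 l4); congr (_ <= _); congr L2norm.
by apply/funext => x; rewrite addrC subrK.
Qed.

End Multiplier.

(** * Energy estimates *)

Section TwoVariables.
Variable R : realType.

(** An open set of the plane is a countable union of boxes with rational corners, and boxes are
    measurable for the product sigma-algebra. *)
Lemma cont2_meas (f : R * R -> R) : continuous f -> measurable_fun setT f.
Proof.
move=> /continuousP cf; apply: (measurability _ (RGenOpens.measurableE R)).
move=> _ [_ [a [b ->] <-]]; rewrite setTI.
have oU : open (f @^-1` `]a, b[) by exact/cf/interval_open.
set U := f @^-1` _ in oU *.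
pose box (q : (rat * rat) * (rat * rat)) : set (R * R) :=
  `]ratr q.1.1, ratr q.1.2[ `*` `]ratr q.2.1, ratr q.2.2[.
(* Boxes not contained in [U] are replaced by the empty set, so the union may range over all
   rational corners. *)
pose G q : set (R * R) := if asbool (box q `<=` U) then box q else set0.
have -> : U = \bigcup_(r1 in [set: rat]) \bigcup_(r2 in [set: rat])
    \bigcup_(r3 in [set: rat]) \bigcup_(r4 in [set: rat]) G ((r1, r2), (r3, r4)).
  apply/seteqP; split=> [[x y] Uxy|p].
    have : nbhs (x, y) U by exact: open_nbhs_nbhs.
    move=> /nbhs_ballP[e /= e0 eU].
    have lt1 (z : R) : z - e < z by rewrite gtrBl.
    have lt2 (z : R) : z < z + e by rewrite ltrDl.
    have [r1] := rat_in_itvoo (lt1 x); rewrite in_itv/= => /andP[a1 b1].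
    have [r2] := rat_in_itvoo (lt2 x); rewrite in_itv/= => /andP[a2 b2].
    have [r3] := rat_in_itvoo (lt1 y); rewrite in_itv/= => /andP[a3 b3].
    have [r4] := rat_in_itvoo (lt2 y); rewrite in_itv/= => /andP[a4 b4].
    exists r1 => //; exists r2 => //; exists r3 => //; exists r4 => //.
    rewrite /G ifT; first by split; rewrite /= in_itv/= ?b1 ?b3.
    apply/asboolP => -[z w] [/=]; rewrite !in_itv/= => /andP[z1 z2] /andP[w1 w2].
    apply: eU; split; rewrite /ball/= ltr_norml; apply/andP; split; lra.
  by move=> [r1 _ [r2 _ [r3 _ [r4 _]]]]; rewrite /G; case: asboolP => // h /h.
do 4!(apply: bigcupT_measurable_rat => ?).
by rewrite /G; case: asboolP => // _; apply: measurableX; exact: measurable_itv.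
Qed.

Lemma cont2_bnd (f : R * R -> R) (M : R) : continuous f ->
  exists C, forall x t, `|x| <= M -> `|t| <= M -> `|f (x, t)| <= C.
Proof.
move=> cf.
have cK : compact (`[- M, M] `*` `[- M, M] : set (R * R)).
  by apply: compact_setX; exact: segment_compact.
have := @continuous_compact _ _ f _ (continuous_subspaceT cf) cK.
move=> /compact_bounded [C [_ hC]].
exists (C + 1) => x t xM tM; apply: (hC (C + 1)); first by rewrite ltrDl.
by exists (x, t) => //; split; rewrite /= in_itv/= -ler_norml.
Qed.

Lemma cont2_sec1 (f : R * R -> R) x : continuous f -> continuous (fun t => f (x, t)).
Proof.
move=> cf t; apply: (@continuous_comp _ _ _ (fun s : R => (x, s)) f); last exact: cf.
exact: (cvg_pair (cvg_cst x) cvg_id).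
Qed.

Lemma cont2_sec2 (f : R * R -> R) t : continuous f -> continuous (fun x => f (x, t)).
Proof.
move=> cf x; apply: (@continuous_comp _ _ _ (fun s : R => (s, t)) f); last exact: cf.
exact: (cvg_pair cvg_id (cvg_cst t)).
Qed.

Lemma cont2_marg (f : R * R -> R) : continuous f -> (forall p, 0 <= f p) ->
  measurable_fun setT (fun t => intR (fun x => f (x, t))).
Proof.
move=> cf f0; apply: (measurableT_comp (@fine_measurable R setT measurableT)).
apply: (@measurable_fun_fubini_tonelli_G _ _ _ _ R (@leb R) (fun p => (f p)%:E)).
  by apply/measurable_EFinP; exact: cont2_meas.
by move=> p; rewrite lee_fin.
Qed.

End TwoVariables.

(** * An abstract energy estimate for skew evolutions with a source *)

Section Energy.
Variable R : realType.
(** One operator [L] covers both flows: [psi + eps/6 psi''] for Airy, which costs the two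
    derivatives in [hL], and [lmult eps] for Whitham. [S] bounds [W] itself and survives in the
    conclusion; [B] bounds its derivatives and enters only errors that vanish as the cutoff is
    released. *)
Variables (W : R -> R -> R) (L : (R -> R) -> R -> R) (K CL S B T : R).
Hypotheses (T0 : 0 <= T) (K0 : 0 <= K) (CL0 : 0 <= CL).
Hypotheses (cW : continuous (fun p : R * R => W p.1 p.2))
  (cWx : continuous (fun p : R * R => pdx W p.1 p.2))
  (cWt : continuous (fun p : R * R => pdt W p.1 p.2)).
Hypothesis dWt : forall x, dif (W x).
Hypothesis hW : forall t, 0 <= t -> Hinf (W ^~ t).
Hypothesis bW : forall t, 0 <= t <= T -> L2norm (W ^~ t) <= S.
Hypothesis bW1 : forall t, 0 <= t <= T -> L2norm (dn 1 (W ^~ t)) <= B.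
Hypothesis bW2 : forall t, 0 <= t <= T -> L2norm (dn 2 (W ^~ t)) <= B.
Hypothesis hL : forall psi, test_fun psi ->
  L2 (L psi) /\ L2norm (L psi) <= CL * (L2norm psi + L2norm (dn 2 psi)).
Hypothesis skewL : forall psi, test_fun psi -> intR (fun x => derive1 psi x * L psi x) = 0.
Hypothesis weak : forall t psi, 0 <= t <= T -> test_fun psi ->
  `|intR (fun x => pdt W x t * psi x) + intR (fun x => pdx W x t * L psi x)| <= K * L2norm psi.

Let S0 : 0 <= S.
Proof. by apply: (le_trans (L2norm_ge0 _) (bW (t := 0) _)); rewrite lexx T0. Qed.

Let B0 : 0 <= B.
Proof. by apply: (le_trans (L2norm_ge0 _) (bW1 (t := 0) _)); rewrite lexx T0. Qed.

Let tail n s := sq (fun x => (1 - cutoff n x) * pdx W x s).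

(* [weak] only tests against compactly supported functions, so [W] is cut off:
   [L (cutoff n * W)] is paired with [W_x - (cutoff n * W)_x] by skewness, and
   this difference is small in L2. *)
Lemma energy_rate : exists2 C, 0 <= C & forall n s, 0 <= s <= T ->
  intR (fun x => pdt W x s * (cutoff n x * W x s)) <=
  K * S + C * (n.+1%:R^-1 + L2norm (fun x => (1 - cutoff n x) * pdx W x s)).
Proof.
have [C1 C10 h1] := cut_dn 1 (bump_test R).
have [C2 C20 h2] := cut_dn 2 (bump_test R).
(* A bound on [L (cutoff n * W)] uniform in [n] and [s]: [S] for the function, and for its second
   derivative the commutator [C2 (S + B)] plus [B]. *)
pose M1 := CL * (S + (C2 * (S + B) + B)).
have M10 : 0 <= M1 by rewrite mulr_ge0// !addr_ge0// mulr_ge0// addr_ge0.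
exists (M1 * (C1 * S + 1)); first by rewrite mulr_ge0// addr_ge0// mulr_ge0.
move=> n s sT; have s0 : 0 <= s by case/andP: sT.
have hs := hW s0; have tc := cutoff_test R n.
pose psi x := cutoff n x * W x s.
have tp : test_fun psi by exact: testMr tc (Hinf_smooth hs).
have [lL bL] := hL tp.
have e0 : 0 <= n.+1%:R^-1 :> R by rewrite invr_ge0.
have e1 : n.+1%:R^-1 <= 1 :> R by rewrite invf_le1 ?ltr0n// ler1n.
have lW := Hinf_L2 hs; have lW1 := Hinf_L2 (Hinf_dn 1 hs); have lW2 := Hinf_L2 (Hinf_dn 2 hs).
have cle (f : R -> R) : L2 f -> L2norm (fun x => cutoff n x * f x) <= L2norm f.
  move=> lf; apply: L2norm_le => // [|x]; first exact: L2_testM.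
  have /andP[c0 c1] := cutoff01 n x; rewrite normrM (ger0_norm c0); exact: ler_piMl.
have np : L2norm psi <= S := le_trans (cle _ lW) (bW sT).
have lp k : L2 (dn k psi) by exact/bcs_L2/test_bcs/test_dn.
have np2 : L2norm (dn 2 psi) <= C2 * (S + B) + B.
  have lc2 := L2_testM tc lW2.
  have := L2normD (L2B (lp 2%N) lc2) lc2.
  rewrite (_ : (fun x => _ + _) = dn 2 psi); last by apply/funext => x; rewrite subrK.
  move=> /le_trans; apply; apply: lerD; last exact: le_trans (cle _ lW2) (bW2 sT).
  apply: (le_trans (h2 _ n hs)); rewrite !big_ord_recr big_ord0/= add0r.
  have n0 := L2norm_ge0 (dn 0 (W ^~ s)); have n1 := L2norm_ge0 (dn 1 (W ^~ s)).
  apply: ler_pM; [exact: mulr_ge0|exact: addr_ge0|exact: ler_piMr|].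
  by apply: lerD; [exact: bW|exact: bW1].
(* With [psi = cutoff n * W], [W_x - psi'] is the tail [(1 - cutoff n) W_x] minus the commutator
   [psi' - cutoff n * W_x]. *)
have D : L2norm (fun x => pdx W x s - derive1 psi x) <=
   C1 * S * n.+1%:R^-1 + L2norm (fun x => (1 - cutoff n x) * pdx W x s).
  have lc1 := L2_testM tc lW1; have lt1 := L2_cut n lW1.
  have l3 := L2B (lp 1%N) lc1.
  have := L2normB lt1 l3.
  rewrite (_ : (fun x => _ - _) = (fun x => pdx W x s - derive1 psi x)); last first.
    by apply/funext => x; rewrite /dn/= /d1 /pdx; ring.
  move=> /le_trans; apply; rewrite addrC; apply: lerD; last exact: lexx.
  apply: (le_trans (h1 _ n hs)); rewrite !big_ord_recr big_ord0/= add0r.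
  rewrite mulrAC; apply: ler_wpM2r => //; apply: ler_wpM2l => //; exact: bW.
have lD : L2 (fun x => pdx W x s - derive1 psi x) by exact: L2B lW1 (lp 1%N).
have E : intR (fun x => pdx W x s * L psi x) = intR (fun x => (pdx W x s - derive1 psi x) * L psi x).
  rewrite (_ : (fun x => (_ - _) * _) = (fun x => pdx W x s * L psi x - derive1 psi x * L psi x)); last first.
    by apply/funext => x; rewrite mulrBl.
  by rewrite (intRB (L2M lW1 lL) (L2M (lp 1%N) lL)) (skewL tp) subr0.
have w := weak sT tp; rewrite E in w.
have cs := cauchy_schwarz lD lL.
have n1 : L2norm (L psi) <= M1.
  by apply: (le_trans bL); apply: ler_wpM2l => //; exact: lerD.
have n2 := L2norm_ge0 (fun x => pdx W x s - derive1 psi x).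
have cs2 := ler_pM n2 (L2norm_ge0 _) D n1.
have Kp := ler_wpM2l K0 np.
set X := L2norm (fun x => (1 - _) * _) in D cs2 *.
have X0 : 0 <= X by exact: L2norm_ge0.
set e := n.+1%:R^-1 in e0 e1 D cs2 *.
have fin : (C1 * S * e + X) * M1 <= M1 * (C1 * S + 1) * (e + X).
  rewrite (mulrC _ M1) -[leRHS]mulrA; apply: ler_wpM2l => //.
  have CS0 : 0 <= C1 * S by exact: mulr_ge0.
  have := mulr_ge0 CS0 X0; move: (C1 * S) => a; rewrite mulrDl mul1r mulrDr; lra.
move: w cs; rewrite -/psi ler_norml ler_norml => /andP[_ w1] /andP[w2 _].
by move: w1 w2 cs2 Kp fin; rewrite -/psi; lra.
Qed.

(** The identity for [d/dt] of the localised energy in integrated form: the fundamental theorem in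
    [t] at each fixed [x], then Fubini. No differentiation under the integral sign is required. *)
Lemma energy_fubini n t : 0 <= t ->
  L1 (fun s => \1_`[0, t] s * (2 * intR (fun x => pdt W x s * (cutoff n x * W x s)))) /\
  intR (fun x => cutoff n x * W x t ^+ 2) - intR (fun x => cutoff n x * W x 0 ^+ 2) =
  intR (fun s => \1_`[0, t] s * (2 * intR (fun x => pdt W x s * (cutoff n x * W x s)))).
Proof.
move=> t0; have tc := cutoff_test R n; have [_ [M hM]] := tc.
pose g (p : R * R) := 2 * (pdt W p.1 p.2 * W p.1 p.2).
have cg : continuous g.
  move=> p; apply: cvgM; first exact: cvg_cst.
  by apply: cvgM; [exact: cWt|exact: cW].
(* [hM] confines [x] to [|x| <= M] and [J] confines [s] to [[0, t]], so this box contains everything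
   where [F] can be nonzero. *)
have [C hC] := cont2_bnd (Num.max M t) cg.
pose J : R -> R := \1_`[0, t].
have iJ : L1 J by exact: indic_itv_L1.
pose F x s := cutoff n x * (J s * g (x, s)).
have mc : measurable_fun setT (@cutoff R n) by apply: cont_meas; exact: test_cont.
have mF : measurable_fun setT (fun p : R * R => F p.1 p.2).
  apply: measurable_funM; first exact: (measurableT_comp mc measurable_fst).
  apply: measurable_funM; first exact: (measurableT_comp (L1_meas iJ) measurable_snd).
  have := cont2_meas cg; congr measurable_fun; apply/funext; by case.
have ic : L1 (fun x => `|C| * cutoff n x) by exact/L1Z/bcs_L1/test_bcs.
have c0 (x : R) : 0 <= cutoff n x by have /andP[] := cutoff01 n x.
have bF x s : `|F x s| <= `|C| * cutoff n x * J s.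
  have [xM|xM] := leP `|x| M; last by rewrite /F (hM _ xM) !(mul0r, mulr0) normr0.
  rewrite /F /J indicE; have [|_] := boolP (s \in _); last by rewrite !(mul0r, mulr0) normr0.
  rewrite inE/= in_itv/= => /andP[s0 st].
  rewrite mul1r mulr1 normrM (ger0_norm (c0 x)) mulrC; apply: ler_wpM2r => //.
  apply: (le_trans _ (ler_norm C)); apply: hC; rewrite le_max; first by rewrite xM.
  by rewrite (ger0_norm s0) st orbT.
have iE := L1_marg2 mF ic iJ bF; have E := FubiniR mF ic iJ bF.
have E2 : (fun s => intR (F ^~ s)) =
    (fun s => \1_`[0, t] s * (2 * intR (fun x => pdt W x s * (cutoff n x * W x s)))).
  apply/funext => s.
  have i1 : L1 (fun x => pdt W x s * (cutoff n x * W x s)).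
    have cs : continuous (fun x => pdt W x s * W x s).
      move=> x; apply: cvgM; first exact: (cont2_sec2 (f := fun p => pdt W p.1 p.2)).
      exact: (cont2_sec2 (f := fun p => W p.1 p.2)).
    have := bcs_L1 (bcsMc (test_bcs tc) cs); congr L1; apply/funext => x; ring.
  rewrite -(intRZ 2 i1) -(intRZ _ (L1Z 2 i1)); congr intR; apply/funext => x.
  by rewrite /F /g /J /=; ring.
have E1 x : intR (F x) = cutoff n x * W x t ^+ 2 - cutoff n x * W x 0 ^+ 2.
  have cWxs : continuous (W x) by exact: (cont2_sec1 (f := fun p => W p.1 p.2)).
  have dWx : dif (W x) by exact: dWt.
  have [dg dgE] := difM dWx dWx.
  have gE : derive1 (fun s => W x s * W x s) = fun s => g (x, s).
    by rewrite dgE; apply/funext => s; rewrite /g /pdt /=; ring.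
  have cgx : continuous (derive1 (fun s => W x s * W x s)) by rewrite gE; exact: cont2_sec1.
  have := FTC_itv t0 dg cgx; rewrite gE => ftc.
  have iJg : L1 (fun s => J s * g (x, s)).
    apply: bcs_L1; apply: bcsMc; last exact: cont2_sec1.
    split; first exact: L1_meas iJ.
    exists t, 1; split=> s; rewrite /J indicE.
      by case: (_ \in _); rewrite ?normr1 ?normr0.
    move=> ts; rewrite memNset//= in_itv/= => /andP[s0 st].
    by move: ts; rewrite (ger0_norm s0) ltNge st.
  by rewrite /F (intRZ _ iJg) ftc !expr2 mulrBr.
split; first by rewrite -E2.
rewrite -E2 -E; under [in RHS]eq_fun do rewrite E1.
have isq s : L1 (fun x => cutoff n x * W x s ^+ 2).
  apply: bcs_L1; apply: (bcsMc (test_bcs tc)) => x.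
  have h : {for x, continuous (W ^~ s)} by exact: (cont2_sec2 (f := fun p => W p.1 p.2)).
  by have := cvgM h h; exact.
by rewrite (intRB (isq t) (isq 0)).
Qed.

(** [energy_rate] is integrated over [[0, t]], where the tails stay below [B] and vanish pointwise
    in [s], so dominated convergence removes them. *)
Lemma energy_estimate t : 0 <= t <= T -> sq (W ^~ t) <= sq (W ^~ 0) + 2 * K * T * S.
Proof.
move=> /andP[t0 tT]; have [C C0 rate] := energy_rate.
have l0 := Hinf_L2 (hW (lexx 0)); have lt := Hinf_L2 (hW t0).
pose J : R -> R := \1_`[0, t].
have iJ : L1 J by exact: indic_itv_L1.
have J0 s : 0 <= J s by rewrite /J indicE; case: (_ \in _).
have mtail n : measurable_fun setT (tail n).
  apply: (@cont2_marg R (fun p => ((1 - cutoff n p.1) * pdx W p.1 p.2) ^+ 2)); last first.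
    by move=> p; exact: sqr_ge0.
  move=> p; have h : (1 - cutoff n q.1) * pdx W q.1 q.2 @[q --> p] --> (1 - cutoff n p.1) * pdx W p.1 p.2.
    apply: cvgM; last exact: cWx.
    apply: cvgB; first exact: cvg_cst.
    apply: (@continuous_comp _ _ _ (fun q : R * R => q.1) (cutoff n)); first exact: cvg_fst.
    exact: (test_cont (cutoff_test R n)).
  have := cvgM h h; exact.
have tail0 n s : 0 <= tail n s by exact: sq_ge0.
have tailB n s : 0 <= s <= T -> tail n s <= B ^+ 2.
  move=> sT; have s0 : 0 <= s by case/andP: sT.
  have l1 := Hinf_L2 (Hinf_dn 1 (hW s0)).
  rewrite /tail -L2norm_sq lerXn2r ?nnegrE ?L2norm_ge0//.
  apply: (le_trans _ (bW1 sT)); apply: L2norm_le => // [|x]; first exact: L2_cut.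
  have /andP[c0 c1] := cutoff01 n x.
  rewrite normrM ger0_norm; last by lra.
  by apply: ler_piMl => //; lra.
have JT s : J s != 0 -> 0 <= s <= T.
  rewrite /J indicE; have [|_] := boolP (s \in _); last by rewrite eqxx.
  by rewrite inE/= in_itv/= => /andP[-> st] _; rewrite (le_trans st tT).
have bJt n s : `|J s * tail n s| <= B ^+ 2 * J s.
  have [->|/JT sT] := eqVneq (J s) 0; first by rewrite mul0r mulr0 normr0.
  rewrite normrM (ger0_norm (J0 s)) (ger0_norm (tail0 n s)) mulrC.
  by apply: ler_wpM2r => //; exact: tailB.
have mJt n : measurable_fun setT (fun s => J s * tail n s).
  by apply: measurable_funM => //; exact: L1_meas iJ.
have iJt n : L1 (fun s => J s * tail n s) := L1_le (mJt n) (L1Z (B ^+ 2) iJ) (bJt n).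
have cvt : intR (fun s => J s * tail n s) @[n --> \oo] --> (0 : R).
  apply: (intR_cvg0 mJt (L1Z (B ^+ 2) iJ) bJt) => s.
  have [->|/JT /andP[s0 _]] := eqVneq (J s) 0.
    by under eq_fun do rewrite mul0r; exact: cvg_cst.
  rewrite -(mulr0 (J s)); apply: cvgM; first exact: cvg_cst.
  have l1 := Hinf_L2 (Hinf_dn 1 (hW s0)).
  have h := cut_tail l1.
  have -> : (fun n => tail n s) = (fun n => L2norm (fun x => (1 - cutoff n x) * pdx W x s) ^+ 2).
    by apply/funext => n; rewrite L2norm_sq.
  by have := cvgM h h; rewrite mulr0; exact.
have [_ cvE] : L1 (fun x => W x t ^+ 2) /\
    intR (fun x => cutoff n x * W x t ^+ 2) @[n --> \oo] --> intR (fun x => W x t ^+ 2).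
  apply: (intR_cvg _ (L2_sqr_L1 lt)) => [n|n x|x].
  - apply: measurable_funM; last by apply: measurable_funX; exact: L2_meas.
    apply: cont_meas; exact: (test_cont (cutoff_test R n)).
  - have /andP[c0 c1] := cutoff01 n x.
    by rewrite normrM (ger0_norm c0) (ger0_norm (sqr_ge0 _)) ler_piMl// sqr_ge0.
  - rewrite -[X in _ --> X]mul1r; apply: cvgM; [exact: cutoff_cvg|exact: cvg_cst].
(* The cutoff is released at a fixed [b]; only afterwards does [b] tend to 0. *)
have main b : 0 < b -> sq (W ^~ t) <= sq (W ^~ 0) + (2 * K * S + 2 * C * b) * t.
  move=> b0.
  pose U n := sq (W ^~ 0) + (2 * K * S + 2 * C * (n.+1%:R^-1 + b)) * t +
    2 * C / b * intR (fun s => J s * tail n s).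
  have cU : U n @[n --> \oo] --> sq (W ^~ 0) + (2 * K * S + 2 * C * (0 + b)) * t + 2 * C / b * 0.
    apply: cvgD; last by apply: cvgM; [exact: cvg_cst|exact: cvt].
    apply: cvgD; first exact: cvg_cst.
    apply: cvgM; last exact: cvg_cst.
    apply: cvgD; first exact: cvg_cst.
    apply: cvgM; first exact: cvg_cst.
    by apply: cvgD; [exact: cvg_harmonic|exact: cvg_cst].
  rewrite mulr0 addr0 add0r in cU.
  apply: (ler_cvg_to cvE cU); apply: nearW => n.
  have [iE E] := energy_fubini n t0.
  have E0 : intR (fun x => cutoff n x * W x 0 ^+ 2) <= sq (W ^~ 0).
    have lc := L2_testM (cutoff_test R n) l0.
    apply: le_intR => [||x]; [|exact: L2_sqr_L1|].
      by have := L2M lc l0; congr L1; apply/funext => x; rewrite expr2 mulrA.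
    have /andP[c0 c1] := cutoff01 n x; apply: ler_piMl => //; exact: sqr_ge0.
  have le1 : intR (fun s => \1_`[0, t] s * (2 * intR (fun x => pdt W x s * (cutoff n x * W x s)))) <=
     intR (fun s => (2 * K * S + 2 * C * (n.+1%:R^-1 + b)) * J s + 2 * C / b * (J s * tail n s)).
    apply: le_intR => [||s]; [exact: iE|by apply: L1D; exact: L1Z|].
    rewrite -/J; have [->|Js] := eqVneq (J s) 0; first by rewrite !(mul0r, mulr0) addr0.
    have sT := JT _ Js; have := rate n s sT.
    set X := L2norm _; set I := intR _ => hI.
    have -> : tail n s = X ^+ 2 by rewrite /X L2norm_sq.
    have X0 : 0 <= X by exact: L2norm_ge0.
    rewrite (_ : _ + _ = J s * (2 * K * S + 2 * C * (n.+1%:R^-1 + b) + 2 * C / b * X ^+ 2)); last by ring.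
    apply: ler_wpM2l => //.
    (* The rate contains the tail norm [X], whereas measurability in time was obtained for its
       square [tail n s]; this inequality trades one for the other at the price of [b]. *)
    have Xb : X <= b + X ^+ 2 / b.
      rewrite -(ler_pM2r b0) mulrDl mulfVK ?gt_eqF//.
      by have := sqr_ge0 (X - b); have := sqr_ge0 X; have := sqr_ge0 b; rewrite sqrrB !expr2; nra.
    have := ler_wpM2l C0 Xb; rewrite mulrDr => h2.
    rewrite (_ : 2 * C / b * X ^+ 2 = 2 * (C * (X ^+ 2 / b))); last by ring.
    move: hI h2; move: (n.+1%:R^-1) (X ^+ 2 / b) => r q hI h2.
    by lra.
  rewrite (intRD (L1Z _ iJ) (L1Z _ (iJt n))) (intRZ _ iJ) (intRZ _ (iJt n)) in le1.
  rewrite /J (intR_indic_itv t0) subr0 -/J in le1.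
  rewrite -/J in E; rewrite -E in le1; rewrite /U.
  apply: (le_trans (y := intR (fun x => cutoff n x * W x 0 ^+ 2) + ((2 * K * S + 2 * C * (n.+1%:R^-1 + b)) * t +
    2 * C / b * intR (fun s => J s * tail n s)))); first by rewrite -lerBlDl.
  by rewrite -addrA lerD2r.
have KS0 : 0 <= K * S by exact: mulr_ge0.
have le2 : sq (W ^~ t) <= sq (W ^~ 0) + 2 * K * S * t.
  apply/ler_addgt0Pr => e e0.
  pose b := e / (2 * (C + 1) * (t + 1)).
  have D0 : 0 < 2 * (C + 1) * (t + 1) by rewrite !mulr_gt0// ltr_wpDl.
  have b0 : 0 < b by exact: divr_gt0.
  have be : b * (2 * (C + 1) * (t + 1)) = e by rewrite /b mulfVK// gt_eqF.
  have := main b b0.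
  have : 2 * C * b * t <= e.
    rewrite -be (_ : 2 * C * b * t = b * (2 * C * t)); last by ring.
    by apply: ler_wpM2l; [exact: ltW|have := mulr_ge0 C0 t0; lra].
  by lra.
apply: (le_trans le2); rewrite lerD2l.
rewrite (_ : 2 * K * T * S = 2 * K * S * T); last by ring.
by apply: ler_wpM2l => //; rewrite -mulrA mulr_ge0.
Qed.

End Energy.

(** * Symmetry of mixed partial derivatives *)

Section Schwarz.
Variable R : realType.

Lemma dq_cvg (f : R -> R) x : dif f ->
  n.+1%:R * (f (x + n.+1%:R^-1) - f x) @[n --> \oo] --> derive1 f x.
Proof.
move=> df; rewrite derive1E.
have /cvgr_dnbhsP h : h^-1 *: (f (h *: 1 + x) - f x) @[h --> 0^'] --> 'D_1 f x := df x.
have {}h := h (fun n => n.+1%:R^-1 : R) (conj (fun n => _) cvg_harmonic).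
have -> : (fun n => n.+1%:R * (f (x + n.+1%:R^-1) - f x)) =
    (fun n => (n.+1%:R^-1 : R)^-1 *: (f (n.+1%:R^-1 *: 1 + x) - f x)).
  by apply/funext => n; rewrite invrK [_ *: 1]mulr1 (addrC x).
by apply: h => n; rewrite invr_eq0 pnatr_eq0.
Qed.

Lemma mvt_step (f : R -> R) x h : 0 < h -> dif f ->
  exists2 c, `|c - x| <= h & f (x + h) - f x = derive1 f c * h.
Proof.
move=> h0 df; have xh : x < x + h by rewrite ltrDl.
have [c] := MVT xh (fun y _ => dif_is y df) (continuous_subspaceT (dif_cont df)).
rewrite in_itv/= => /andP[c1 c2] E; exists c; last by rewrite E addrAC subrr add0r.
by rewrite ler_norml; apply/andP; split; lra.
Qed.

(** [mixed] takes time derivatives first, so [smooth2] says nothing directly about the value of the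
    time derivative of a space derivative, which the energy estimate involves. Continuity is assumed
    of one mixed derivative, existence of the other. *)
Lemma schwarz (f : R -> R -> R) :
  (forall x, dif (f x)) -> (forall t, dif (f ^~ t)) -> (forall x, dif (pdx f x)) ->
  (forall t, dif (pdt f ^~ t)) -> continuous (fun p : R * R => pdx (pdt f) p.1 p.2) ->
  pdt (pdx f) = pdx (pdt f).
Proof.
move=> ft fx fxt ftx cg; apply/funext => x; apply/funext => t.
pose h n : R := n.+1%:R^-1.
have h0 n : 0 < h n by rewrite invr_gt0.
(* The second difference of [f], by the mean value theorem first in [t], then in [x]. *)
have D (k m : nat) : exists c d, [/\ `|c - x| <= h m, `|d - t| <= h k &
    m.+1%:R * ((f (x + h m) (t + h k) - f (x + h m) t) - (f x (t + h k) - f x t))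
     = pdx (pdt f) c d * h k].
  have [dB dBE] := difB (ft (x + h m)) (ft x).
  have [d dt E1] := mvt_step t (h0 k) dB.
  have [c cx E2] := mvt_step x (h0 m) (ftx d).
  exists c, d; split => //; move: E1; rewrite dBE => E1.
  have {}E1 : (f (x + h m) (t + h k) - f (x + h m) t) - (f x (t + h k) - f x t) =
      (pdt f (x + h m) d - pdt f x d) * h k by rewrite /pdt -E1; ring.
  have hm : m.+1%:R * h m = 1 by rewrite /h mulfV// pnatr_eq0.
  rewrite E1 E2 -/(pdx (pdt f) c d); move: (pdx _ c d) => p.
  by rewrite mulrA mulrCA hm mulr1.
apply/eqP; rewrite -subr_eq0 -normr_le0; apply/ler_addgt0Pr => e e0; rewrite add0r.
have /cvgrPdist_le/(_ e e0) := cg (x, t).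
move=> [[A1 A2] [/= /nbhs_ballP[r1 /= r10 B1] /nbhs_ballP[r2 /= r20 B2]] hA].
have near1 r : 0 < r -> \forall n \near \oo, h n < r.
  move=> r0; have /cvgrPdist_lt/(_ r r0) := @cvg_harmonic R.
  by apply: filterS => n; rewrite sub0r normrN ger0_norm// ltW// h0.
(* The space increment tends to 0 first, at a fixed time increment; the bound is uniform in [k], so
   the time increment can follow. *)
have bk k : h k < r2 -> `|k.+1%:R * (pdx f x (t + h k) - pdx f x t) - pdx (pdt f) x t| <= e.
  move=> hk; have [dB dBE] := difB (fx (t + h k)) (fx t).
  have cq := dq_cvg (x := x) dB; rewrite dBE in cq.
  have cc : `|k.+1%:R * (m.+1%:R * (f (x + m.+1%:R^-1) (t + h k) - f (x + m.+1%:R^-1) t -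
     (f x (t + h k) - f x t))) - pdx (pdt f) x t| @[m --> \oo] -->
     `|k.+1%:R * (pdx f x (t + h k) - pdx f x t) - pdx (pdt f) x t|.
    apply: cvg_norm; apply: cvgB; last exact: cvg_cst.
    by apply: cvgM; [exact: cvg_cst|exact: cq].
  apply: (ler_cvg_to cc (cvg_cst e)); near=> m.
  have [c [d [cx dt ->]]] := D k m.
  rewrite (_ : k.+1%:R * _ = pdx (pdt f) c d); last by rewrite /h mulrCA mulfV ?mulr1// pnatr_eq0.
  rewrite distrC; apply: (hA (c, d)); split.
  - apply: B1; rewrite /ball/= distrC; apply: (le_lt_trans cx); near: m; exact: near1.
  - by apply: B2; rewrite /ball/= distrC; apply: (le_lt_trans dt).
have ck : `|k.+1%:R * (pdx f x (t + h k) - pdx f x t) - pdx (pdt f) x t| @[k --> \oo] -->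
    `|pdt (pdx f) x t - pdx (pdt f) x t|.
  by apply: cvg_norm; apply: cvgB; [exact: dq_cvg|exact: cvg_cst].
apply: (ler_cvg_to ck (cvg_cst e)); near=> k; apply: bk; near: k; exact: near1.
Unshelve. all: by end_near. Qed.

End Schwarz.

(** * Derivatives of solutions and their energy estimate *)

Section Solutions.
Variable R : realType.
Implicit Types u v : R -> R -> R.

Lemma iter_pdxE k u t : (fun x => iter k (@pdx R) u x t) = dn k (u ^~ t).
Proof. by elim: k => [//|k IH]; rewrite dnS -IH. Qed.

Lemma iter_pdx_at k u x t : iter k (@pdx R) u x t = dn k (u ^~ t) x.
Proof. by rewrite -iter_pdxE. Qed.

Lemma mixed_dif1 n m u t : smooth2 u -> dif (mixed n m u ^~ t).
Proof. by move=> su x; have [] := su n m x t. Qed.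

Lemma mixed_dif2 n m u x : smooth2 u -> dif (mixed n m u x).
Proof. by move=> su t; have [_ []] := su n m x t. Qed.

Lemma mixed_cont n m u : smooth2 u -> continuous (fun p : R * R => mixed n m u p.1 p.2).
Proof. by move=> su [x t]; have [_ []] := su n m x t. Qed.

Lemma pdt_iter k u : smooth2 u -> pdt (iter k (@pdx R) u) = mixed k 1 u.
Proof.
move=> su; elim: k => [//|k IH].
transitivity (pdx (pdt (iter k (@pdx R) u))); last by rewrite IH.
apply: schwarz.
- by move=> x; exact: (@mixed_dif2 k 0).
- by move=> t; exact: (@mixed_dif1 k 0).
- by move=> x; exact: (@mixed_dif2 k.+1 0).
- by move=> t; rewrite IH; exact: mixed_dif1.
- by rewrite IH; exact: (@mixed_cont k.+1 1).
Qed.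

Lemma smooth2_sec m u t : smooth2 u -> smooth1 (mixed 0 m u ^~ t).
Proof. by move=> su n x; rewrite -iter_pdxE; exact: (@mixed_dif1 n m). Qed.

Lemma mixed1_at k u x t : mixed k 1 u x t = dn k (pdt u ^~ t) x.
Proof. exact: (iter_pdx_at k (pdt u)). Qed.

Lemma sol_Hinf u t : sol_class u -> 0 <= t -> Hinf (u ^~ t).
Proof.
move=> [su [lu _]] t0; split=> [|n]; first exact: (@smooth2_sec 0).
by rewrite -iter_pdxE; exact: lu.
Qed.

Lemma sol_bound k u T : sol_class u ->
  exists C, forall t, 0 <= t <= T -> L2norm (dn k (u ^~ t)) <= C.
Proof.
move=> [_ [_ bu]]; have [C hC] := bu k T; exists C => t /hC.
by rewrite iter_pdxE.
Qed.

Lemma mixedB n m u v : smooth2 u -> smooth2 v ->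
  mixed n m (fun x t => u x t - v x t) = fun x t => mixed n m u x t - mixed n m v x t.
Proof.
move=> su sv; elim: n => [|n IH].
  elim: m => [//|m IH]; rewrite /mixed/= -/(mixed 0 m _) [iter m _ _]IH.
  apply/funext => x; have [_ E] := difB (@mixed_dif2 0 m _ x su) (@mixed_dif2 0 m _ x sv).
  exact: E.
rewrite /mixed iterS -/(mixed n m _) IH; apply/funext => x; apply/funext => t.
have [_ E] := difB (@mixed_dif1 n m _ t su) (@mixed_dif1 n m _ t sv).
by rewrite /pdx E.
Qed.

Lemma iter_pdxB k u v : smooth2 u -> smooth2 v ->
  iter k (@pdx R) (fun x t => u x t - v x t) =
  fun x t => iter k (@pdx R) u x t - iter k (@pdx R) v x t.
Proof. exact: (@mixedB k 0). Qed.

Lemma sol_classB u v : sol_class u -> sol_class v -> sol_class (fun x t => u x t - v x t).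
Proof.
move=> Hu Hv; have [su [lu bu]] := Hu; have [sv [lv bv]] := Hv.
have E k := iter_pdxB k su sv.
split; [|split].
- move=> n m x t; rewrite mixedB//; split; [|split].
  + by have [] := difB (@mixed_dif1 n m _ t su) (@mixed_dif1 n m _ t sv).
  + by have [] := difB (@mixed_dif2 n m _ x su) (@mixed_dif2 n m _ x sv).
  + by apply: cvgB; exact: mixed_cont.
- by move=> k t t0; rewrite E; apply: L2B; [exact: lu|exact: lv].
- move=> k T; have [C hC] := bu k T; have [D hD] := bv k T.
  exists (C + D) => t tT; have t0 : 0 <= t by case/andP: tT.
  rewrite E; apply: (le_trans (L2normB (lu k t t0) (lv k t t0))).
  by apply: lerD; [exact: hC|exact: hD].
Qed.

Lemma sol_energy k u (L : (R -> R) -> R -> R) (K CL t : R) :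
  sol_class u -> 0 <= K -> 0 <= CL -> 0 <= t ->
  (forall psi, test_fun psi ->
    L2 (L psi) /\ L2norm (L psi) <= CL * (L2norm psi + L2norm (dn 2 psi))) ->
  (forall psi, test_fun psi -> intR (fun x => derive1 psi x * L psi x) = 0) ->
  (forall s psi, 0 <= s -> test_fun psi ->
    `|intR (fun x => mixed k 1 u x s * psi x) +
      intR (fun x => dn k.+1 (u ^~ s) x * L psi x)| <= K * L2norm psi) ->
  exists S, [/\ L2norm (dn k (u ^~ t)) <= S,
    (forall S', (forall s, 0 <= s <= t -> L2norm (dn k (u ^~ s)) <= S') -> S <= S') &
    forall s, 0 <= s <= t -> sq (dn k (u ^~ s)) <= sq (dn k (u ^~ 0)) + 2 * K * t * S].
Proof.
move=> Hu K0 CL0 t0 hL skewL weak; have [su _] := Hu.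
pose E := [set L2norm (dn k (u ^~ s)) | s in [set s | 0 <= s <= t]].
have tt : 0 <= t <= t by rewrite t0 lexx.
have Ent : E (L2norm (dn k (u ^~ t))) by exists t.
have [C hC] := sol_bound k t Hu.
have Esup : has_sup E by split; [exists (L2norm (dn k (u ^~ t)))|exists C => _ [s st <-]; exact: hC].
have ubE := sup_upper_bound Esup.
exists (sup E); split; first exact: ubE.
  by move=> S' hS; apply: ge_sup; [exists (L2norm (dn k (u ^~ t)))|move=> _ [s st <-]; exact: hS].
have [C1 hC1] := sol_bound k.+1 t Hu; have [C2 hC2] := sol_bound k.+2 t Hu.
pose W := iter k (@pdx R) u.
have WE s : W ^~ s = dn k (u ^~ s) := iter_pdxE k u s.
have W1 s : dn 1 (W ^~ s) = dn k.+1 (u ^~ s) by rewrite WE dnD.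
have W2 s : dn 2 (W ^~ s) = dn k.+2 (u ^~ s) by rewrite WE dnD.
move=> s st; rewrite -!WE.
apply: (@energy_estimate R W L K CL (sup E) (Num.max C1 C2) t t0 K0 CL0) => //.
- exact: (@mixed_cont k 0).
- exact: (@mixed_cont k.+1 0).
- by rewrite pdt_iter//; exact: mixed_cont.
- by move=> x; exact: (@mixed_dif2 k 0).
- by move=> r r0; rewrite WE; apply: Hinf_dn; exact: sol_Hinf.
- by move=> r rt; rewrite WE; apply: ubE; exists r.
- by move=> r rt; rewrite W1 le_max hC1.
- by move=> r rt; rewrite W2 le_max hC2 ?orbT.
- move=> r psi /andP[r0 _] tp; rewrite pdt_iter//.
  have -> : (fun x => pdx W x r * L psi x) = (fun x => dn k.+1 (u ^~ r) x * L psi x).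
    by apply/funext => x; rewrite -(iter_pdx_at k.+1 u x r).
  exact: weak.
Qed.

End Solutions.

(** * Comparison of the two flows *)

Section Comparison.
Variable R : realType.
Implicit Types (u v : R -> R -> R) (phi psi : R -> R).

Lemma testc_L1 (f psi : R -> R) : continuous f -> test_fun psi -> L1 (fun x => f x * psi x).
Proof.
move=> cf tp; have := bcs_L1 (bcsMc (test_bcs tp) cf).
by congr L1; apply/funext => x; rewrite mulrC.
Qed.

Lemma ibp_dn n f psi : smooth1 f -> test_fun psi ->
  intR (fun x => dn n f x * psi x) = (-1) ^+ n * intR (fun x => f x * dn n psi x).
Proof.
move=> sf; elim: n psi => [|n IH] psi tp; first by rewrite mul1r.
have [_ [M hM]] := tp; have sn := smooth_dn (n := n) sf.
transitivity (- intR (fun x => dn n f x * derive1 psi x)).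
  apply: (@ibp _ (dn n f) psi M (smooth_dif sn) _ (smooth_dif (test_smooth tp)) _ hM).
    exact: smooth_cont (smooth_d1 sn).
  exact: smooth_cont (smooth_d1 (test_smooth tp)).
by rewrite [X in - X](IH _ (test_d1 tp)) exprS mulN1r mulNr -dnSr.
Qed.

Lemma test_skew psi : test_fun psi -> intR (fun x => derive1 psi x * psi x) = 0.
Proof.
move=> tp; have := ibp_dn 1 (test_smooth tp) tp; rewrite expr1 mulN1r.
rewrite (_ : (fun x => psi x * _) = (fun x => dn 1 psi x * psi x)); last first.
  by apply/funext => x; rewrite mulrC.
by rewrite /dn/= /d1; move: (intR _) => I; lra.
Qed.

Lemma airy_op_L2 eps psi : 0 <= eps -> test_fun psi ->
  L2 (fun x => psi x + eps / 6 * dn 2 psi x) /\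
  L2norm (fun x => psi x + eps / 6 * dn 2 psi x) <= (1 + eps / 6) * (L2norm psi + L2norm (dn 2 psi)).
Proof.
move=> e0 tp; have l1 := Hinf_L2 (test_Hinf tp).
have l2 := Hinf_L2 (test_Hinf (test_dn 2 tp)); have l3 := L2Z (eps / 6) l2.
split; first exact: L2D.
apply: (le_trans (L2normD l1 l3)); have e6 : 0 <= eps / 6 by exact: divr_ge0.
rewrite (L2normZ _ l2) (ger0_norm e6).
have n1 := mulr_ge0 e6 (L2norm_ge0 psi); have n2 := L2norm_ge0 (dn 2 psi).
by move: n1 n2; move: (eps / 6) (L2norm psi) (L2norm _) => a b c n1 n2; nra.
Qed.

(** Both terms, [psi' psi] and [psi'' psi'], are half the derivative of a compactly supported
    square. *)
Lemma airy_op_skew eps psi : test_fun psi ->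
  intR (fun x => derive1 psi x * (psi x + eps / 6 * dn 2 psi x)) = 0.
Proof.
move=> tp; have tp1 := test_d1 tp.
have i1 := testc_L1 (test_cont tp1) tp.
have i2 := testc_L1 (test_cont (test_d1 tp1)) tp1.
rewrite (_ : (fun x => _) = (fun x => derive1 psi x * psi x +
   eps / 6 * (derive1 (derive1 psi) x * derive1 psi x))); last first.
  by apply/funext => x; rewrite mulrDr; congr (_ + _); rewrite mulrCA [derive1 psi x * _]mulrC.
by rewrite (intRD i1 (L1Z _ i2)) (intRZ _ i2) (test_skew tp) (test_skew tp1) mulr0 addr0.
Qed.

(** The Airy equation holds pointwise and may be differentiated [k] times; two of the derivatives on
    [u] are then moved to [psi], which puts it in the same form as the Whitham equation. *)
Lemma airy_weak eps phi u k t psi : airy_sol eps phi u -> 0 <= t -> test_fun psi ->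
  intR (fun x => mixed k 1 u x t * psi x) +
  intR (fun x => dn k.+1 (u ^~ t) x * (psi x + eps / 6 * dn 2 psi x)) = 0.
Proof.
move=> [Hu [_ eqn]] t0 tp; have [su _] := Hu; have hu := sol_Hinf Hu t0.
have s n : smooth1 (dn n (u ^~ t)) by exact: smooth_dn (Hinf_smooth hu).
have ut : pdt u ^~ t = fun x => (-1) * (dn 1 (u ^~ t) x + eps / 6 * dn 3 (u ^~ t) x).
  apply/funext => x; have := eqn x t t0; rewrite -!iter_pdx_at.
  by rewrite /= => h; rewrite mulN1r; apply/eqP; rewrite -addr_eq0 addrA h.
have sZ : smooth1 (fun x => eps / 6 * dn 3 (u ^~ t) x) by exact: smoothZ.
have mE x : mixed k 1 u x t = (-1) * (dn k.+1 (u ^~ t) x + eps / 6 * dn k.+3 (u ^~ t) x).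
  rewrite mixed1_at ut (dn_scale _ _ (smoothD (s 1%N) sZ)) (dn_add _ (s 1%N) sZ) (dn_scale _ _ (s 3%N)).
  by rewrite !dnD addn1 addn3.
have c n := smooth_cont (s n).
have i1 := testc_L1 (c k.+1) tp; have i3 := testc_L1 (c k.+3) tp.
have i2 := testc_L1 (c k.+1) (test_dn 2 tp).
rewrite (_ : (fun x => _ * psi x) = (fun x => (-1) * (dn k.+1 (u ^~ t) x * psi x +
   eps / 6 * (dn k.+3 (u ^~ t) x * psi x)))); last by apply/funext => x; rewrite mE; ring.
rewrite (intRZ _ (L1D i1 (L1Z _ i3))) (intRD i1 (L1Z _ i3)) (intRZ _ i3).
rewrite (_ : (fun x => _ * (_ + _)) = (fun x => dn k.+1 (u ^~ t) x * psi x +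
   eps / 6 * (dn k.+1 (u ^~ t) x * dn 2 psi x))); last by apply/funext => x; ring.
rewrite (intRD i1 (L1Z _ i2)) (intRZ _ i2).
have := ibp_dn 2 (s k.+1) tp; rewrite dnD add2n sqrrN expr1n mul1r => ->.
by rewrite mulN1r addNr.
Qed.

Lemma airy_conserve eps phi u k t : 0 <= eps -> airy_sol eps phi u -> 0 <= t ->
  L2norm (dn k (u ^~ t)) <= L2norm (dn k phi).
Proof.
move=> e0 au t0; have [Hu [u0 _]] := au.
have CL0 : 0 <= 1 + eps / 6 by rewrite addr_ge0// divr_ge0.
have weak s psi : 0 <= s -> test_fun psi ->
    `|intR (fun x => mixed k 1 u x s * psi x) + intR (fun x => dn k.+1 (u ^~ s) x *
      (psi x + eps / 6 * dn 2 psi x))| <= 0 * L2norm psi.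
  by move=> s0 tp; rewrite (airy_weak k au s0 tp) normr0 mul0r.
have [S [_ _ hS]] := @sol_energy R k u (fun psi x => psi x + eps / 6 * dn 2 psi x) 0 (1 + eps / 6) t
  Hu (lexx 0) CL0 t0 (fun psi => airy_op_L2 (psi := psi) e0) (airy_op_skew eps) weak.
have := hS t; rewrite t0 lexx => /(_ isT).
have -> : u ^~ 0 = phi by apply/funext.
by rewrite mulr0 !mul0r addr0 => h; apply: ler_wsqrtr.
Qed.

(** The weak equation is tested with [dn k psi], and the derivatives are moved back onto [v]; both
    terms acquire the same sign [(-1)^k], which cancels. *)
Lemma whitham_weak eps phi v k t psi : whitham_sol eps phi v -> 0 <= t -> test_fun psi ->
  intR (fun x => mixed k 1 v x t * psi x) +
  intR (fun x => dn k.+1 (v ^~ t) x * lmult eps psi x) = 0.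
Proof.
move=> [Hv [_ eqn]] t0 tp; have [sv _] := Hv; have hv := sol_Hinf Hv t0.
have st : smooth1 (pdt v ^~ t) by exact: (smooth2_sec (m := 1)).
under eq_fun do rewrite mixed1_at.
under [X in _ + intR X]eq_fun do rewrite dnSr.
rewrite (ibp_dn k st tp).
have := eqn t _ t0 (test_dn k tp).
rewrite (lmult_dn eps k (Hinf_d1 hv) tp) => h.
have := congr1 (fun z => (-1) ^+ k * z) h.
by rewrite mulr0 mulrDr mulrA -exprMn mulrNN mulr1 expr1n mul1r.
Qed.

Lemma comparison_L2 eps phi u v k t : 0 <= eps -> airy_sol eps phi u -> whitham_sol eps phi v ->
  0 <= t -> L2norm (dn k (fun x => u x t - v x t)) <= 2 * eps ^+ 2 * t * L2norm (dn (k + 5) phi).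
Proof.
move=> e0 au wv t0; have [Hu [u0 _]] := au; have [Hv [v0 _]] := wv.
have [su _] := Hu; have [sv _] := Hv.
pose w x t := u x t - v x t; have Hw : sol_class w by exact: sol_classB.
set F := L2norm (dn (k + 5) phi); have F0 : 0 <= F by exact: L2norm_ge0.
have K0 : 0 <= eps ^+ 2 * F by rewrite mulr_ge0// sqr_ge0.
have weak s psi : 0 <= s -> test_fun psi ->
    `|intR (fun x => mixed k 1 w x s * psi x) +
      intR (fun x => dn k.+1 (w ^~ s) x * lmult eps psi x)| <= eps ^+ 2 * F * L2norm psi.
  move=> s0 tp; have hu := Hinf_dn k.+1 (sol_Hinf Hu s0); have hv := Hinf_dn k.+1 (sol_Hinf Hv s0).
  have [ll _] := lmult_L2 eps tp.
  have [ml _] := airy_op_L2 e0 tp.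
  have iu := L2M (Hinf_L2 hu) ll; have iv := L2M (Hinf_L2 hv) ll; have ia := L2M (Hinf_L2 hu) ml.
  have ct z : smooth2 z -> continuous (fun x => mixed k 1 z x s).
    by move=> sz; apply: (cont2_sec2 (f := fun p => mixed k 1 z p.1 p.2)); exact: mixed_cont.
  have ju := testc_L1 (ct _ su) tp; have jv := testc_L1 (ct _ sv) tp.
  (* Subtracting the two weak equations leaves only the difference of the operators acting on [psi],
     paired with the Airy solution. *)
  rewrite (_ : _ + _ = - intR (fun x => dn k.+1 (u ^~ s) x * defect eps psi x)); last first.
    have -> : (fun x => mixed k 1 w x s * psi x) = (fun x => mixed k 1 u x s * psi x - mixed k 1 v x s * psi x).
      by apply/funext => x; rewrite mixedB// mulrBl.
    have -> : (fun x => dn k.+1 (w ^~ s) x * lmult eps psi x) =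
        (fun x => dn k.+1 (u ^~ s) x * lmult eps psi x - dn k.+1 (v ^~ s) x * lmult eps psi x).
      by apply/funext => x; rewrite -!iter_pdx_at iter_pdxB// mulrBl.
    rewrite (intRB ju jv) (intRB iu iv).
    have -> : (fun x => dn k.+1 (u ^~ s) x * defect eps psi x) =
        (fun x => dn k.+1 (u ^~ s) x * (psi x + eps / 6 * dn 2 psi x) - dn k.+1 (u ^~ s) x * lmult eps psi x).
      by apply/funext => x; rewrite /defect mulrBr.
    rewrite (intRB ia iu).
    have := airy_weak k au s0 tp; have := whitham_weak k wv s0 tp.
    move: (intR _) (intR _) (intR _) (intR _) (intR _) => A B C D G h1 h2; lra.
  rewrite normrN; apply: (le_trans (defect_bound e0 hu tp)).
  apply: ler_wpM2r; first exact: L2norm_ge0.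
  apply: ler_wpM2l; first exact: sqr_ge0.
  by rewrite dnD addnC addSnnS; exact: airy_conserve au s0.
have hL psi : test_fun psi ->
    L2 (lmult eps psi) /\ L2norm (lmult eps psi) <= 1 * (L2norm psi + L2norm (dn 2 psi)).
  move=> tp; have [l n] := lmult_L2 eps tp; split => //.
  by rewrite mul1r (le_trans n)// lerDl L2norm_ge0.
have [S [tS Smin hS]] := @sol_energy R k w (lmult eps) (eps ^+ 2 * F) 1 t Hw K0 ler01 t0 hL
  (@lmult_skew R eps) weak.
have S0 := le_trans (L2norm_ge0 _) tS.
pose A := 2 * (eps ^+ 2 * F) * t.
have A0 : 0 <= A by rewrite mulr_ge0// mulr_ge0.
have w0 : sq (dn k (w ^~ 0)) = 0.
  have -> : w ^~ 0 = fun x => 0 * phi x by apply/funext => x; rewrite /w u0 v0 subrr mul0r.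
  have sphi : smooth1 phi.
    have := Hinf_smooth (sol_Hinf Hu (lexx 0)); congr smooth1; apply/funext => x; exact: u0.
  rewrite (dn_scale _ _ sphi) /sq (_ : (fun x => _) = fun=> 0) ?intR0//.
  by apply/funext => x; rewrite mul0r expr0n.
(* The least bound [S] of the norms on [0, t] satisfies [S^2 <= A S]. *)
have SA : S <= Num.sqrt (A * S).
  apply: Smin => s st; apply: ler_wsqrtr; apply: (le_trans (hS s st)).
  by rewrite w0 add0r.
apply: (le_trans tS); rewrite (_ : 2 * eps ^+ 2 * t * F = A); last by rewrite /A; ring.
have [->//|Sn] := eqVneq S 0.
have Sp : 0 < S by rewrite lt_neqAle eq_sym Sn.
rewrite -(ler_pM2r Sp) -[leRHS]sqr_sqrtr ?mulr_ge0// -expr2.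
by rewrite lerXn2r ?nnegrE ?sqrtr_ge0.
Qed.

Lemma Hnorm_ge k m phi : (m <= k)%N -> L2norm (dn m phi) <= Hnorm k phi.
Proof.
move=> mk; rewrite -[leLHS](ger0_norm (L2norm_ge0 _)) -sqrtr_sqr.
apply: ler_wsqrtr; rewrite (bigD1 (Ordinal (mk : (m < k.+1)%N)))//=.
rewrite -[leLHS]addr0; apply: lerD.
  by rewrite ler_peMl ?sqr_ge0// ler1n bin_gt0.
by apply: sumr_ge0 => i _; rewrite mulr_ge0// sqr_ge0.
Qed.

End Comparison.

Theorem theorem2p2 (R : realType) :
  exists N : nat -> R -> R,
    (forall j a, 0 < N j a) /\
    forall (eps : R) (phi : R -> R) (u v : R -> R -> R),
      0 < eps -> Hinf phi ->
      airy_sol eps phi u -> whitham_sol eps phi v ->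
      forall (j : nat) (t : R), 0 <= t ->
        forall x : R,
          `| iter j (@pdx R) u x t - iter j (@pdx R) v x t |
            <= N j (Hnorm (j + 7) phi) * eps ^+ 2 * (1 + t).
Proof.
(* 8 is the factor 2 of [sup_bound], times the two norms in it, times the factor 2 of
   [comparison_L2]. Adding 1 to [|a|] makes the constant positive for every [a]. *)
exists (fun _ a => 8 * (`|a| + 1)); split=> [_ a|].
  by rewrite mulr_gt0// ltr_wpDl.
move=> eps phi u v eps0 hphi au wv j t t0 x; have e0 := ltW eps0.
have [Hu _] := au; have [Hv _] := wv.
have hw := HinfB (sol_Hinf Hu t0) (sol_Hinf Hv t0).
have sb := sup_bound x (Hinf_dn j hw).
have -> : iter j (@pdx R) u x t - iter j (@pdx R) v x t = dn j (fun x => u x t - v x t) x.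
  have [su _] := Hu; have [sv _] := Hv.
  by rewrite -(iter_pdx_at j (fun x t => u x t - v x t)) iter_pdxB.
apply: (le_trans sb); set H := Hnorm (j + 7) phi.
have H0 : 0 <= H by exact: sqrtr_ge0.
(* The range [k <= j + 2] is what [k + 5 <= j + 7] allows; it is applied with [k = j] and
   [k = j + 1]. *)
have b k : (k <= j + 2)%N -> L2norm (dn k (fun x => u x t - v x t)) <= 2 * eps ^+ 2 * t * H.
  move=> kj; apply: (le_trans (comparison_L2 k e0 au wv t0)).
  apply: ler_wpM2l; first by rewrite !mulr_ge0// sqr_ge0.
  by apply: Hnorm_ge; move: kj; rewrite -(leq_add2r 5) -addnA.
have b0 := b j (leq_addr _ _); have b1 := b j.+1; rewrite -addn1 leq_add2l in b1.
have {}b1 := b1 isT; rewrite addn1 dnS in b1.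
rewrite (ger0_norm H0).
have e2 : 0 <= eps ^+ 2 by exact: sqr_ge0.
have h1 : 0 <= eps ^+ 2 * t by exact: mulr_ge0.
have h2 : 0 <= eps ^+ 2 * H by exact: mulr_ge0.
move: b0 b1 e2 h1 h2; move: (L2norm _) (L2norm _) => X Y b0 b1 e2 h1 h2.
apply: (le_trans (y := 8 * (eps ^+ 2 * t * H))); first by lra.
by lra.
Qed.
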